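(* Let $q$ be an odd prime. The characters of the real irreducible representations of $\mathrm{SL}_2(q)$ are given by $$\mathbf{1},\ \psi,\ \chi_{2i},\ 2\chi_{2i'+1},\ \theta_{2j},\ 2\theta_{2j'+1}$$ for all integers $i,i',j,j'$ with $1\le 2i,\,2i'+1\le (q-3)/2$ and $1\le 2j,\,2j'+1\le (q-1)/2$, together with - $\xi_1,\ \xi_2,\ 2\eta_1,\ 2\eta_2$ if $q\equiv 1\pmod 4$; - $2\operatorname{Re}\xi_1=\xi_1+\xi_2$ and $2\operatorname{Re}\eta_1=\eta_1+\eta_2$ if $q\equiv 3\pmod 4$.
   Context: $\mathrm{SL}_2(q)$ is the group of $2\times 2$ matrices of determinant $1$ over $\mathbb{F}_q$. Let $\nu$ be a generator of $\mathbb{F}_q^\times$ and put $\mathbf{1}=\begin{pmatrix}1&0\\0&1\end{pmatrix}$, $z=\begin{pmatrix}-1&0\\0&-1\end{pmatrix}$, $c=\begin{pmatrix}1&0\\1&1\end{pmatrix}$, $d=\begin{pmatrix}1&0\\ \nu&1\end{pmatrix}$, $a=\begin{pmatrix}\nu&0\\0&\nu^{-1}\end{pmatrix}$, and let $b$ be an element of order $q+1$. The conjugacy classes of $\mathrm{SL}_2(q)$ are represented by $\mathbf{1},z,c,d,zc,zd,a^l,b^m$ with $1\le l\le (q-3)/2$, $1\le m\le (q-1)/2$. Let $\epsilon=(-1)^{(q-1)/2}$, $\zeta_r=\exp(2\pi \sqrt{-1}/r)$ and $\nu_r^s=\zeta_r^s+\zeta_r^{-s}$. The complex irreducible characters of $\mathrm{SL}_2(q)$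 are the following, with $1\le i\le (q-3)/2$ and $1\le j\le (q-1)/2$: $$\begin{array}{l|cccccc} & \mathbf{1} & z & c & d & a^l & b^m\\ \hline \mathbf{1} & 1&1&1&1&1&1\\ \psi & q&q&0&0&1&-1\\ \chi_i & q+1&(-1)^i(q+1)&1&1&\nu_{q-1}^{il}&0\\ \theta_j & q-1&(-1)^j(q-1)&-1&-1&0&-\nu_{q+1}^{jm}\\ \xi_1 & \frac{q+1}{2}&\frac{\epsilon(q+1)}{2}&\frac{1+\sqrt{\epsilon q}}{2}&\frac{1-\sqrt{\epsilon q}}{2}&(-1)^l&0\\ \xi_2 & \frac{q+1}{2}&\frac{\epsilon(q+1)}{2}&\frac{1-\sqrt{\epsilon q}}{2}&\frac{1+\sqrt{\epsilon q}}{2}&(-1)^l&0\\ \eta_1 & \frac{q-1}{2}&-\frac{\epsilon(q-1)}{2}&\frac{-1+\sqrt{\epsilon q}}{2}&\frac{-1-\sqrt{\epsilon q}}{2}&0&(-1)^{m+1}\\ \eta_2 & \frac{q-1}{2}&-\frac{\epsilon(q-1)}{2}&\frac{-1-\sqrt{\epsilon q}}{2}&\frac{-1+\sqrt{\epsilon q}}{2}&0&(-1)^{m+1}\end{array}$$ and $\chi(zc)=\frac{\chi(z)}{\chi(\mathbf 1)}\chi(c)$, $\chi(zd)=\frac{\chi(z)}{\chi(\mathbf 1)}\chi(d)$ for each of these characters $\chi$. The first row is the trivial character, also denoted $\mathbf{1}$. A real irreducible representation is an irreducible representation over $\mathbb{R}$. *)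

(* Defs.v *)
From HB Require Import structures.
From mathcomp Require Import all_boot all_order all_algebra all_fingroup.
From mathcomp Require Import all_solvable all_field all_character.
From mathcomp Require Import complex.
From mathcomp Require Import reals trigo.

Set Implicit Arguments.
Unset Strict Implicit.
Unset Printing Implicit Defensive.

Import Order.TTheory GRing.Theory Num.Theory.
Local Open Scope ring_scope.
Local Open Scope complex_scope.

Section SpecialLinearGroup.
Variable q : nat.

Definition SL2 : {set {'GL_2(q)}} := [set g | \det (GLval g) == 1].

Lemma SL2_group_set : group_set SL2.
Proof.
apply/group_setP; split; first by rewrite inE GL_1E det1.
by move=> g h; rewrite !inE GL_ME det_mulmx => /eqP-> /eqP->; rewrite mulr1.
Qed.

Canonical SL2_group := group SL2_group_set.

Definition mx2 (x y z t : 'F_q) : 'M['F_q]_2 :=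
  \matrix_(i < 2, j < 2)
    if i == 0 then (if j == 0 then x else y) else (if j == 0 then z else t).

Lemma lower_unitmx (x : {unit 'F_q}) (y : 'F_q) :
  mx2 (val x) 0 y (val x)^-1 \is a GRing.unit.
Proof.
by rewrite [_ \is a _]unitmxE (expand_det_row _ 0) !big_ord_recl big_ord0 !mxE /=
  mul0r !addr0 /cofactor det_mx11 !mxE /= mul1r divrr ?unitr1 //; apply: valP.
Qed.

Definition lower (x : {unit 'F_q}) (y : 'F_q) : {'GL_2(q)} :=
  FinRing.unit 'M['F_q]_2 (lower_unitmx x y).

Lemma unitN1 : (-1 : 'F_q) \is a GRing.unit.
Proof. by rewrite unitrN unitr1. Qed.

Definition elt_z : {'GL_2(q)} := lower (FinRing.unit 'F_q unitN1) 0.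
Definition elt_c : {'GL_2(q)} := lower 1%g 1.
Definition elt_d (nu : {unit 'F_q}) : {'GL_2(q)} := lower 1%g (val nu).
Definition elt_a (nu : {unit 'F_q}) : {'GL_2(q)} := lower nu 0.

End SpecialLinearGroup.

Section CharacterTable.
Variables (R : realType) (q : nat) (nu : {unit 'F_q}) (b : {'GL_2(q)}).

Definition zeta (r : nat) : R[i] :=
  cos (2 * pi / r%:R) +i* sin (2 * pi / r%:R).

Definition nu_sum (r s : nat) : R[i] := zeta r ^+ s + zeta r ^- s.

Definition eps : R[i] := (-1) ^+ (q.-1)./2.

Definition sqrt_eps_q : R[i] := sqrtC (eps * q%:R).

(* The value at each class representative, for the row of the table with
   entries v1, vz, vc, vd, va l, vb m at 1, z, c, d, a^l, b^m. *)
Definition row_values (v1 vz vc vd : R[i]) (va vb : nat -> R[i]) :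
    seq ({'GL_2(q)} * R[i]) :=
  let z := elt_z q in let c := elt_c q in
  let d := elt_d nu in let a := elt_a nu in
  [:: (1%g, v1); (z, vz); (c, vc); (d, vd);
      ((z * c)%g, vz / v1 * vc); ((z * d)%g, vz / v1 * vd)]
  ++ [seq ((a ^+ l)%g, va l) | l <- iota 1 ((q - 3)./2)]
  ++ [seq ((b ^+ m)%g, vb m) | m <- iota 1 ((q - 1)./2)].

(* The representatives lie in distinct conjugacy classes of SL_2(q), which they
   exhaust; so for g in SL_2(q) exactly one term of the sum can be nonzero. *)
Definition table_row v1 vz vc vd va vb (g : {'GL_2(q)}) : R[i] :=
  \sum_(r <- row_values v1 vz vc vd va vb)
    if g \in (r.1 ^: SL2 q)%g then r.2 else 0.

Definition psi :=
  table_row q%:R q%:R 0 0 (fun=> 1) (fun=> -1).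

Definition chi (i : nat) :=
  table_row (q%:R + 1) ((-1) ^+ i * (q%:R + 1)) 1 1
    (fun l => nu_sum (q - 1) (i * l)) (fun=> 0).

Definition theta (j : nat) :=
  table_row (q%:R - 1) ((-1) ^+ j * (q%:R - 1)) (-1) (-1)
    (fun=> 0) (fun m => - nu_sum (q + 1) (j * m)).

Definition xi1 :=
  table_row ((q%:R + 1) / 2) (eps * (q%:R + 1) / 2)
    ((1 + sqrt_eps_q) / 2) ((1 - sqrt_eps_q) / 2)
    (fun l => (-1) ^+ l) (fun=> 0).

Definition xi2 :=
  table_row ((q%:R + 1) / 2) (eps * (q%:R + 1) / 2)
    ((1 - sqrt_eps_q) / 2) ((1 + sqrt_eps_q) / 2)
    (fun l => (-1) ^+ l) (fun=> 0).

Definition eta1 :=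
  table_row ((q%:R - 1) / 2) (- (eps * (q%:R - 1) / 2))
    ((-1 + sqrt_eps_q) / 2) ((-1 - sqrt_eps_q) / 2)
    (fun=> 0) (fun m => (-1) ^+ m.+1).

Definition eta2 :=
  table_row ((q%:R - 1) / 2) (- (eps * (q%:R - 1) / 2))
    ((-1 - sqrt_eps_q) / 2) ((-1 + sqrt_eps_q) / 2)
    (fun=> 0) (fun m => (-1) ^+ m.+1).

End CharacterTable.

(* f restricted to G is the character of an irreducible representation of G
   over R; only the values of f on G matter. *)
Definition real_irr_character (R : realType) (gT : finGroupType)
    (G : {group gT}) (f : gT -> R[i]) : Prop :=
  exists n (rG : mx_representation R G n),
    mx_irreducible rG /\ {in G, forall g, f g = (\tr (rG g))%:C}.

(* Main.v *)
(** Every row of the table is realised by an explicit generalized character: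
    [chi_i] and [psi] come from linear characters of the Borel subgroup, and
    [theta_j], [xi_i], [eta_i] are combinations of these with characters induced
    from the centre times the unipotent subgroup and from the cyclic group <b>.
    Since each has norm 1 and positive degree, each is irreducible.

    An irreducible complex representation X, seen as a real one, is either
    irreducible, with character 2 Re chi, or has a real form.  It is irreducible
    if chi is not real.  If chi is real, choose P intertwining X with its conjugate;
    then conj(P) P is a real scalar c, and a real form exists iff c > 0.  The sign
    of c is found from elements t, w with w t w^-1 = t^-1 and w^2 = z: on an
    eigenspace of X(t), the map v |-> conj(v) P X(w) is antilinear with square
    c chi(z)/chi(1), and an antilinear map of negative square needs an even
    dimension.  Every real chi in the table has an eigenvalue of odd multiplicity
    (1 or 3) at t = a or t = b, so it is of real type iff chi(z) > 0.

    The list is complete since the sum of chi(1) chi over it is the regular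
    character. *)

Require Import Defs.
From mathcomp Require Import all_boot all_order all_algebra all_fingroup.
From mathcomp Require Import all_solvable all_field all_character.
From mathcomp Require Import complex.
From mathcomp Require Import reals.
From mathcomp Require Import trigo boolp ring lra zify.

Set Implicit Arguments.
Unset Strict Implicit.
Unset Printing Implicit Defensive.

Import Order.TTheory GRing.Theory Num.Theory.
Import GroupScope GRing.Theory.
Local Open Scope ring_scope.

(** * Pairings of characters and intertwiners *)

(** The rows are mere formulas, and it is not given that the listed classes exhaust the group. This
    is obtained by counting: the classes are distinct and their sizes add up to the group order.
    Every inner product is then a computation on rows. The obstacle is the characters of half
    degree. Removing from a half Gelfand-Graev character all constituents of degree [q], [q + 1],
    [q - 1] with its central sign leaves exactly one of them, of type xi or eta according to that
    sign. Its values at [c] and [d] come from a quadratic Gauss sum, whose square is easy to find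
    and whose sign is not. Twisting the additive character by [nu] changes that sign, so both
    characters are carried along and the sign is never determined. The pairing is bilinear and
    unnormalised, the sum of [f g * h g^-1]. Over any field, a nonzero value for two irreducible
    representations yields a nonzero intertwiner and hence an isomorphism. A real irreducible
    character is therefore identified as soon as it pairs nontrivially with one listed character,
    and it must do so because its pairing with the regular character is [#|G| * f 1]. *)

Section CharacterPairing.
Variables (F : fieldType) (gT : finGroupType) (G : {group gT}).

Definition pairing (f h : gT -> F) : F := \sum_(g in G) f g * h g^-1%g.

Lemma pairingC f h : pairing f h = pairing h f.
Proof.
rewrite /pairing (reindex_inj invg_inj) /=; apply: eq_big => [g|g _].
  by rewrite groupV.
by rewrite invgK mulrC.
Qed.

Lemma eq_pairing f f' h h' :
  {in G, f =1 f'} -> {in G, h =1 h'} -> pairing f h = pairing f' h'.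
Proof.
by move=> ff' hh'; apply: eq_bigr => g Gg; rewrite ff' // hh' ?groupV.
Qed.

Section TwoReps.
Variables (n1 n2 : nat).
Variables (r1 : mx_representation F G n1) (r2 : mx_representation F G n2).

Definition avg_hom (M : 'M[F]_(n1, n2)) :=
  \sum_(g in G) r1 g *m M *m r2 g^-1%g.

Lemma avg_homP M h : h \in G -> r1 h *m avg_hom M = avg_hom M *m r2 h.
Proof.
move=> Gh; rewrite /avg_hom mulmx_sumr mulmx_suml.
rewrite (reindex_inj (mulgI h^-1%g)) /=; apply: eq_big => [g|g Gg].
  by rewrite groupMl ?groupV.
rewrite groupMl ?groupV // in Gg.
rewrite invMg invgK repr_mxM ?groupV // repr_mxM ?groupV // !mulmxA.
by rewrite -repr_mxM ?groupV // mulgV repr_mx1 mul1mx.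
Qed.

(** The entry at (i, j) of the average of the matrix unit E_ij is the sum over g of
    [r1 g i i * r2 g^-1 j j]; summing over i and j gives both traces. A nonzero pairing thus
    exhibits a nonzero intertwiner. *)
Lemma pairing_avg_hom :
  pairing (fun g => \tr (r1 g)) (fun g => \tr (r2 g)) =
  \sum_i \sum_j avg_hom (delta_mx i j) i j.
Proof.
rewrite /pairing /avg_hom.
under [RHS]eq_bigr => i _ do under eq_bigr => j _ do rewrite summxE.
under [RHS]eq_bigr => i _ do rewrite exchange_big /=.
rewrite exchange_big /=; apply: eq_bigr => g _.
rewrite /mxtrace mulr_suml; apply: eq_bigr => i _.
rewrite mulr_sumr; apply: eq_bigr => j _.
rewrite -mulmxA mxE (bigD1 i) //= big1 ?addr0 => [|k ne_ki].
  rewrite mxE (bigD1 j) //= big1 ?addr0 => [|l ne_lj].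
    by rewrite mxE !eqxx mul1r.
  by rewrite mxE (negbTE ne_lj) andbF mul0r.
rewrite mxE big1 ?mulr0 // => l _.
by rewrite mxE (negbTE ne_ki) mul0r.
Qed.

Lemma irr_hom_rsim (M : 'M[F]_(n1, n2)) :
  mx_irreducible r1 -> mx_irreducible r2 -> M != 0 ->
  {in G, forall g, r1 g *m M = M *m r2 g} -> mx_rsim r1 r2.
Proof.
move=> /mx_irrP[_ irr1] /mx_irrP[_ irr2] nzM homM.
have freeM : row_free M.
  have modK : mxmodule r1 (kermx M).
    apply/mxmoduleP => g Gg; apply/sub_kermxP.
    by rewrite -mulmxA homM // mulmxA mulmx_ker mul0mx.
  rewrite -kermx_eq0; apply/negPn/negP => /(irr1 _ modK).
  rewrite -sub1mx => /sub_kermxP; rewrite mul1mx => M0.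
  by rewrite M0 eqxx in nzM.
have fullM : row_full M.
  have modM : mxmodule r2 <<M>>%MS.
    rewrite (eqmx_module _ (genmxE M)); apply/mxmoduleP => g Gg.
    by rewrite -homM // submxMl.
  have := irr2 _ modM; rewrite -mxrank_eq0 genmxE mxrank_eq0 => /(_ nzM).
  by rewrite /row_full genmxE.
have eqn : n1 = n2 by rewrite -(eqP freeM) (eqP fullM).
by exists M.
Qed.

Lemma pairing_neq0_rsim :
  mx_irreducible r1 -> mx_irreducible r2 ->
  pairing (fun g => \tr (r1 g)) (fun g => \tr (r2 g)) != 0 -> mx_rsim r1 r2.
Proof.
move=> irr1 irr2; rewrite pairing_avg_hom => nz.
have [[i j] /= nzij | all0] := pickP (fun p : 'I_n1 * 'I_n2 =>
    avg_hom (delta_mx p.1 p.2) p.1 p.2 != 0); last first.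
  case/eqP: nz; apply: big1 => i _; apply: big1 => j _.
  by apply/eqP; have /= /negbFE := all0 (i, j).
apply: (irr_hom_rsim irr1 irr2 _ (fun g => avg_homP (delta_mx i j) (h := g))).
by apply: contraNneq nzij => ->; rewrite mxE.
Qed.

End TwoReps.

(** By Schur's lemma the average of E_ij is a scalar matrix. Its trace is [#|G|] times the Kronecker
    symbol, so characteristic zero determines the scalar. *)
Lemma pairing_abs_irr n (r : mx_representation F G n) :
  [pchar F] =i pred0 -> mx_absolutely_irreducible r ->
  pairing (fun g => \tr (r g)) (fun g => \tr (r g)) = #|G|%:R.
Proof.
move=> /pcharf0P charF0 absr; rewrite pairing_avg_hom.
have [n_gt0 _] := andP absr.
have nz_n : n%:R != 0 :> F by rewrite charF0 -lt0n.
have avgE i j : avg_hom r r (delta_mx i j) = (#|G|%:R * (i == j)%:R / n%:R)%:M.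
  have : centgmx r (avg_hom r r (delta_mx i j)).
    by apply/centgmxP => h Gh; rewrite avg_homP.
  move/(mx_abs_irr_cent_scalar absr) => /is_scalar_mxP[a Ea].
  rewrite Ea; congr _%:M; apply: (mulIf nz_n); rewrite divfK //.
  transitivity (\tr (avg_hom r r (delta_mx i j))).
    by rewrite Ea mxtrace_scalar mulr_natr.
  rewrite /avg_hom raddf_sum /= (eq_bigr (fun=> (i == j)%:R)) => [|g Gg].
    by rewrite sumr_const mulr_natl.
  rewrite mxtrace_mulC mulmxA -repr_mxM ?groupV // mulVg repr_mx1 mul1mx.
  rewrite /mxtrace (bigD1 i) //= big1 ?addr0 => [|k /negbTE ne_ki].
    by rewrite mxE eqxx.
  by rewrite mxE ne_ki.
under eq_bigr => i _ do under eq_bigr => j _ do rewrite avgE.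
rewrite (eq_bigr (fun=> #|G|%:R / n%:R)) => [|i _].
  by rewrite sumr_const card_ord -[RHS](divfK nz_n) mulr_natr.
rewrite (bigD1 i) //= big1 ?addr0 => [|j /negbTE ne_ji].
  by rewrite !mxE eqxx mulr1n mulr1.
by rewrite !mxE eq_sym ne_ji mulr0n.
Qed.

End CharacterPairing.

(** * Generalized characters *)

Section VirtualCharacters.
Variables (F : numClosedFieldType) (gT : finGroupType) (G : {group gT}).

Let iG : irrType F G := DecSocleType (regular_repr F G).

Lemma pchar'_group : [pchar F]^'.-group G.
Proof. by apply/pgroupP=> p _; rewrite inE /= pchar_num. Qed.

Definition irr_char (i : iG) (g : gT) : F := \tr (irr_repr i g).

Definition vchar (f : gT -> F) := exists m : iG -> int,
  {in G, forall g, f g = \sum_i (m i)%:~R * irr_char i g}.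

Lemma repr_char_decomp n (r : mx_representation F G n) :
  exists m : iG -> nat, {in G, forall g, \tr (r g) = \sum_i (m i)%:R * irr_char i g}.
Proof.
pose sG : socleType r := DecSocleType r.
exists (fun i => \sum_(W : sG | irr_comp iG (socle_repr W) == i) socle_mult W)%N.
move=> g Gg.
have soc1 : (Socle sG :=: 1%:M)%MS.
  by rewrite reducible_Socle1 //; apply: mx_Maschke_pchar pchar'_group.
rewrite -(mxtrace_submod1 (Socle_module sG) soc1) // mxtrace_Socle //.
rewrite (partition_big (fun W : sG => irr_comp iG (socle_repr W)) predT) //=.
apply: eq_bigr => i _; rewrite natr_sum mulr_suml; apply: eq_bigr => W /eqP Wi.
rewrite mulr_natl; congr (_ *+ _).
have /mxtrace_rsim -> // := rsim_irr_comp_pchar iG pchar'_group (socle_irr W).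
by rewrite /irr_char Wi.
Qed.

Lemma vchar_repr n (r : mx_representation F G n) : vchar (fun g => \tr (r g)).
Proof.
have [m Em] := repr_char_decomp r; exists (fun i => (m i)%:Z) => g Gg.
by rewrite Em //; apply: eq_bigr => i _; rewrite pmulrn.
Qed.

Lemma eq_vchar f f' : {in G, f =1 f'} -> vchar f -> vchar f'.
Proof. by move=> eqf [m Em]; exists m => g Gg; rewrite -eqf // Em. Qed.

Lemma vchar0 : vchar (fun=> 0).
Proof. by exists (fun=> 0) => g _; rewrite big1 // => i _; rewrite mul0r. Qed.

Lemma vcharD f h : vchar f -> vchar h -> vchar (fun g => f g + h g).
Proof.
move=> [m Em] [k Ek]; exists (fun i => m i + k i) => g Gg.
by rewrite Em // Ek // -big_split; apply: eq_bigr => i _; rewrite rmorphD mulrDl.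
Qed.

Lemma vcharB f h : vchar f -> vchar h -> vchar (fun g => f g - h g).
Proof.
move=> [m Em] [k Ek]; exists (fun i => m i - k i) => g Gg.
by rewrite Em // Ek // -sumrB; apply: eq_bigr => i _; rewrite rmorphB mulrBl.
Qed.

Lemma vchar_sum (I : Type) (s : seq I) (P : pred I) (f : I -> gT -> F) :
  (forall i, P i -> vchar (f i)) -> vchar (fun g => \sum_(i <- s | P i) f i g).
Proof.
move=> vf; elim: s => [|i s IHs].
  by apply: eq_vchar vchar0 => g _; rewrite big_nil.
case Pi: (P i); last by apply: eq_vchar IHs => g _; rewrite big_cons Pi.
by apply: eq_vchar (vcharD (vf i Pi) IHs) => g _; rewrite big_cons Pi.
Qed.

Lemma pairing_irr_char i j :
  pairing G (irr_char i) (irr_char j) = #|G|%:R *+ (i == j).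
Proof.
case: (eqVneq i j) => [<-|ne_ij] /=.
  rewrite mulr1n; apply: pairing_abs_irr; first exact: pchar_num.
  exact: group_closure_closed_field (socle_irr i).
apply: contraNeq ne_ij; rewrite mulr0n => nz.
apply/socle_rsimP.
exact: pairing_neq0_rsim (socle_irr i) (socle_irr j) nz.
Qed.

Lemma pairing_suml (I : finType) (a : I -> F) (f : I -> gT -> F) h :
  pairing G (fun g => \sum_i a i * f i g) h = \sum_i a i * pairing G (f i) h.
Proof.
rewrite /pairing; under eq_bigr => g _ do rewrite mulr_suml.
rewrite exchange_big; apply: eq_bigr => i _.
by rewrite mulr_sumr; apply: eq_bigr => g _; rewrite mulrA.
Qed.

Lemma pairing_irr_coef (a : iG -> F) j :
  pairing G (fun g => \sum_i a i * irr_char i g) (irr_char j) = #|G|%:R * a j.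
Proof.
rewrite pairing_suml (bigD1 j) //= pairing_irr_char eqxx mulr1n mulrC.
rewrite big1 ?addr0 // => i /negbTE ne_ij.
by rewrite pairing_irr_char ne_ij mulr0n mulr0.
Qed.

(** Integer coefficients whose squares sum to 1 are all zero but one, which is 1 or -1; a natural
    number as value at 1 excludes -1. *)
Lemma vchar_norm1_irr (f : gT -> F) d :
  vchar f -> pairing G f f = #|G|%:R -> f 1%g = d%:R ->
  exists n (r : mx_representation F G n),
    mx_irreducible r /\ {in G, forall g, f g = \tr (r g)}.
Proof.
move=> [m Em] norm1 f1.
have nzG : #|G|%:R != 0 :> F by rewrite pnatr_eq0 -lt0n cardG_gt0.
have sum1 : \sum_i m i ^+ 2 = 1.
  have : #|G|%:R * (\sum_i m i ^+ 2)%:~R = #|G|%:R * 1 :> F.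
    rewrite mulr1 -[RHS]norm1 (eq_pairing Em Em) pairing_suml rmorph_sum mulr_sumr.
    apply: eq_bigr => i _; rewrite pairingC pairing_irr_coef rmorphXn expr2 /=.
    by rewrite mulrCA.
  by move/(mulfI nzG)/eqP; rewrite (eqr_int _ _ 1) => /eqP.
have [i nzi] : exists i, m i != 0.
  apply/existsP; apply: contraT; rewrite negb_exists => /forallP m0.
  have: \sum_i m i ^+ 2 = 0.
    by apply: big1 => i _; rewrite (eqP (negPn (m0 i))).
  by rewrite sum1.
have mi2 : 1 <= m i ^+ 2 by rewrite -gtz0_ge1 exprn_even_gt0.
have rest0 : \sum_(j | j != i) m j ^+ 2 = 0.
  have := sum1; rewrite (bigD1 i) //=.
  have : 0 <= \sum_(j | j != i) m j ^+ 2 by apply: sumr_ge0 => j _; apply: sqr_ge0.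
  by move: mi2; move: (m i ^+ 2) (\sum_(_ | _) _) => u v; lia.
have m0 j : j != i -> m j = 0.
  move=> ne_ji; apply/eqP; rewrite -sqrf_eq0; move/eqP: rest0.
  rewrite psumr_eq0 => [/allP/(_ j)|k _]; last exact: sqr_ge0.
  by rewrite mem_index_enum ne_ji; apply.
have {}Em : {in G, forall g, f g = (m i)%:~R * irr_char i g}.
  move=> g Gg; rewrite Em // (bigD1 i) //= big1 ?addr0 // => j /m0 ->.
  by rewrite mul0r.
have mi1 : m i = 1.
  have : m i ^+ 2 = 1 by have := sum1; rewrite (bigD1 i) //= rest0 addr0.
  move/eqP; rewrite sqrf_eq1 => /orP[] /eqP // miN1.
  have := Em _ (group1 G); rewrite miN1 f1 /irr_char repr_mx1 mxtrace1 => /eqP.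
  rewrite mulN1r -addr_eq0 -natrD pnatr_eq0 addn_eq0 andbC => /andP[/eqP n0 _].
  by have := irr_degree_gt0 i; rewrite n0.
exists _, (irr_repr i); split; first exact: socle_irr.
by move=> g Gg; rewrite Em // mi1 mul1r.
Qed.

End VirtualCharacters.

(** * Induction of linear characters *)

Section InducedLinear.
Variables (F : numFieldType) (gT : finGroupType) (G H : {group gT}).
Variable lam : gT -> F.
Hypothesis sHG : H \subset G.
Hypothesis lamM : {in H &, {morph lam : x y / (x * y)%g >-> x * y}}.

Definition ind_char (g : gT) : F :=
  #|H|%:R^-1 * \sum_(x in G | (x * g * x^-1)%g \in H) lam (x * g * x^-1)%g.

Lemma mxtrace_submod_proj n (r : mx_representation F G n) (P : 'M_n)
    (modP : mxmodule r P) g :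
  g \in G -> P *m P = P -> P *m r g = r g *m P ->
  \tr (submod_repr modP g) = \tr (P *m r g).
Proof.
move=> Gg PP Pr; pose B := row_base P; pose S := in_submod P 1%:M.
have P_SB : P *m S *m B = P.
  by rewrite -in_submodE -[LHS]/(val_submod (in_submod P P)) in_submodK.
have BP : B *m P = B.
  have /submxP[D ED] : (B <= P)%MS by rewrite eq_row_base.
  by rewrite ED -mulmxA PP.
transitivity (\tr (B *m r g *m S)).
  by rewrite /= /submod_mx in_submodE /val_submod /= mul1mx.
move: (B) (S) P_SB BP => {}B {}S P_SB BP.
transitivity (\tr (P *m S *m B *m r g)); last by rewrite P_SB.
rewrite -[in RHS]mulmxA -(mulmxA P) [RHS]mxtrace_mulC -!mulmxA -Pr.
by rewrite (mulmxA B P) BP [RHS]mxtrace_mulC -mulmxA.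
Qed.

Let map_mxG (f : gT -> gT) : 'M[F]_#|G| :=
  \matrix_i delta_mx 0 (gring_index G (f (enum_val i))).

Let map_mxGM f f' : {in G, forall x, f x \in G} ->
  map_mxG f *m map_mxG f' = map_mxG (f' \o f).
Proof.
move=> fG; apply/row_matrixP=> i; rewrite row_mul !rowK -rowE rowK.
by rewrite gring_indexK // fG // enum_valP.
Qed.

Let map_mxG_tr f : {in G, forall x, f x \in G} ->
  \tr (map_mxG f) = \sum_(x in G) (f x == x)%:R.
Proof.
move=> fG; rewrite [RHS](reindex_onto (enum_val) (gring_index G)) /=; last first.
  by move=> x Gx; rewrite gring_indexK.
rewrite /mxtrace; apply: eq_big => [i|i _].
  by rewrite enum_valP gring_valK eqxx.
rewrite !mxE eqxx /= -(inj_eq enum_val_inj) gring_indexK ?fG ?enum_valP //.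
by rewrite eq_sym.
Qed.

(** The inverse makes [L] multiplicative, because row vectors compose translations from left to
    right. *)
Let L h := map_mxG (mulg h^-1%g).

(** The average of left translations weighted by [lam] is an idempotent P of the regular
    representation that commutes with right translations. Its row space is the induced module, on
    which [r g] has trace [\tr (P *m r g)]. *)
Lemma ind_char_repr :
  exists n (r : mx_representation F G n), {in G, forall g, \tr (r g) = ind_char g}.
Proof.
have nzH : #|H|%:R != 0 :> F by rewrite pnatr_eq0 -lt0n cardG_gt0.
pose P := #|H|%:R^-1 *: \sum_(h in H) lam h *: L h.
have LM h k : h \in H -> k \in H -> L h *m L k = L (h * k)%g.
  move=> Hh Hk; rewrite map_mxGM => [|x Gx]; last first.
    by rewrite groupM // groupV (subsetP sHG).
  by apply/row_matrixP => i; rewrite !rowK /= invMg mulgA.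
have PP : P *m P = P.
  rewrite /P -scalemxAl -scalemxAr; congr (_ *: _).
  rewrite mulmx_suml.
  rewrite (eq_bigr (fun=> \sum_(h in H) lam h *: L h)) => [|h Hh]; last first.
    rewrite mulmx_sumr [RHS](reindex_inj (mulgI h)) /=.
    apply: eq_big => [k|k Hk]; first by rewrite groupMl.
    by rewrite -scalemxAl -scalemxAr scalerA LM // lamM.
  by rewrite sumr_const -scaler_nat scalerA mulVf ?scale1r.
pose r := regular_repr F G.
have rE g : r g = map_mxG (mulg^~ g) by [].
have Pr g : g \in G -> P *m r g = r g *m P.
  move=> Gg; rewrite /P -scalemxAl -scalemxAr mulmx_suml mulmx_sumr.
  congr (_ *: _); apply: eq_bigr => h Hh; rewrite -scalemxAl -scalemxAr.
  have Gh := subsetP sHG h Hh.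
  rewrite rE !map_mxGM => [|x Gx|x Gx]; rewrite ?groupM ?groupV //.
  by congr (_ *: _); apply/row_matrixP => i; rewrite !rowK /= mulgA.
have modP : mxmodule r P.
  by apply/mxmoduleP => g Gg; rewrite Pr // submxMl.
exists _, (submod_repr modP) => g Gg.
rewrite mxtrace_submod_proj ?Pr //.
rewrite -Pr // /P -scalemxAl mxtraceZ; congr (_ * _).
rewrite mulmx_suml raddf_sum /=.
rewrite (eq_bigr (fun h => \sum_(x in G) lam h * ((h^-1 * x * g)%g == x)%:R)); last first.
  move=> h Hh; have Gh := subsetP sHG h Hh.
  rewrite -scalemxAl mxtraceZ rE map_mxGM => [|x Gx]; last by rewrite groupM ?groupV.
  by rewrite map_mxG_tr ?mulr_sumr // => x Gx; rewrite /= !groupM ?groupV.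
rewrite exchange_big [RHS]big_mkcondr /=; apply: eq_bigr => x Gx.
have eqE h : ((h^-1 * x * g)%g == x) = (h == (x * g * x^-1)%g).
  apply/eqP/eqP => [Ex|->].
    by rewrite -{2}Ex !invMg !invgK !mulgA mulgK mulgV mul1g.
  by rewrite !invMg invgK !mulgA !mulgKV.
case: ifP => [Hxg|nHxg].
  rewrite (bigD1 _ Hxg) /= eqE eqxx mulr1 big1 ?addr0 // => h /andP[_ ne_h].
  by rewrite eqE (negbTE ne_h) mulr0.
apply: big1 => h Hh; rewrite eqE; case: eqP => [E|_]; last by rewrite mulr0.
by rewrite -E Hh in nHxg.
Qed.

Lemma ind_charE g : g \in G ->
  ind_char g =
    #|'C_G[g]|%:R / #|H|%:R * \sum_(h in H | h \in g ^: G) lam h.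
Proof.
move=> Gg; rewrite /ind_char [_ / _]mulrC -mulrA; congr (_ * _).
rewrite (partition_big (fun x => x * g * x^-1)%g (mem H)) => [|x /andP[] //].
rewrite mulr_sumr [RHS]big_mkcondr /=; apply: eq_bigr => h Hh.
rewrite (eq_bigr (fun=> lam h)) => [|x /andP[_ /eqP-> //]].
rewrite sumr_const.
case: ifP => [/imsetP[y Gy Eh] | nGh].
  rewrite mulr_natl; congr (_ *+ _).
  (* For [h = g ^ y], the solutions x of [x g x^-1 = h] form the left coset of the centralizer of g
     by [y^-1]. *)
  rewrite -(card_lcoset 'C_G[g] y^-1%g); apply: eq_card => x.
  rewrite mem_lcoset invgK in_setI groupMl // unfold_in.
  have -> : (y * x \in 'C[g])%g = (x * g * x^-1 == h)%g.
    rewrite Eh conjgE; apply/cent1P/eqP => [E | E].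
      have := congr1 (fun u => y^-1 * u * x^-1)%g E.
      by rewrite !mulgA mulVg mul1g mulgK.
    have := congr1 (fun u => y * u * x)%g E.
    by rewrite /commute !mulgA mulgKV mulgV mul1g.
  by case: eqP => [->|_]; rewrite ?Hh ?andbT ?andbF.
rewrite eq_card0 // => x; rewrite unfold_in; apply/negP => /andP[/andP[Gx _] /eqP Eh].
by rewrite -Eh -mulgA -{1}[x]invgK -conjgE memJ_class ?groupV in nGh.
Qed.

End InducedLinear.

(** * Real forms of complex representations *)

Lemma mxtrace_idempotent (F : fieldType) n (P : 'M[F]_n) :
  P *m P = P -> \tr P = (\rank P)%:R.
Proof.
move=> PP; have P_SB : P *m in_submod P 1%:M *m row_base P = P.
  by rewrite -in_submodE -[LHS]/(val_submod (in_submod P P)) in_submodK.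
have BP : row_base P *m P = row_base P.
  have /submxP[D ED] : (row_base P <= P)%MS by rewrite eq_row_base.
  by rewrite ED -mulmxA PP.
rewrite -{1}P_SB mxtrace_mulC mulmxA BP -in_submodE.
have -> : row_base P = val_submod 1%:M by rewrite /val_submod /= mul1mx.
by rewrite val_submodK mxtrace1.
Qed.

(** The average of [a ^- m] times the m-th power of A over a period of A is the projection onto the
    eigenspace of a, so its trace is the multiplicity. The powers are given as [X m] so that they
    can be images of group elements. *)
Lemma rank_eigenspace_sum (F : numFieldType) n (A : 'M[F]_n) (X : nat -> 'M[F]_n) N (a : F) :
  (0 < N)%N -> X 0%N = 1%:M -> (forall m, X m.+1 = X m *m A) -> X N = 1%:M -> a ^+ N = 1 ->
  (\rank (eigenspace A a))%:R = N%:R^-1 * \sum_(m < N) a ^- m * \tr (X m).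
Proof.
move=> N_gt0 X0 XS XN aN.
have nzN : N%:R != 0 :> F by rewrite pnatr_eq0 -lt0n.
have nza : a != 0.
  by apply: contra_eq_neq aN => ->; rewrite expr0n eqn0Ngt N_gt0 eq_sym oner_eq0.
pose P := N%:R^-1 *: \sum_(m < N) a ^- m *: X m.
have PA : P *m A = a *: P.
  rewrite /P -scalemxAl scalerA mulrC -scalerA; congr (_ *: _).
  rewrite mulmx_suml scaler_sumr; case: N N_gt0 XN aN {nzN P} => // N _ XN aN.
  rewrite big_ord_recr [RHS]big_ord_recl /= addrC.
  congr (_ + _); last first.
    apply: eq_bigr => m _; rewrite -scalemxAl -XS scalerA; congr (_ *: _).
    by rewrite /bump /= exprS invfM mulrA divff ?mul1r.
  rewrite -scalemxAl -XS XN expr0 invr1 scale1r X0; congr (_ *: _).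
  by apply: (mulfI (expf_neq0 N nza)); rewrite divff ?expf_neq0 // -exprSr aN.
have eigP (W : 'M_n) : W *m A = a *: W -> W *m P = W.
  move=> WA; have WX m : W *m X m = a ^+ m *: W.
    elim: m => [|m IHm]; first by rewrite X0 mulmx1 scale1r.
    by rewrite XS mulmxA IHm -scalemxAl WA scalerA exprSr.
  rewrite /P -scalemxAr mulmx_sumr (eq_bigr (fun=> W)) => [|m _].
    by rewrite sumr_const card_ord -scaler_nat scalerA mulVf ?scale1r.
  by rewrite -scalemxAr WX scalerA mulVf ?expf_neq0 // scale1r.
have PP := eigP P PA.
have -> : \rank (eigenspace A a) = \rank P.
  apply/eqmx_rank/andP; split; last by apply/eigenspaceP.
  apply/submxP; exists (eigenspace A a).
  by rewrite eigP //; apply/eigenspaceP.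
rewrite -mxtrace_idempotent // mxtraceZ raddf_sum; congr (_ * _).
by apply: eq_bigr => m _; rewrite /= mxtraceZ.
Qed.

(** * Complex matrices as real matrices of twice the size *)

Section Realification.
Variable R : rcfType.
Local Notation C := R[i].
Local Notation toC := (real_complex R).
Local Notation cmx := (map_mx toC).
Local Notation imag := (Complex 0 1 : C).

Definition re_mx m n (M : 'M[C]_(m, n)) : 'M[R]_(m, n) := map_mx (@complex.Re R) M.
Definition im_mx m n (M : 'M[C]_(m, n)) : 'M[R]_(m, n) := map_mx (@complex.Im R) M.

Lemma complex_mxE m n (M : 'M[C]_(m, n)) : M = cmx (re_mx M) + imag *: cmx (im_mx M).
Proof.
apply/matrixP => i j; rewrite !mxE; case: (M i j) => a b /=.
by apply/eqP; rewrite eq_complex /= !mul0r !mul1r subrr addr0 !add0r !eqxx.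
Qed.

Lemma re_mx_eq m n (A B : 'M[R]_(m, n)) : re_mx (cmx A + imag *: cmx B) = A.
Proof. by apply/matrixP => i j; rewrite !mxE /= !mul0r !mul1r; ring. Qed.

Lemma im_mx_eq m n (A B : 'M[R]_(m, n)) : im_mx (cmx A + imag *: cmx B) = B.
Proof. by apply/matrixP => i j; rewrite !mxE /= !mul0r !mul1r; ring. Qed.

(* The row vectors of R^(2n) stand for those of C^n, (x, y) being x + iy. *)
Definition cplx_mx k n (v : 'M[R]_(k, n + n)) : 'M[C]_(k, n) :=
  cmx (lsubmx v) + imag *: cmx (rsubmx v).

Definition realify m n (M : 'M[C]_(m, n)) : 'M[R]_(m + m, n + n) :=
  block_mx (re_mx M) (im_mx M) (- im_mx M) (re_mx M).

(** Identities between real matrices of size 2n are verified through this map, where they become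
    identities of complex matrices. *)
Lemma cplx_mx_inj k n : injective (@cplx_mx k n).
Proof.
move=> u v E; rewrite -[u]hsubmxK -[v]hsubmxK.
by congr row_mx; [rewrite -[LHS](re_mx_eq _ (rsubmx u)) | 
  rewrite -[LHS](im_mx_eq (lsubmx u))]; rewrite -/(cplx_mx u) E ?re_mx_eq ?im_mx_eq.
Qed.

Lemma imag2 : imag * imag = -1.
Proof. by apply/eqP; rewrite eq_complex /= !mulr0 !mulr1 addr0 sub0r oppr0 !eqxx. Qed.

Lemma cplx_mxMl k l n (A : 'M[R]_(k, l)) (v : 'M[R]_(l, n + n)) :
  cplx_mx (A *m v) = cmx A *m cplx_mx v.
Proof.
rewrite /cplx_mx -{1 2}[v]hsubmxK mul_mx_row row_mxKl row_mxKr.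
by rewrite mulmxDr -scalemxAr !map_mxM.
Qed.

Lemma cplx_mxMr k m n (v : 'M[R]_(k, m + m)) (M : 'M[C]_(m, n)) :
  cplx_mx (v *m realify M) = cplx_mx v *m M.
Proof.
rewrite /cplx_mx {3}[M]complex_mxE -{1 2}[v]hsubmxK /realify mul_row_block.
rewrite row_mxKl row_mxKr mulmxDl !mulmxDr !raddfD /= -!scalemxAl -!scalemxAr.
rewrite scalerA imag2 scaleN1r mulmxN raddfN /= !map_mxM addrACA.
by congr (_ + _); rewrite addrC.
Qed.

Lemma realifyM m n p (M : 'M[C]_(m, n)) (N : 'M[C]_(n, p)) :
  realify (M *m N) = realify M *m realify N.
Proof.
by apply: cplx_mx_inj; rewrite -[realify (M *m N)]mul1mx !cplx_mxMr mulmxA -cplx_mxMr mul1mx.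
Qed.

Lemma realify1 n : realify (1%:M : 'M[C]_n) = 1%:M.
Proof.
by apply: cplx_mx_inj; rewrite -[realify _]mul1mx cplx_mxMr mulmx1.
Qed.

Lemma mxtrace_realify n (M : 'M[C]_n) : \tr (realify M) = 2 * complex.Re (\tr M).
Proof.
rewrite mxtrace_block.
have -> : \tr (re_mx M) = complex.Re (\tr M); last by rewrite mulr_natl mulr2n.
rewrite /mxtrace (big_morph _ (_ : {morph @complex.Re R : x y / x + y}) (_ : _ = 0)) //.
- by apply: eq_bigr => i _; rewrite mxE.
- by case=> a b [].
Qed.
End Realification.

(** * Real and quaternionic type of an irreducible complex representation *)

Section RealTypes.
Variable R : rcfType.
Local Notation C := R[i].
Local Notation toC := (real_complex R).
Local Notation cmx := (map_mx toC).
Local Notation jmx := (map_mx conjc).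
Variables (gT : finGroupType) (G : {group gT}) (n : nat).
Variable X : mx_representation C G n.

Lemma realify_mx_repr : mx_repr G (fun g => realify (X g)).
Proof.
split=> [|g h Gg Gh]; first by rewrite repr_mx1 realify1.
by rewrite repr_mxM // realifyM.
Qed.
Definition realify_repr : mx_representation R G (n + n) :=
  MxRepresentation realify_mx_repr.

Hypothesis irrX : mx_irreducible X.

(* A proper invariant real subspace of dimension at most n spans C^n over C,
   hence is a real form. *)
Lemma realify_irr_or_real_form :
  mx_irreducible realify_repr \/
  exists (Y : mx_representation R G n) (Q : 'M[C]_n),
    Q \in unitmx /\ {in G, forall g, Q *m X g = cmx (Y g) *m Q}.
Proof.
have [n_gt0 _] : (0 < n)%N /\ True by case/mx_irrP: irrX.
case: (pselect (mx_irreducible realify_repr)) => [irrR|redR]; [by left | right].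
have oo : (0 < n + n)%N by rewrite addn_gt0 n_gt0.
have [U [modU nzU ltU]] : exists U : 'M[R]_(n + n), [/\ mxmodule realify_repr U, U != 0 & ~~ row_full U].
  apply: contrapT => noU; apply: redR; apply/mx_irrP; split.
    by rewrite addn_gt0 n_gt0.
  move=> U modU nzU; apply: contrapT => /negP ltU; apply: noU.
  by exists U.
have R'G : [pchar R]^'.-group G by apply/pgroupP=> p _; rewrite inE /= pchar_num.
have [W [modW defUW dxUW]] := mx_Maschke_pchar realify_repr R'G modU (submx1 U).
have rankUW : (\rank U + \rank W = n + n)%N.
  by have := mxdirectP dxUW; rewrite /= defUW mxrank1.
(* The dimensions of U and of its Maschke complement add up to 2n, so one of them is at most n. *)
have {U W modU nzU ltU modW defUW dxUW rankUW} [V [modV nzV leV]] :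
    exists V : 'M[R]_(n + n), [/\ mxmodule realify_repr V, V != 0 & (\rank V <= n)%N].
  case: (leqP (\rank U) n) => [leU|gtU]; first by exists U.
  exists W; split=> //; last by rewrite -(leq_add2l (\rank U)) rankUW leq_add2r ltnW.
  apply: contraNneq ltU => W0; move: rankUW; rewrite W0 mxrank0 addn0.
  by rewrite /row_full => ->.
pose Y := submod_repr modV; pose B := row_base V; pose Q := cplx_mx B.
have homB g : g \in G -> B *m realify (X g) = Y g *m B.
  move=> Gg; have := val_submodJ modV 1%:M Gg.
  by rewrite /val_submod /= !mul1mx => ->.
have homQ g : g \in G -> Q *m X g = cmx (Y g) *m Q.
  by move=> Gg; rewrite -cplx_mxMr homB // cplx_mxMl.
have nzQ : Q != 0.
  apply: contraNneq nzV => Q0; rewrite -mxrank_eq0; have <- : \rank B = \rank V by rewrite /B eq_row_base.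
  suff -> : B = 0 by rewrite mxrank0.
  by apply: cplx_mx_inj; rewrite -/Q Q0 -[0 in RHS](mul0mx _ B) cplx_mxMl map_mx0 mul0mx.
have fullQ : row_full Q.
  have modQ : mxmodule X <<Q>>%MS.
    rewrite (eqmx_module _ (genmxE Q)); apply/mxmoduleP => g Gg.
    by rewrite homQ // submxMl.
  case/mx_irrP: irrX => _ /(_ _ modQ).
  rewrite -mxrank_eq0 genmxE mxrank_eq0 => /(_ nzQ).
  by rewrite /row_full genmxE.
(* Q has [\rank V] rows, at most n, and rank n; hence it is square and invertible. *)
have eqn : \rank V = n.
  by apply/eqP; rewrite eqn_leq leV -{1}(eqP fullQ) rank_leq_row.
clearbody Q; clearbody Y; clear homB B; move: eqn Y Q homQ fullQ {nzQ}.
move: (\rank V) => k ->{k} Y Q homQ fullQ.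
by exists Y, Q; rewrite -row_full_unit.
Qed.

Lemma real_form_irr (Y : mx_representation R G n) (Q : 'M[C]_n) :
  Q \in unitmx -> {in G, forall g, Q *m X g = cmx (Y g) *m Q} ->
  mx_irreducible Y /\ {in G, forall g, \tr (X g) = (\tr (Y g))%:C%C}.
Proof.
move=> uQ homQ; split.
  apply: (@mx_irr_map _ _ toC); apply: mx_rsim_irr irrX.
  exists (invmx Q) => // [|g Gg]; first by rewrite row_free_unit unitmx_inv.
  by rewrite /= map_reprE -(mulKmx uQ (X g)) homQ // -mulmxA mulmxK.
move=> g Gg; rewrite -(mulKmx uQ (X g)) homQ // mxtrace_mulC mulmxK //.
by rewrite trace_map_mx.
Qed.

Lemma realify_irr_of_nonreal g :
  g \in G -> complex.Im (\tr (X g)) != 0 -> mx_irreducible realify_repr.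
Proof.
move=> Gg; case: realify_irr_or_real_form => // -[Y [Q [uQ homQ]]].
by have [_ ->] := real_form_irr uQ homQ; rewrite //= eqxx.
Qed.

(* For an eigenspace E of X t, the map v |-> conj v * P * X w is antilinear on E
   with square c * s; an antilinear map of negative square forces even dimension. *)
Lemma odd_eigenspace_sign (P : 'M[C]_n) (c s : R) t w (a : C) :
  {in G, forall g, P *m X g = jmx (X g) *m P} ->
  jmx P *m P = c%:C%C%:M -> t \in G -> w \in G -> X (w * w)%g = s%:C%C%:M ->
  (w * t * w^-1 = t^-1)%g -> a * a^*%C = 1 -> c * s != 0 ->
  odd (\rank (eigenspace (X t) a)) -> 0 < c * s.
Proof.
move=> homP PJP Gt Gw Xww wt aa nzcs oddk.
pose E := row_base (eigenspace (X t) a); set k := \rank _ in E oddk.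
have nza : a != 0 by apply: contra_eq_neq aa => ->; rewrite mul0r eq_sym oner_eq0.
have Et : E *m X t = a *: E by apply/eigenspaceP; rewrite eq_row_base.
have freeE : row_free E := row_base_free _.
have subE (W : 'M_(k, n)) : W *m X t = a *: W -> (W <= E)%MS.
  by move=> Wt; rewrite eq_row_base; apply/eigenspaceP.
clearbody E.
have EtV : E *m X t^-1%g = a^*%C *: E.
  rewrite -[LHS]scale1r -aa mulrC -scalerA scalemxAl -Et; congr (_ *: _).
  by rewrite repr_mxK.
have EJtV : jmx E *m jmx (X t^-1%g) = a *: jmx E.
  by rewrite -map_mxM EtV map_mxZ /= conjcK.
(* Since P intertwines X with its conjugate and w inverts t, the antilinear map preserves the
   eigenspace; K is its matrix in the basis E. *)
have /submxP[K EK] : (jmx E *m P *m X w <= E)%MS.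
  apply: subE; have wtE : (w * t = t^-1 * w)%g by rewrite -wt mulgKV.
  rewrite -(mulmxA (jmx E *m P)) -repr_mxM // wtE repr_mxM ?groupV // mulmxA -(mulmxA (jmx E)).
  by rewrite homP ?groupV // mulmxA EJtV -!scalemxAl.
have KK : jmx K *m K = (c * s)%:C%C%:M.
  apply: (row_free_inj freeE); rewrite -mulmxA -EK mul_scalar_mx !mulmxA -map_mxM -EK !map_mxM.
  have -> : jmx (jmx E) = E by apply/matrixP => i j; rewrite !mxE conjcK.
  rewrite -[_ *m jmx (X w) *m P]mulmxA -homP // -!mulmxA -repr_mxM //.
  rewrite Xww !mulmxA -(mulmxA E) PJP !mul_mx_scalar scalerA -rmorphM /=.
  by rewrite mulrC.
(* The determinant of [jmx K *m K] is the squared modulus of [\det K], and it also equals the k-th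
   power of [c * s]. *)
have : 0 <= (c * s) ^+ k.
  rewrite -ler0c rmorphXn /= -det_scalar -KK det_mulmx det_map_mx mulrC.
  exact: mulcJ_ge0.
rewrite exprn_odd_ge0 // => ge0.
by rewrite lt_def nzcs.
Qed.
End RealTypes.

Section RealTypes2.
Variable R : rcfType.
Local Notation C := R[i].
Local Notation toC := (real_complex R).
Local Notation cmx := (map_mx toC).
Local Notation jmx := (map_mx conjc).
Local Notation imag := (Complex 0 1 : C).
Variables (gT : finGroupType) (G : {group gT}) (n : nat).
Variable X : mx_representation C G n.
Hypothesis irrX : mx_irreducible X.

Let jmxK m p (M : 'M[C]_(m, p)) : jmx (jmx M) = M.
Proof. by apply/matrixP => i j; rewrite !mxE conjcK. Qed.

Lemma real_char_conj_hom :
  {in G, forall g, complex.Im (\tr (X g)) = 0} ->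
  exists (P : 'M[C]_n) (c : R), [/\ c != 0, jmx P *m P = c%:C%C%:M &
    {in G, forall g, P *m X g = jmx (X g) *m P}].
Proof.
move=> realX; pose XJ := map_repr conjc X.
have absX : mx_absolutely_irreducible X by apply: group_closure_closed_field.
have irrXJ : mx_irreducible XJ by apply: mx_abs_irrW; rewrite map_mx_abs_irr.
have rsX : mx_rsim X XJ.
  apply: pairing_neq0_rsim => //.
  (* For a real character this is the pairing of X with itself. *)
  rewrite (_ : pairing _ _ _ = #|G|%:R) ?pnatr_eq0 -?lt0n ?cardG_gt0 //.
  rewrite -(pairing_abs_irr (pchar_num C) absX); apply: eq_pairing => // g Gg.
  rewrite /XJ map_reprE trace_map_mx /=; move: (realX g Gg).
  by case: (\tr _) => a b /= ->; rewrite oppr0.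
case: rsX => B _ freeB homB; have uB : B \in unitmx by rewrite -row_free_unit.
pose P := invmx B.
have uP : P \in unitmx by rewrite unitmx_inv.
have homP : {in G, forall g, P *m X g = jmx (X g) *m P}.
  move=> g Gg; rewrite -{1}[X g](mulmxK uB) homB // -[_ *m _ *m invmx B]mulmxA.
  by rewrite mulmxA (mulVmx uB) mul1mx.
have homPJ : {in G, forall g, jmx P *m jmx (X g) = X g *m jmx P}.
  by move=> g Gg; rewrite -map_mxM homP // map_mxM jmxK.
have /(mx_abs_irr_cent_scalar absX) /is_scalar_mxP [c Ec] : centgmx X (jmx P *m P).
  by apply/centgmxP => g Gg; rewrite -mulmxA homP // mulmxA homPJ // -mulmxA.
have n_gt0 : (0 < n)%N by case/mx_irrP: irrX.
(* Computing [P *m jmx P *m P] in two ways shows that c and its conjugate scale the invertible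
   matrix P in the same way. *)
have c_real : c^*%C = c.
  have := congr1 (mulmx P) Ec; rewrite mulmxA -[P *m jmx P]jmxK map_mxM jmxK Ec.
  rewrite map_scalar_mx mul_scalar_mx mul_mx_scalar /= => /eqP.
  rewrite -subr_eq0 -scalerBl scaler_eq0 subr_eq0 => /orP[/eqP //|/eqP P0].
  by move: uP; rewrite P0 -row_free_unit /row_free mxrank0 eq_sym eqn0Ngt n_gt0.
have nz_c : c != 0.
  apply: contraTneq uP => c0; move: Ec; rewrite c0 => /(congr1 determinant)/eqP.
  rewrite det_mulmx det_map_mx det_scalar expr0n eqn0Ngt n_gt0 mulf_eq0 /=.
  by rewrite unitmxE unitfE conjc_eq0 orbb => ->.
exists P, (complex.Re c); have Ere : (complex.Re c)%:C%C = c.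
  by apply: RRe_real; apply/complex_realP; case: (c) c_real => a b [] /eqP; 
  rewrite eqNr => /eqP ->; exists a.
rewrite Ere; split=> //.
by apply: contra_neq nz_c => E; rewrite -Ere E.
Qed.

(** After scaling P to make c equal to 1, the map v |-> conj(v) P is a real-linear involution S that
    commutes with the group and anticommutes with multiplication by i. On an irreducible
    realification Schur's lemma would make S equal to 1 or -1, which commutes with multiplication by
    i. *)
Lemma reducible_of_conj_hom (P : 'M[C]_n) (c : R) :
  0 < c -> jmx P *m P = c%:C%C%:M ->
  {in G, forall g, P *m X g = jmx (X g) *m P} ->
  ~ mx_irreducible (realify_repr X).
Proof.
move=> c_gt0 PJP homP irrR.
have n_gt0 : (0 < n)%N by case/mx_irrP: irrX.
pose s := Num.sqrt c; have s2 : s * s = c by rewrite -expr2 sqr_sqrtr ?ltW.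
have nzs : s != 0 by rewrite sqrtr_eq0 -ltNge.
pose P' := (s^-1)%:C%C *: P.
have P'JP' : jmx P' *m P' = 1%:M.
  rewrite /P' map_mxZ (_ : GRing.RMorphism.sort _ _ = (s^-1)%:C%C); last exact: conjc_real.
  rewrite -scalemxAl -scalemxAr scalerA PJP scale_scalar_mx.
  by rewrite -!rmorphM /= -s2 mulrACA mulVf // mulr1.
have homP' : {in G, forall g, P' *m X g = jmx (X g) *m P'}.
  by move=> g Gg; rewrite -scalemxAl homP // -scalemxAr.
pose D : 'M[R]_(n + n) := block_mx 1%:M 0 0 (- 1%:M).
pose S := D *m realify P'.
have cplxD k (v : 'M[R]_(k, n + n)) : cplx_mx (v *m D) = jmx (cplx_mx v).
  rewrite /cplx_mx -{1 2}[v]hsubmxK mul_row_block row_mxKl row_mxKr.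
  apply/matrixP => i j; rewrite !mulmx0 !mulmx1 mulmxN mulmx1 !mxE /=.
  by apply/eqP; rewrite eq_complex /= !mul0r !mul1r; apply/andP; split; apply/eqP; ring.
have cplxS k (v : 'M[R]_(k, n + n)) : cplx_mx (v *m S) = jmx (cplx_mx v) *m P'.
  by rewrite mulmxA cplx_mxMr cplxD.
pose J := realify (imag%:M : 'M[C]_n).
have cplxJ k (v : 'M[R]_(k, n + n)) : cplx_mx (v *m J) = imag *: cplx_mx v.
  by rewrite cplx_mxMr mul_mx_scalar.
clearbody S J.
have SS : S *m S = 1%:M.
  apply: cplx_mx_inj; rewrite -[S *m S]mul1mx mulmxA !cplxS map_mxM jmxK.
  by rewrite -mulmxA P'JP' mulmx1.
have cplxN k (v : 'M[R]_(k, n + n)) : cplx_mx (- v) = - cplx_mx v.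
  by rewrite /cplx_mx !raddfN opprD.
have SJ : S *m J = - (J *m S).
  apply: cplx_mx_inj; rewrite cplxN -[S *m J]mul1mx -[J *m S]mul1mx !mulmxA.
  rewrite cplxJ !cplxS cplxJ map_mxZ -scalemxAl -scaleNr; congr (_ *: _).
  by apply/eqP; rewrite eq_complex /= oppr0 opprK !eqxx.
have JJ : J *m J = - 1%:M.
  apply: cplx_mx_inj; rewrite -[J *m J]mul1mx mulmxA !cplxJ scalerA imag2 scaleN1r.
  by rewrite cplxN.
have centS : centgmx (realify_repr X) S.
  apply/centgmxP => g Gg; apply: cplx_mx_inj.
  rewrite -[S *m _]mul1mx -[_ *m S]mul1mx !mulmxA cplx_mxMr !cplxS cplx_mxMr.
  by rewrite map_mxM -!mulmxA homP'.
have SP : S = 1%:M \/ S = - 1%:M.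
  case: (eqVneq (S - 1%:M) 0) => [/eqP|nz1]; first by rewrite subr_eq0 => /eqP; left.
  right; have cent1 : centgmx (realify_repr X) (S - 1%:M).
    by apply/centgmxP => g Gg; rewrite mulmxBl mulmxBr mulmx1 mul1mx (centgmxP centS).
  have u1 := mx_Schur irrR cent1 nz1.
  have E0 : (S - 1%:M) *m (S + 1%:M) = 0.
    by rewrite mulmxBl mulmxDr mul1mx SS mulmx1 [1%:M + S]addrC subrr.
  by apply/eqP; rewrite -addr_eq0 -[S + 1%:M](mulKmx u1) E0 mulmx0.
have JN : J = - J.
  case: SP SJ => ->; first by rewrite mul1mx mulmx1.
  by rewrite mulNmx mulmxN mulmx1 mul1mx opprK.
have J0 : J = 0.
  apply/matrixP => i j; have := congr1 (fun M : 'M_(n + n) => M i j) JN.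
  by rewrite !mxE; lra.
have := JJ; rewrite J0 mul0mx => /eqP; rewrite eq_sym oppr_eq0.
by rewrite -mxrank_eq0 mxrank1 addn_eq0 andbb eqn0Ngt n_gt0.
Qed.
Section OddEigenspace.
Variables (s : R) (t w : gT) (a : C).
Hypotheses (Gt : t \in G) (Gw : w \in G) (Xww : X (w * w)%g = s%:C%C%:M).
Hypotheses (wt : (w * t * w^-1 = t^-1)%g) (aa : a * a^*%C = 1).
Hypotheses (nzs : s != 0) (oddk : odd (\rank (eigenspace (X t) a))).

Lemma real_type_of_odd : 0 < s -> {in G, forall g, complex.Im (\tr (X g)) = 0} ->
  exists Y : mx_representation R G n,
    mx_irreducible Y /\ {in G, forall g, \tr (X g) = (\tr (Y g))%:C%C}.
Proof.
move=> s_gt0 realX; have [P [c [nzc PJP homP]]] := real_char_conj_hom realX.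
have nzcs : c * s != 0 by rewrite mulf_neq0.
have cs := odd_eigenspace_sign homP PJP Gt Gw Xww wt aa nzcs oddk.
have c_gt0 : 0 < c by rewrite -(pmulr_lgt0 _ s_gt0).
case: (realify_irr_or_real_form irrX) => [|[Y [Q [uQ homQ]]]].
  by move/(reducible_of_conj_hom c_gt0 PJP homP).
by exists Y; apply: real_form_irr homQ.
Qed.

(** A real form given by Q yields the intertwiner [invmx (jmx Q) *m Q], whose constant c is 1. The
    sign lemma would then give [0 < s]. *)
Lemma quaternionic_type_of_odd : s < 0 -> mx_irreducible (realify_repr X).
Proof.
move=> s_lt0; case: (realify_irr_or_real_form irrX) => // -[Y [Q [uQ homQ]]].
have uQJ : jmx Q \in unitmx by rewrite map_unitmx.
have cmxJ (M : 'M[R]_n) : jmx (cmx M) = cmx M.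
  by apply/matrixP => i j; rewrite !mxE conjc_real.
pose P := invmx (jmx Q) *m Q.
have homP : {in G, forall g, P *m X g = jmx (X g) *m P}.
  move=> g Gg; have XJE : jmx (X g) = invmx (jmx Q) *m (cmx (Y g) *m jmx Q).
    by rewrite -[in LHS](mulKmx uQ (X g)) homQ // map_mxM map_invmx map_mxM cmxJ.
  have E : cmx (Y g) *m jmx Q *m P = cmx (Y g) *m Q by rewrite -mulmxA (mulKVmx uQJ).
  by rewrite XJE -mulmxA homQ // -[RHS]mulmxA E.
have PJP : jmx P *m P = 1%:C%C%:M.
  by rewrite map_mxM map_invmx jmxK !mulmxA mulmxK // mulVmx.
have := odd_eigenspace_sign homP PJP Gt Gw Xww wt aa.
by rewrite mul1r => /(_ nzs oddk); rewrite lt_gtF.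
Qed.
End OddEigenspace.

End RealTypes2.

(** * Conjugacy classes of SL2 *)

Section ClassReps.
Variables (gT : finGroupType) (G : {group gT}) (reps : seq gT).
Hypotheses (reps_uniq : uniq [seq r ^: G | r <- reps])
  (reps_card : (\sum_(r <- reps) #|r ^: G| = #|G|)%N) (reps_sub : {subset reps <= G}).

Let count_class g : (\sum_(r <- reps) (g \in r ^: G) = (g ^: G \in [seq r ^: G | r <- reps]))%N.
Proof.
have cntE : (\sum_(r <- reps) (g \in r ^: G) = count_mem (g ^: G) [seq r ^: G | r <- reps])%N.
  rewrite count_map -sum1_count [RHS]big_mkcond; apply: eq_bigr => r _ /=.
  by rewrite eq_sym (sameP class_eqP eqP); case: ifP.
by rewrite cntE count_uniq_mem.
Qed.

(** Each element lies in at most one listed class, and the incidences number [#|G|] in total, so no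
    element is missed. *)
Lemma class_reps_exist g : g \in G -> exists2 r, r \in reps & g \in r ^: G.
Proof.
move=> Gg; pose inc g := (\sum_(r <- reps) (g \in r ^: G))%N.
have le1 h : (inc h <= 1)%N by rewrite /inc count_class leq_b1.
have sum1 : (\sum_(h in G) inc h = \sum_(h in G) 1)%N.
  rewrite sum1_card -reps_card /inc exchange_big /=.
  rewrite big_seq [RHS]big_seq; apply: eq_bigr => r reps_r.
  rewrite -sum1_card [RHS]big_mkcond [LHS]big_mkcond /=; apply: eq_bigr => h _.
  case: ifP => [_|nGh]; first by case: ifP.
  case: ifP => // rGh; suff: h \in G by rewrite nGh.
  by apply: subsetP rGh; rewrite class_subG ?reps_sub.
have inc1 : inc g = 1%N.
  apply/eqP; rewrite eqn_leq le1 /=; apply: contraT; rewrite -ltnNge ltnS leqn0 => /eqP inc0.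
  have := sum1; rewrite (bigD1 g) //= [RHS](bigD1 g) //= inc0 add0n => eq1.
  have : (\sum_(h in G | h != g) inc h <= \sum_(h in G | h != g) 1)%N.
    by apply: leq_sum.
  by rewrite eq1 add1n ltnn.
move: inc1; rewrite /inc count_class => /eqP; rewrite eqb1 => /mapP[r reps_r Er].
by exists r => //; rewrite -Er class_refl.
Qed.

Lemma class_reps_sum (V : nmodType) (f : gT -> V) :
  {in G &, forall g x, f (g ^ x)%g = f g} ->
  \sum_(g in G) f g = \sum_(r <- reps) f r *+ #|r ^: G|.
Proof.
move=> fJ.
transitivity (\sum_(g in G) \sum_(r <- reps) f g *+ (g \in r ^: G)).
  apply: eq_bigr => g Gg; rewrite sumrMnr.
  have [r reps_r rGg] := class_reps_exist Gg.
  rewrite count_class; have -> : g ^: G = r ^: G by apply/class_eqP.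
  by rewrite (map_f (fun r => r ^: G) reps_r).
rewrite exchange_big /=; rewrite big_seq [RHS]big_seq; apply: eq_bigr => r reps_r.
rewrite -sumr_const [LHS]big_mkcond [RHS]big_mkcond /=; apply: eq_bigr => g _.
case: (boolP (g \in r ^: G)) => [/imsetP[x Gx ->]|_]; last by rewrite mulr0n if_same.
have Gr := reps_sub reps_r; have -> : (r ^ x)%g \in G = true by apply: groupJ.
exact: fJ.
Qed.

Lemma class_reps_table (V : nmodType) (rv : seq (gT * V)) r v g :
  map fst rv = reps -> (r, v) \in rv -> g \in r ^: G ->
  \sum_(s <- rv) (if g \in s.1 ^: G then s.2 else 0) = v.
Proof.
move=> rv_reps.
have uniq_rv : uniq [seq s.1 ^: G | s <- rv] by rewrite (map_comp (fun r => r ^: G)) rv_reps.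
move: uniq_rv; elim: rv {rv_reps} => //= -[r' v'] rv IHrv /andP[nrv uniq_rv].
rewrite big_cons inE => /orP[/eqP[Er Ev]|rv_r] rGg /=; first subst r' v'.
  rewrite rGg big_seq big1 ?addr0 // => s' rv_s'; case: ifP => // sGg.
  case/negP: nrv; apply/mapP; exists s' => //=.
  by rewrite -(class_eqP rGg) -(class_eqP sGg).
rewrite IHrv // ifN ?add0r //; apply: contra nrv => sGg.
by apply/mapP; exists (r, v) => //=; rewrite -(class_eqP rGg) -(class_eqP sGg).
Qed.
End ClassReps.

(* {'GL_2(q)} has two convertible group structures that unify very slowly; fixing
   one of them avoids mixing the two. *)
Definition GL2fin (q : nat) : finGroupType := {'GL_2(q)}.

(** * Elements of SL2 by their matrix entries *)

Section SL2Elements.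
Variable q : nat.
Hypotheses (q_pr : prime q) (q_odd : odd q).
Local Notation Fq := 'F_q.
Local Notation GL := (GL2fin q).
Local Notation G := (SL2_group q).
Local Notation mx2 := (@mx2 q).

Lemma mx2E (M : 'M[Fq]_2) : M = mx2 (M 0 0) (M 0 1) (M 1 0) (M 1 1).
Proof.
by apply/matrixP => i j; rewrite mxE; case: i j => [[|[]] // ?] [[|[]] // ?] /=;
   congr (M _ _); apply: val_inj.
Qed.

Lemma mx2_inj a b c d a' b' c' d' :
  mx2 a b c d = mx2 a' b' c' d' -> [/\ a = a', b = b', c = c' & d = d'].
Proof.
move=> E; split; [have := congr1 (fun M : 'M_2 => M 0 0) E | have := congr1 (fun M : 'M_2 => M 0 1) E
  | have := congr1 (fun M : 'M_2 => M 1 0) E | have := congr1 (fun M : 'M_2 => M 1 1) E];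
  by rewrite !mxE.
Qed.

Lemma mx2M a b c d a' b' c' d' :
  mx2 a b c d *m mx2 a' b' c' d' =
  mx2 (a * a' + b * c') (a * b' + b * d') (c * a' + d * c') (c * b' + d * d').
Proof.
apply/matrixP => i j; rewrite !mxE !big_ord_recl big_ord0 !mxE addr0 /=.
by case: i j => [[|[]] // ?] [[|[]] // ?].
Qed.

Lemma det_mx2 a b c d : \det (mx2 a b c d) = a * d - b * c.
Proof.
rewrite (expand_det_row _ 0) !big_ord_recl big_ord0 /cofactor !det_mx11 !mxE /=.
by rewrite addr0 expr0 expr1 mul1r mulN1r mulrN.
Qed.

Lemma tr_mx2 a b c d : \tr (mx2 a b c d) = a + d.
Proof. by rewrite /mxtrace !big_ord_recl big_ord0 !mxE /= addr0. Qed.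

Lemma mx2_1 : 1%:M = mx2 1 0 0 1.
Proof. by rewrite [LHS]mx2E !mxE. Qed.

Lemma GL_inj (g h : GL) : (GLval g = GLval h) -> g = h.
Proof. exact: val_inj. Qed.

Definition low (x : {unit Fq}) (y : Fq) : GL := lower x y.

Definition sz : GL := elt_z q.

Lemma GLval_lower x y : GLval (low x y) = mx2 (val x) 0 y (val x)^-1.
Proof. by []. Qed.

Lemma lower_SL2 (x : {unit Fq}) y : low x y \in G.
Proof. by rewrite inE GLval_lower det_mx2 mul0r subr0 divrr //; apply: valP. Qed.

Lemma SL2_mx2P (g : GL) :
  g \in G -> exists a b c d, GLval g = mx2 a b c d /\ a * d - b * c = 1.
Proof.
rewrite inE => /eqP detg; do 4!eexists; split; first exact: mx2E.
by rewrite -det_mx2 -mx2E.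
Qed.

Lemma SL2_mx2_exists a b c d :
  a * d - b * c = 1 -> exists2 g : GL, g \in G & GLval g = mx2 a b c d.
Proof.
move=> E; have u : mx2 a b c d \is a GRing.unit by rewrite [_ \is a _]unitmxE det_mx2 E unitr1.
by exists (FinRing.unit 'M[Fq]_2 u) => //; rewrite inE det_mx2 E.
Qed.

Lemma unit_neq0 (x : {unit Fq}) : val x != 0.
Proof. by rewrite -unitfE; apply: valP. Qed.

Lemma neq0_unit (x : Fq) : x != 0 -> exists u : {unit Fq}, val u = x.
Proof. by rewrite -unitfE => ux; exists (FinRing.unit _ ux). Qed.

Lemma GLmulE (g h : GL) : GLval (g * h)%g = GLval g *m GLval h.
Proof. by []. Qed.

Lemma lowerM x y x' y' :
  (low x y * low x' y')%g = low (x * x')%g (y * val x' + (val x)^-1 * y') :> GL.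
Proof.
apply: GL_inj; rewrite GLmulE !GLval_lower mx2M /= !mul0r !mulr0 !addr0 add0r.
by rewrite invfM.
Qed.

Lemma lower1 : low 1%g 0 = 1%g :> GL.
Proof. by apply: GL_inj; rewrite GLval_lower /= invr1 -mx2_1. Qed.

Lemma lowerV x y : (low x y)^-1%g = low x^-1%g (- y) :> GL.
Proof.
apply: (mulgI (low x y)); rewrite mulgV lowerM mulgV -lower1; congr low.
by rewrite /= mulrN mulrC subrr.
Qed.

Lemma lower_inj x y x' y' : low x y = low x' y' :> GL -> x = x' /\ y = y'.
Proof. by move/(congr1 (@GLval 2 _))/mx2_inj => [/val_inj -> _ -> _]. Qed.

Lemma two_neq0 : 2 != 0 :> Fq.
Proof.
rewrite -(dvdn_pcharf (pchar_Fp q_pr)).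
rewrite dvdn_prime2 //.
by apply: contraTN q_odd => /eqP ->.
Qed.

Lemma elt_zE : GLval (sz) = (-1)%:M.
Proof. by rewrite GLval_lower /= invrN invr1 [RHS]mx2E !mxE /= mulr1n mulr0n. Qed.

Lemma elt_z_central (g : GL) : (sz * g = g * sz)%g.
Proof. by apply: GL_inj; rewrite !GLmulE elt_zE scalar_mxC. Qed.

Lemma elt_zz : (sz * sz = 1)%g.
Proof. by apply: GL_inj; rewrite GLmulE elt_zE -scalar_mxM mulrNN mulr1. Qed.

Lemma elt_z_lower x y : (sz * low x y)%g = low (FinRing.unit _ (unitN1 q) * x)%g (- y).
Proof. by rewrite lowerM mul0r add0r /= invrN invr1 mulN1r. Qed.

(** Without inverses, conjugacy becomes a system of polynomial equations in the matrix entries. *)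
Lemma conj_classP (g h : GL) :
  reflect (exists2 x, x \in G & (x * h = g * x)%g) (h \in g ^: G).
Proof.
apply: (iffP imsetP) => [[x Gx ->]|[x Gx E]]; exists x => //.
  by rewrite conjgE !mulgA mulgV mul1g.
by rewrite conjgE -E mulKg.
Qed.

Lemma class_trace (g h : GL) : h \in g ^: G -> \tr (GLval h) = \tr (GLval g).
Proof.
case/conj_classP => x Gx E; have Eh : h = (x^-1 * (g * x))%g by rewrite -E mulKg.
by rewrite Eh GLmulE mxtrace_mulC -GLmulE mulgK.
Qed.

End SL2Elements.

(** * Conjugacy and centralizers of lower triangular elements *)

Section LowerClasses.
Variable q : nat.
Hypotheses (q_pr : prime q) (q_odd : odd q).
Local Notation Fq := 'F_q.
Local Notation GL := (GL2fin q).
Local Notation G := (SL2_group q).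
Local Notation mx2 := (@mx2 q).
Implicit Types (x e : {unit Fq}) (y w : Fq).

Lemma unitVE x : val x^-1%g = (val x)^-1. Proof. by []. Qed.

Lemma lower_conj_diag x y :
  val x != (val x)^-1 -> low x y \in low x 0 ^: G.
Proof.
rewrite -subr_eq0 => nz; pose w := - y / (val x - (val x)^-1).
apply/conj_classP; exists (low 1%g w); first exact: lower_SL2.
rewrite !lowerM mul1g mulg1 /= mul0r add0r invr1 mul1r; congr low.
apply/eqP; rewrite -subr_eq0; apply/eqP.
have -> : w * val x + y - (val x)^-1 * w = w * (val x - (val x)^-1) + y by ring.
by rewrite divfK // addNr.
Qed.

Lemma lower_conj_inv x : low x^-1%g 0 \in low x 0 ^: G.
Proof.
have [u Gu Eu] : exists2 u : GL, u \in G & GLval u = mx2 0 1 (-1) 0.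
  by apply: SL2_mx2_exists; ring.
apply/conj_classP; exists u => //; apply: GL_inj.
rewrite !GLmulE Eu !GLval_lower !mx2M !unitVE invrK.
by congr Defs.mx2; ring.
Qed.

(** Comparing entries forces the conjugating matrix to be lower triangular with diagonal entries p
    and 1/p, and such a matrix scales the lower left entry by a square. This separates [c] from
    [d]. *)
Lemma lower_conj_sqr e y y' : (e * e = 1)%g -> y != 0 ->
  reflect (exists2 p, p != 0 & y' = p ^+ 2 * y) (low e y' \in low e y ^: G).
Proof.
move=> ee nzy; have nze := unit_neq0 e.
have eV : (val e)^-1 = val e by rewrite -unitVE (eqP (_ : e^-1 == e)%g) // eq_sym eq_mulgV1 invgK ee.
apply: (iffP (conj_classP _ _)) => [[u Gu] | [p nzp ->]].
  have [p [r [s [t [Eu D]]]]] := SL2_mx2P Gu.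
  move/(congr1 (@GLval 2 _)); rewrite !GLmulE Eu !GLval_lower !mx2M eV.
  case/mx2_inj; rewrite !mul0r !mulr0 !add0r !addr0 => E1 _ E3 E4.
  have r0 : r = 0.
    apply/eqP; move/eqP: E4; rewrite mulrC -subr_eq0 opprD addrCA subrr addr0 oppr_eq0.
    by rewrite mulf_eq0 (negbTE nzy).
  rewrite r0 mul0r subr0 in D; exists p.
    by apply: contra_eq_neq D => ->; rewrite mul0r eq_sym oner_eq0.
  have Ety : t * y' = y * p by apply: (addrI (s * val e)); rewrite E3 addrC mulrC; ring.
  by rewrite -[LHS]mul1r -D -mulrA Ety; ring.
have [x Ex] := neq0_unit nzp; exists (low x 0); first exact: lower_SL2.
apply: GL_inj; rewrite !GLmulE !GLval_lower !mx2M Ex eV.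
by congr Defs.mx2; field.
Qed.

Lemma cent_lower_unip e y : (e * e = 1)%g -> y != 0 ->
  'C_G[low e y] = [set low u.1 u.2 | u in setX [set u : {unit Fq} | (u * u == 1)%g] setT].
Proof.
move=> ee nzy; have nze := unit_neq0 e.
have eV : (val e)^-1 = val e by rewrite -unitVE (eqP (_ : e^-1 == e)%g) // eq_sym eq_mulgV1 invgK ee.
apply/setP => u; apply/idP/imsetP.
  case/setIP => Gu /cent1P; have [p [r [s [t [Eu D]]]]] := SL2_mx2P Gu.
  move/(congr1 (@GLval 2 _)); rewrite !GLmulE Eu !GLval_lower !mx2M eV.
  case/mx2_inj; rewrite !mul0r !mulr0 !add0r !addr0 => E1 _ E3 E4.
  have r0 : r = 0.
    apply/eqP; move/eqP: E4; rewrite mulrC -subr_eq0 opprD addrCA subrr addr0 oppr_eq0.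
    by rewrite mulf_eq0 (negbTE nzy).
  rewrite r0 mul0r subr0 in D.
  have Et : t = p.
    apply: (mulIf nzy); apply: (addrI (s * val e)).
    by rewrite E3; ring.
  have nzp : p != 0 by apply: contra_eq_neq D => ->; rewrite mul0r eq_sym oner_eq0.
  have [x Ex] := neq0_unit nzp; exists (x, s).
    by rewrite !inE andbT; apply/eqP/val_inj; rewrite /= Ex -[in LHS]Et mulrC -D Et.
  apply: GL_inj; rewrite GLval_lower Ex Eu r0 Et /=; congr Defs.mx2.
  by apply: (mulfI nzp); rewrite divff // -D Et.
case=> -[e' w] /setXP[/=]; rewrite inE => /eqP e'e' _ ->.
have e'V : (val e')^-1 = val e' by rewrite -unitVE (eqP (_ : e'^-1 == e')%g) // eq_sym eq_mulgV1 invgK e'e'.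
rewrite inE lower_SL2; apply/cent1P/GL_inj; rewrite !GLmulE !GLval_lower !mx2M eV e'V.
by congr Defs.mx2; ring.
Qed.

Lemma cent_lower_diag x : val x != (val x)^-1 ->
  'C_G[low x 0] = [set low u 0 | u in [set: {unit Fq}]].
Proof.
rewrite -subr_eq0 => nz; apply/setP => u; apply/idP/imsetP.
  case/setIP => Gu /cent1P; have [p [r [s [t [Eu D]]]]] := SL2_mx2P Gu.
  move/(congr1 (@GLval 2 _)); rewrite !GLmulE Eu !GLval_lower !mx2M.
  case/mx2_inj; rewrite !mul0r !mulr0 !add0r !addr0 => _ E2 E3 _.
  have r0 : r = 0.
    apply/eqP; move/eqP: E2; rewrite -subr_eq0 mulrC -mulrBl mulf_eq0 -opprB oppr_eq0.
    by rewrite (negbTE nz).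
  have s0 : s = 0.
    apply/eqP; move/eqP: E3; rewrite -subr_eq0 mulrC -mulrBl mulf_eq0.
    by rewrite (negbTE nz).
  rewrite r0 mul0r subr0 in D.
  have nzp : p != 0 by apply: contra_eq_neq D => ->; rewrite mul0r eq_sym oner_eq0.
  have [v Ev] := neq0_unit nzp; exists v => //.
  apply: GL_inj; rewrite GLval_lower Ev Eu r0 s0; congr Defs.mx2.
  by apply: (mulfI nzp); rewrite divff.
case=> v _ ->; rewrite inE lower_SL2; apply/cent1P; rewrite /commute !lowerM.
by rewrite !mul0r !mulr0 addr0; congr low; apply: val_inj; rewrite /= mulrC.
Qed.

Lemma card_units : #|[set: {unit Fq}]| = q.-1.
Proof. by rewrite card_finField_unit card_Fp. Qed.

Lemma unit_sqr1 x : (x * x = 1)%g -> x = 1%g \/ x = FinRing.unit _ (unitN1 q).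
Proof.
move/(congr1 val) => /= /eqP; rewrite -expr2 sqrf_eq1 => /orP[] /eqP E.
  by left; apply: val_inj.
by right; apply: val_inj.
Qed.

Lemma card_cent_lower_unip e y : (e * e = 1)%g -> y != 0 -> #|'C_G[low e y]| = (2 * q)%N.
Proof.
move=> ee nzy; rewrite cent_lower_unip // card_in_imset => [|[a b] [c d] _ _ /lower_inj[/= -> -> //]].
rewrite cardsX cardsT card_Fp //; congr (_ * _)%N.
have -> : [set u : {unit Fq} | (u * u == 1)%g] = [set 1%g; FinRing.unit _ (unitN1 q)].
  apply/setP => u; rewrite !inE; apply/eqP/orP => [/unit_sqr1[->|->]|[]/eqP ->].
  - by left.
  - by right.
  - by rewrite mulg1.
  by apply: val_inj; rewrite /= mulrNN mulr1.
rewrite cards2 -(inj_eq val_inj) /= -subr_eq0 opprK.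
by rewrite two_neq0.
Qed.

Lemma card_cent_lower_diag x : val x != (val x)^-1 -> #|'C_G[low x 0]| = q.-1.
Proof.
move=> nz; rewrite cent_lower_diag // card_imset ?card_units // => u v.
by case/lower_inj.
Qed.
End LowerClasses.

(** * Elements without eigenvalues in the prime field *)

Section IrreducibleElements.
Variable q : nat.
Hypotheses (q_pr : prime q) (q_odd : odd q).
Local Notation Fq := 'F_q.
Local Notation GL := (GL2fin q).
Local Notation G := (SL2_group q).
Local Notation mx2 := (@mx2 q).
Implicit Types (x e : {unit Fq}) (y w : Fq).

(** In determinant 1 the polynomial is the characteristic polynomial, so these are the nonsplit
    elements. *)
Definition irr_elt (g : GL) := forall x : Fq, x ^+ 2 - \tr (GLval g) * x + 1 != 0.

Lemma irr_class (g h : GL) : h \in g ^: G -> irr_elt g -> irr_elt h.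
Proof. by move=> /class_trace trh irrg x; rewrite trh. Qed.

Lemma lower_not_irr x y : ~ irr_elt (low x y).
Proof.
move/(_ (val x)); rewrite GLval_lower tr_mx2 => /eqP; apply.
have := unit_neq0 x; move: (val x) => v nzv; by field.
Qed.

Lemma not_irr_lower (g : GL) x : g \in G ->
  val x ^+ 2 - \tr (GLval g) * val x + 1 = 0 -> exists y, g \in low x y ^: G.
Proof.
move=> Gg; have [p [r [s [u [Eg D]]]]] := SL2_mx2P Gg; rewrite Eg tr_mx2 => root_x.
have nzx := unit_neq0 x.
(* A row eigenvector is completed to a matrix h of determinant 1; then [h * g * h^-1] has first row
   [(x, 0)]. *)
suff [v1 [v2 [nzv E1 E2]]] : exists v1 v2, [/\ (v1 != 0) || (v2 != 0),
    v1 * p + v2 * s = val x * v1 & v1 * r + v2 * u = val x * v2].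
  have [w1 [w2 Dw]] : exists w1 w2, v1 * w2 - v2 * w1 = 1.
    case/orP: nzv => nz; [exists 0, v1^-1 | exists (- v2^-1), 0].
      by rewrite mulr0 subr0 divff.
    by rewrite mulr0 sub0r mulrN opprK divff.
  have [h Gh Eh] := SL2_mx2_exists Dw.
  have [p' [r' [s' [u' [Eh' D']]]]] := SL2_mx2P (groupM (groupM Gh Gg) (groupVr Gh)).
  have : (h * g * h^-1 * h = h * g)%g by rewrite mulgKV.
  move/(congr1 (@GLval 2 _)); rewrite GLmulE Eh' GLmulE Eh Eg !mx2M.
  case/mx2_inj; rewrite E1 E2 => F1 F2 F3 F4.
  have [p'E r'0] : p' = val x /\ r' = 0.
    split.
      rewrite -[LHS]mulr1 -Dw; transitivity ((p' * v1 + r' * w1) * w2 - (p' * v2 + r' * w2) * w1).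
        by ring.
      by rewrite F1 F2 -[RHS]mulr1 -Dw; ring.
    rewrite -[LHS]mulr1 -Dw; transitivity ((p' * v2 + r' * w2) * v1 - (p' * v1 + r' * w1) * v2).
      by ring.
    by rewrite F1 F2; ring.
  exists s'; have -> : low x s' = (h * g * h^-1)%g.
    apply: GL_inj; rewrite Eh' GLval_lower p'E r'0; congr Defs.mx2.
    by move: D'; rewrite p'E r'0 mul0r subr0 => D'; apply: (mulfI nzx); rewrite divff.
  by apply/conj_classP; exists h; rewrite // mulgKV.
have det0 : (p - val x) * (u - val x) = r * s.
  apply/eqP; rewrite -subr_eq0 -root_x; apply/eqP; rewrite -D; ring.
(* The row [(s, x - p)] is an eigenvector unless it vanishes. If it does, then [s = 0] and [x = p],
   and either [(1, 0)] or [(u - x, - r)] serves. *)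
case: (eqVneq s 0) => [s0|nzs]; last first.
  exists s, (val x - p); split; [by rewrite nzs | by ring |].
  apply/eqP; rewrite -subr_eq0; apply/eqP.
  transitivity (r * s - (p - val x) * (u - val x)); first by ring.
  by rewrite det0 subrr.
case: (eqVneq (val x - p) 0) => [/eqP|nzp]; last first.
  exists s, (val x - p); split; [by rewrite nzp orbT | by ring |].
  apply/eqP; rewrite -subr_eq0; apply/eqP.
  transitivity (r * s - (p - val x) * (u - val x)); first by ring.
  by rewrite det0 subrr.
rewrite subr_eq0 => /eqP xp.
case: (eqVneq r 0) => [r0|nzr].
  exists 1, 0; split; first by rewrite oner_eq0.
    by rewrite xp; ring.
  by rewrite r0; ring.
exists (u - val x), (- r); split; first by rewrite oppr_eq0 nzr orbT.
  by rewrite s0 xp; ring.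
by ring.
Qed.

Lemma lowerX x k : (low x 0 ^+ k = low (x ^+ k) 0)%g.
Proof.
elim: k => [|k IHk]; first by rewrite !expg0 lower1.
by rewrite !expgS IHk lowerM mul0r mulr0 addr0.
Qed.

Lemma lower1X y k : (low 1 y ^+ k = low 1 (y *+ k))%g.
Proof.
elim: k => [|k IHk]; first by rewrite expg0 mulr0n lower1.
by rewrite expgS IHk lowerM mulg1 /= mulr1 invr1 mul1r mulrS.
Qed.

Lemma unitX_q1 x : (x ^+ q.-1 = 1)%g.
Proof. by rewrite -(card_units q_pr); apply/expg_cardG; rewrite inE. Qed.

(** If the eigenvalue x differs from its inverse, the element is diagonalisable; otherwise x is 1 or
    -1 and the square of the element is unipotent. *)
Lemma not_irr_exp (g : GL) : g \in G -> ~ irr_elt g ->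
  (g ^+ q.-1 = 1)%g \/ (g ^+ (2 * q) = 1)%g.
Proof.
move=> Gg nirr.
have [v nzv rootv] : exists2 v : Fq, v != 0 & v ^+ 2 - \tr (GLval g) * v + 1 = 0.
  have [v /eqP rootv | noroot] := pickP (fun v : Fq => v ^+ 2 - \tr (GLval g) * v + 1 == 0).
    exists v => //; apply: contra_eq_neq rootv => ->.
    by rewrite expr0n mulr0 subr0 add0r oner_eq0.
  by case: nirr => v; rewrite noroot.
have [x Ex] := neq0_unit nzv; rewrite -Ex in rootv.
have [y] := not_irr_lower Gg rootv.
case: (eqVneq (val x) (val x)^-1) => [xV|xV]; last first.
  move/class_trans/(_ (lower_conj_diag y xV))/imsetP => [h Gh ->].
  by left; rewrite -conjXg lowerX unitX_q1 lower1 conj1g.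
have xx : (x * x = 1)%g by apply: val_inj; rewrite /= {2}xV divff ?unit_neq0.
case/imsetP => h Gh ->; right; rewrite -conjXg expgM expgS expg1 lowerM xx lower1X.
by rewrite -mulr_natr pchar_Fp_0 // mulr0 lower1 conj1g.
Qed.

Section CentIrr.
Variables (g : GL) (p r s u : Fq).
Hypotheses (Gg : g \in G) (irrg : irr_elt g) (Eg : GLval g = mx2 p r s u).
Local Notation t := (p + u).

Let D : p * u - r * s = 1.
Proof. by move: Gg; rewrite inE Eg det_mx2 => /eqP. Qed.

Let irr_t v : v ^+ 2 - t * v + 1 != 0.
Proof. by have := irrg v; rewrite Eg tr_mx2. Qed.

Let nz_r : r != 0.
Proof.
apply: contraNneq (irr_t p) => r0; rewrite -D r0.
by apply/eqP; ring.
Qed.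

(** The centralizer consists of the elements of norm 1 in the quadratic extension generated by g:
    the last equation is the norm of [al + be * g]. *)
Lemma cent_irr_form (h : GL) : h \in 'C_G[g] -> exists al be,
  GLval h = mx2 (al + be * p) (be * r) (be * s) (al + be * u) /\
  al ^+ 2 + al * be * t + be ^+ 2 = 1.
Proof.
case/setIP => Gh /cent1P; have [a [b [c [d [Eh Dh]]]]] := SL2_mx2P Gh.
move/(congr1 (@GLval 2 _)); rewrite !GLmulE Eh Eg !mx2M => /mx2_inj[E1 E2 E3 E4].
have cE : c = b / r * s.
  apply: (mulfI nz_r); have -> : r * c = b * s by apply: (addrI (p * a)); rewrite -E1; ring.
  by field.
have dE : d = a - b / r * p + b / r * u.
  apply: (mulfI nz_r); have -> : r * d = a * r + b * u - p * b by rewrite E2; ring.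
  by field.
exists (a - b / r * p), (b / r); split.
  by rewrite cE dE; congr Defs.mx2; field.
rewrite -[RHS]Dh cE dE -[X in _ + X]mulr1 -D; field => //.
Qed.

(** The norm equation is a conic, parametrised by the slopes of the lines through its point
    [(1, 0)]. No other point has the slope [- t / 2] of the tangent, so this value is free to encode
    [(-1, 0)], while [None] encodes the identity. The upper bound suffices because the powers of b
    will attain it. *)
Lemma card_cent_irr_le : (#|'C_G[g]| <= q.+1)%N.
Proof.
pose be (h : GL) := GLval h 0 1 / r; pose al (h : GL) := GLval h 0 0 - be h * p.
have formE h : h \in 'C_G[g] ->
    GLval h = mx2 (al h + be h * p) (be h * r) (be h * s) (al h + be h * u) /\
    al h ^+ 2 + al h * be h * t + be h ^+ 2 = 1.
  case/cent_irr_form => a [b [Eh Dh]].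
  have -> : be h = b by rewrite /be Eh mxE /= mulfK.
  have -> : al h = a by rewrite /al /be Eh !mxE /= mulfK // addrK.
  by [].
pose slope h : option Fq := if be h == 0 then (if al h == 1 then None else Some (- t / 2))
  else Some ((al h - 1) / be h).
have nz2 := two_neq0 q_pr q_odd.
have slopeE h : h \in 'C_G[g] -> be h != 0 ->
    let m := (al h - 1) / be h in
    be h = - (2 * m + t) / (m ^+ 2 + t * m + 1) /\ m != - t / 2.
  move=> Ch nzb m; have [_ Dh] := formE h Ch.
  have am : al h = 1 + m * be h by rewrite /m divfK //; ring.
  clearbody m.
  have nzm : m ^+ 2 + t * m + 1 != 0 by have := irr_t (- m); rewrite sqrrN mulrN opprK.
  have E : be h * (m ^+ 2 + t * m + 1) = - (2 * m + t).
    apply: (mulfI nzb); apply/eqP; rewrite -subr_eq0; apply/eqP.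
    transitivity (al h ^+ 2 + al h * be h * t + be h ^+ 2 - 1); first by rewrite am; ring.
    by rewrite Dh subrr.
  split; first by rewrite -E mulfK.
  apply: contraNneq nzb => Em; have : be h * (m ^+ 2 + t * m + 1) = 0.
    by rewrite E Em; field.
  by move/eqP; rewrite mulf_eq0 (negbTE nzm) orbF.
have cardo : #|{: option Fq}| = q.+1 by rewrite card_option card_Fp.
rewrite -cardo -cardsT -(@card_in_imset _ _ slope) ?subset_leq_card ?subsetT //.
move=> h k Ch Ck; have [Eh Dh] := formE h Ch; have [Ek Dk] := formE k Ck.
suff eq_ab : slope h = slope k -> al h = al k /\ be h = be k.
  by move/eq_ab => [eqa eqb]; apply: GL_inj; rewrite Eh Ek eqa eqb.
have be0 l : l \in 'C_G[g] -> be l = 0 -> al l != 1 -> al l = -1.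
  move=> Cl b0 na; have [_ Dl] := formE l Cl; move: Dl.
  rewrite b0 mulr0 mul0r expr0n /= !addr0 => /eqP; rewrite sqrf_eq1 (negbTE na).
  by move/eqP.
rewrite /slope; case: (eqVneq (be h) 0) => bh; case: (eqVneq (be k) 0) => bk.
- case: (eqVneq (al h) 1) => ah; case: (eqVneq (al k) 1) => ak //= _.
    by rewrite ah ak bh bk.
  by rewrite bh bk (be0 h) // (be0 k).
- case: ifP => // _ /Some_inj Em; have [_] := slopeE k Ck bk.
  by rewrite -Em eqxx.
- case: ifP => // _ /Some_inj Em; have [_] := slopeE h Ch bh.
  by rewrite Em eqxx.
move/Some_inj => Em; have [Eb _] := slopeE h Ch bh; have [Eb' _] := slopeE k Ck bk.
have eqb : be h = be k by rewrite Eb Em -Eb'.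
split=> //; have : (al h - 1) / be h * be h = (al k - 1) / be k * be k by rewrite Em eqb.
by rewrite !divfK // => /addIr.
Qed.

Lemma cent_irr_trace (h : GL) : h \in 'C_G[g] ->
  \tr (GLval h) = \tr (GLval g) -> h = g \/ h = g^-1%g.
Proof.
move=> Ch; have [a [b [Eh Dh]]] := cent_irr_form Ch.
have nz2 := two_neq0 q_pr q_odd.
rewrite Eh Eg !tr_mx2 => trE.
have E2a : 2 * a = t * (1 - b).
  transitivity (a + b * p + (a + b * u) - t * b); first by ring.
  by rewrite trE; ring.
have nzt : t ^+ 2 - 4 != 0.
  have := irr_t (t / 2); apply: contra_neq => E; apply: (mulfI nz2); apply: (mulfI nz2).
  transitivity (- (t ^+ 2 - 4)); first by field.
  by rewrite E oppr0 !mulr0.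
(* This eliminates a between the trace and norm equations. The solutions [b = 1] and [b = -1] are g
   and its inverse [t - g]. *)
have : (t ^+ 2 - 4) * (1 - b ^+ 2) = 0.
  transitivity ((2 * a) ^+ 2 + 2 * (2 * a) * b * t + 4 * b ^+ 2 - 4).
    by rewrite E2a; ring.
  transitivity (4 * (a ^+ 2 + a * b * t + b ^+ 2) - 4); first by ring.
  by rewrite Dh; ring.
move/eqP; rewrite mulf_eq0 (negbTE nzt) /= subr_eq0 [1 == _]eq_sym sqrf_eq1 => /orP[] /eqP Eb.
  left; apply: GL_inj; rewrite Eh Eg Eb.
  have -> : a = 0 by apply: (mulfI nz2); rewrite E2a Eb; ring.
  by congr Defs.mx2; ring.
right; have Ea : a = t by apply: (mulfI nz2); rewrite E2a Eb; ring.
apply: (mulgI g); rewrite mulgV; apply: GL_inj; rewrite GLmulE Eg Eh Eb Ea mx2M.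
rewrite [RHS]mx2_1; congr Defs.mx2; try ring;
  by rewrite -[RHS]D; ring.
Qed.
End CentIrr.

End IrreducibleElements.

Section CardSL2.
Variable q : nat.
Hypotheses (q_pr : prime q) (q_odd : odd q).
Local Notation Fq := 'F_q.
Local Notation GL := (GL2fin q).
Local Notation G := (SL2_group q).

(** The matrix [diag(x, 1)] has determinant x, so the translates of SL2 by these matrices partition
    the full linear group, whose order is known. *)
Lemma card_SL2 : #|G| = (q.-1 * q * q.+1)%N.
Proof.
have cardGL : #|[set: GL]| = (#|G| * q.-1)%N.
  have diag_unit (x : {unit Fq}) : Defs.mx2 (val x) 0 0 1 \is a GRing.unit.
    by rewrite [_ \is a _]unitmxE det_mx2 mulr1 mul0r subr0; apply: valP.
  pose dg x : GL := FinRing.unit 'M[Fq]_2 (diag_unit x).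
  have det_dg x : \det (GLval (dg x)) = val x by rewrite det_mx2; ring.
  rewrite -(card_units q_pr) -cardsX.
  rewrite -(@card_in_imset _ _ (fun u : GL * {unit Fq} => u.1 * dg u.2)%g); last first.
    move=> [g x] [h y] /setXP[/= Gg _] /setXP[/= Gh _] /= E.
    rewrite !inE in Gg Gh.
    have xy : x = y.
      have := congr1 (fun u : GL => \det (GLval u)) E.
      rewrite !GLmulE !det_mulmx !det_dg (eqP Gg) (eqP Gh) !mul1r.
      by move/val_inj.
    by move: E; rewrite xy => /mulIg ->.
  apply: eq_card => h; rewrite inE; symmetry; apply/imsetP.
  have [x Ex] := neq0_unit (GL_det (h : {'GL_2(q)})).
  exists (h * (dg x)^-1, x)%g; last by rewrite /= mulgKV.
  rewrite !inE andbT; have := det_dg x.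
  have := congr1 (fun u : GL => \det (GLval u)) (mulgKV (dg x) h).
  rewrite GLmulE det_mulmx => E Ed; rewrite Ed Ex in E.
  by apply/eqP/(mulIf (GL_det (h : {'GL_2(q)}))); rewrite E mul1r.
have := card_GL_2 'F_q; rewrite cardGL card_Fp // expnS expn1 => E.
have q1 : (0 < q.-1)%N by have := prime_gt1 q_pr; case: (q) => [|[]].
apply/eqP; rewrite -(eqn_pmul2r q1) E; apply/eqP; ring.
Qed.
End CardSL2.

Section HalfOrder.
Variable q : nat.
Hypotheses (q_pr : prime q) (q_odd : odd q).
Let k := (q - 1)./2.

Lemma q_eq : q = k.*2.+1.
Proof. by rewrite /k; have := q_odd; lia. Qed.

Lemma k_gt0 : (0 < k)%N.
Proof. by have := prime_gt1 q_pr; have := q_eq; lia. Qed.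

Lemma half_q3 : (q - 3)./2 = k.-1.
Proof. by have := k_gt0; have := q_eq; lia. Qed.

End HalfOrder.

Section ClassSizes.
Variable q : nat.
Hypotheses (q_pr : prime q) (q_odd : odd q).
Local Notation Fq := 'F_q.
Local Notation GL := (GL2fin q).
Local Notation G := (SL2_group q).
Local Notation uN1 := (FinRing.unit Fq (unitN1 q)).
Let k := (q - 1)./2.
Let q_eq : q = k.*2.+1 := q_eq q_pr q_odd.

Lemma card_classM (g : GL) : g \in G -> (#|g ^: G| * #|'C_G[g]|)%N = (q.-1 * q * q.+1)%N.
Proof. by move=> Gg; rewrite -index_cent1 mulnC Lagrange ?subsetIl // card_SL2. Qed.

Lemma card_class_unip e y : (e * e = 1)%g -> y != 0 ->
  #|low e y ^: G| = (2 * k * k.+1)%N.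
Proof.
move=> ee nzy; have := card_classM (lower_SL2 e y).
rewrite card_cent_lower_unip // => E.
have q_gt0 := prime_gt0 q_pr; apply/eqP.
rewrite -(@eqn_pmul2r (2 * q)) ?muln_gt0 // E; apply/eqP; have := q_eq; nia.
Qed.

Lemma central_class (g : GL) : (forall h : GL, h \in G -> g * h = h * g)%g -> g ^: G = [set g].
Proof.
move=> cg; apply/setP => h; rewrite inE; apply/imsetP/eqP => [[x Gx ->]|->].
  by rewrite conjgE cg // mulKg.
by exists 1%g; rewrite ?conjg1.
Qed.

Lemma uN1_sqr : (uN1 * uN1 = 1)%g.
Proof. by apply: val_inj; rewrite /= mulrNN mulr1. Qed.

End ClassSizes.

Section NuSection.
Variables (q : nat) (nu : {unit 'F_q}).
Hypotheses (q_pr : prime q) (q_odd : odd q).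
Hypothesis nu_gen : generator [set: {unit 'F_q}] nu.
Local Notation Fq := 'F_q.
Local Notation G := (SL2_group q).

Let k := (q - 1)./2.

Let q_eq : q = k.*2.+1 := q_eq q_pr q_odd.
Let k_gt0 : (0 < k)%N := k_gt0 q_pr q_odd.

Lemma order_nu : #[nu]%g = k.*2.
Proof.
have := nu_gen; rewrite /generator => /eqP E.
by rewrite /order -E card_units // {1}q_eq.
Qed.

Lemma nuX_eq1 i : (nu ^+ i == 1)%g = (k.*2 %| i)%N.
Proof. by rewrite -order_dvdn order_nu. Qed.

Lemma nu_log (x : {unit Fq}) : exists2 i, (i < k.*2)%N & x = (nu ^+ i)%g.
Proof.
have : x \in <[nu]>%g by have := nu_gen; rewrite /generator => /eqP <-; rewrite inE.
by case/cyclePmin => i; rewrite order_nu => lt_i ->; exists i.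
Qed.

(** The order of [nu] is even, so the parity of an exponent of [nu] is well defined. *)
Lemma nu_nonsquare (p : Fq) : p ^+ 2 != val nu.
Proof.
apply/eqP => E; have nzp : p != 0.
  by apply: contra_eq_neq E => ->; rewrite expr0n eq_sym unit_neq0.
have [x Ex] := neq0_unit nzp; have [i _ Ei] := nu_log x.
have Enu : (nu ^+ (i + i) = nu ^+ 1)%g.
  by rewrite expg1 expgD -Ei; apply: val_inj; rewrite /= Ex -E.
move/eqP: Enu; rewrite eq_expg_mod_order order_nu => /eqP/(congr1 odd).
have oddm n : odd (n %% k.*2) = odd n.
  by rewrite [in RHS](divn_eq n k.*2) oddD oddM odd_double andbF.
by rewrite !oddm addnn odd_double.
Qed.

Lemma elt_aX l : (low nu 0 ^+ l)%g = low (nu ^+ l)%g 0.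
Proof. exact: lowerX. Qed.

Lemma nuX_neqV l : (0 < l < k)%N -> val (nu ^+ l)%g != (val (nu ^+ l)%g)^-1.
Proof.
move=> /andP[l_gt0 ltlk]; rewrite -unitVE (inj_eq val_inj) eq_sym eq_invg_mul -expgD nuX_eq1 addnn.
by rewrite gtnNdvd ?double_gt0 // ltn_double.
Qed.

Lemma card_class_a l : (0 < l < k)%N -> #|(low nu 0 ^+ l)%g ^: G| = (q * q.+1)%N.
Proof.
move=> lk; have nz := nuX_neqV lk; have := card_classM q_pr (lower_SL2 (nu ^+ l)%g 0).
rewrite card_cent_lower_diag // -elt_aX => E.
have q1 : (0 < q.-1)%N by have := prime_gt1 q_pr; lia.
by apply/eqP; rewrite -(eqn_pmul2r q1) E; apply/eqP; ring.
Qed.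

End NuSection.

(** * Powers of an element of order q + 1 *)

Section NonsplitTorus.
Variables (q : nat) (b : GL2fin q).
Hypotheses (q_pr : prime q) (q_odd : odd q).
Hypotheses (Gb : b \in SL2_group q) (ob : #[b]%g = q.+1).
Local Notation G := (SL2_group q).
Let k := (q - 1)./2.
Let q_eq : q = k.*2.+1 := q_eq q_pr q_odd.
Let k_gt0 : (0 < k)%N := k_gt0 q_pr q_odd.

(** An eigenvalue would make the order of [b ^+ m] divide [q.-1] or [2 * q]. Together with the order
    [q.+1] of b, either case gives [b ^+ m.*2 = 1]. *)
Lemma bX_irr m : ~~ (q.+1 %| m.*2)%N -> irr_elt (b ^+ m)%g.
Proof.
move=> ndiv; apply: boolp.contrapT => nirr.
have : (b ^+ (q.+1) = 1)%g by rewrite -ob expg_order.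
move=> b1; case/negP: ndiv; rewrite -ob order_dvdn -addnn.
have q_gt0 := prime_gt0 q_pr.
case: (not_irr_exp q_pr (groupX m Gb) nirr); rewrite -expgM => E.
  have : (b ^+ (m * q.-1 + m.*2) = 1)%g.
    rewrite (_ : (_ + _)%N = q.+1 * m)%N; first by rewrite expgM b1 expg1n.
    by rewrite -{2}(prednK q_gt0); lia.
  by rewrite expgD E mul1g -addnn => ->.
have : (b ^+ (m * (2 * q) + m.*2) = 1)%g.
  rewrite (_ : (_ + _)%N = q.+1 * m.*2)%N; first by rewrite expgM b1 expg1n.
  by lia.
by rewrite expgD E mul1g -addnn => ->.
Qed.

Lemma bX_irr_half m : (0 < m <= k)%N -> irr_elt (b ^+ m)%g.
Proof.
move=> /andP[m_gt0 le_mk]; apply: bX_irr; rewrite gtnNdvd ?double_gt0 //.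
by have := q_eq; lia.
Qed.

Lemma cent_bX m : irr_elt (b ^+ m)%g -> 'C_G[b ^+ m]%g = <[b]>%g.
Proof.
move=> irrb; apply/eqP; rewrite eq_sym eqEcard; apply/andP; split.
  by rewrite subsetI cycle_subG Gb /= cycle_subG; apply/cent1P/commuteX.
have [p [r [s [u [Eg _]]]]] := SL2_mx2P (groupX m Gb).
by rewrite -[#|<[b]>%g|]/(#[b]%g) ob; apply: card_cent_irr_le Eg; rewrite // groupX.
Qed.

Lemma bX_class m n : irr_elt (b ^+ m)%g -> (b ^+ n)%g \in (b ^+ m)%g ^: G ->
  (b ^+ n = b ^+ m \/ b ^+ n = b ^- m)%g.
Proof.
move=> irrb /class_trace trE; have [p [r [s [u [Eg _]]]]] := SL2_mx2P (groupX m Gb).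
apply: (cent_irr_trace q_pr q_odd _ irrb Eg) => //; first exact: groupX.
by rewrite inE groupX //; apply/cent1P/commuteX2.
Qed.

Lemma bX_eq m n : (b ^+ m == b ^+ n)%g = (m == n %[mod q.+1]).
Proof. by rewrite eq_expg_mod_order ob. Qed.

Lemma card_class_b m : (0 < m <= k)%N -> #|(b ^+ m)%g ^: G| = (q.-1 * q)%N.
Proof.
move=> mk; have := card_classM q_pr (groupX m Gb); rewrite (cent_bX (bX_irr_half mk)).
rewrite -[#|<[b]>%g|]/(#[b]%g) ob => E.
by apply/eqP; rewrite -(eqn_pmul2r (ltn0Sn q)) E.
Qed.

End NonsplitTorus.

(** * A complete list of class representatives *)

Section ClassList.
Variables (q : nat) (nu : {unit 'F_q}) (b : GL2fin q).
Hypotheses (q_pr : prime q) (q_odd : odd q).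
Hypothesis nu_gen : generator [set: {unit 'F_q}] nu.
Hypotheses (Gb : b \in SL2_group q) (ob : #[b]%g = q.+1).
Local Notation Fq := 'F_q.
Local Notation GL := (GL2fin q).
Local Notation G := (SL2_group q).
Local Notation uN1 := (FinRing.unit Fq (unitN1 q)).
Let k := (q - 1)./2.
Let q_eq : q = k.*2.+1 := q_eq q_pr q_odd.

(** These pairs encode 1, z, c, d, zc, zd by diagonal entry and lower left entry. Multiplication by
    z negates both, whence [-1] and [- val nu]. *)
Definition unip_reps : seq ({unit Fq} * Fq) :=
  [:: (1%g, 0); (uN1, 0); (1%g, 1); (1%g, val nu); (uN1, -1); (uN1, - val nu)].

Definition class_reps : seq GL :=
  [seq low u.1 u.2 | u <- unip_reps] ++
  [seq (low nu 0 ^+ l)%g | l <- iota 1 k.-1] ++ [seq (b ^+ m)%g | m <- iota 1 k].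

Lemma unip_reps_inj e y e' y' : (e, y) \in unip_reps -> (e', y') \in unip_reps ->
  low e' y' \in low e y ^: G -> (e, y) = (e', y').
Proof.
have neN1 : (1%g : {unit Fq}) == uN1 = false.
  by rewrite -(inj_eq val_inj) /= -subr_eq0 opprK (negbTE (two_neq0 q_pr q_odd)).
have ee u : u \in unip_reps -> (u.1 * u.1 = 1)%g /\ (u.2 = 0 \/ u.2 != 0).
  rewrite !inE => /or4P[/eqP->|/eqP->|/eqP->|] /=; rewrite ?uN1_sqr ?mulg1 //.
  - by split=> //; left.
  - by split=> //; left.
  - by split=> //; right.
  case/or3P => /eqP -> /=; rewrite ?uN1_sqr ?mulg1 ?oppr_eq0 ?oner_neq0 ?unit_neq0;
    by split=> //; right.
move=> u1 u2; have [/= e1 y01] := ee _ u1; have [/= e2 y02] := ee _ u2 => cl.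
have eE : e' = e.
  have := class_trace cl; rewrite !GLval_lower !tr_mx2.
  have vV (x : {unit Fq}) : (x * x = 1)%g -> (val x)^-1 = val x.
    by move=> xx; rewrite -unitVE; congr val; apply/eqP; rewrite eq_sym eq_mulgV1 invgK xx.
  rewrite !vV // => E; apply: val_inj; apply: (mulIf (two_neq0 q_pr q_odd)).
  by rewrite !mulr_natr !mulr2n.
case: y01 => [y0|nzy].
  have : low e' y' = low e y.
    have cG (h : GL) : h \in G -> (low e y * h = h * low e y)%g.
      move=> Gh; case: (unit_sqr1 e1) => ->; rewrite y0 ?lower1 ?mulg1 ?mul1g //.
      exact: elt_z_central.
    by move: cl; rewrite (central_class cG) inE => /eqP.
  by case/lower_inj => -> ->.
rewrite eE in u2 cl *; have [p nzp Ep] := lower_conj_sqr _ e1 nzy cl.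
have yP w : (e, w) \in unip_reps -> w != 0 -> w = val e \/ w = val e * val nu.
  rewrite !inE => /or4P[/eqP[_ ->]|/eqP[_ ->]|/eqP[-> ->]|] /=; rewrite ?eqxx //; first by left.
  case/or3P => /eqP[-> ->] _ /=; [right | left | right]; rewrite ?mul1r ?mulN1r //.
have nzy' : y' != 0 by rewrite Ep mulf_neq0 ?expf_neq0.
have nze := unit_neq0 e.
(* If the two entries differ, their ratio is [nu] or its inverse, and it would have to be the square
   of p. *)
case: (yP _ u1 nzy) (yP _ u2 nzy') Ep => -> [] -> // Ep.
  case/eqP: (nu_nonsquare q_pr q_odd nu_gen p); apply: (mulfI nze); rewrite Ep; exact: mulrC.
case/eqP: (nu_nonsquare q_pr q_odd nu_gen p^-1); apply: (mulfI nze).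
by rewrite {1}Ep; field.
Qed.
End ClassList.

Section ClassList2.
Variables (q : nat) (nu : {unit 'F_q}) (b : GL2fin q).
Hypotheses (q_pr : prime q) (q_odd : odd q).
Hypothesis nu_gen : generator [set: {unit 'F_q}] nu.
Hypotheses (Gb : b \in SL2_group q) (ob : #[b]%g = q.+1).
Local Notation Fq := 'F_q.
Local Notation GL := (GL2fin q).
Local Notation G := (SL2_group q).
Local Notation uN1 := (FinRing.unit Fq (unitN1 q)).
Local Notation k := ((q - 1)./2).
Local Notation unip_reps := (unip_reps nu).
Local Notation class_reps := (class_reps nu b).

Let nz2 := two_neq0 q_pr q_odd.

Lemma unitV_sqr (x : {unit Fq}) : (x * x = 1)%g -> (val x)^-1 = val x.
Proof. by move=> xx; rewrite -unitVE; congr val; apply/eqP; rewrite eq_sym eq_mulgV1 invgK xx. Qed.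

Lemma unit_sqr_val (x : {unit Fq}) : (x * x = 1)%g -> val x * val x = 1.
Proof. by move=> xx; rewrite -{1}(unitV_sqr xx) mulVf // unit_neq0. Qed.

Lemma unip_reps_sqr u : u \in unip_reps -> (u.1 * u.1 = 1)%g.
Proof. by rewrite !inE => /or4P[|||/or3P[]] /eqP -> /=; rewrite ?uN1_sqr ?mulg1. Qed.

Lemma irr_trace_sqr (g : GL) : irr_elt g -> \tr (GLval g) ^+ 2 != 4.
Proof.
move=> irrg; have := irrg (\tr (GLval g) / 2); apply: contra_neq => E.
apply: (mulfI nz2); apply: (mulfI nz2).
transitivity (4 - \tr (GLval g) ^+ 2); first by field.
by rewrite E subrr !mulr0.
Qed.

Lemma unip_trace_sqr u : u \in unip_reps -> \tr (GLval (low u.1 u.2)) ^+ 2 = 4.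
Proof.
move/unip_reps_sqr => uu; rewrite GLval_lower tr_mx2 unitV_sqr //.
have aux (v : Fq) : v * v = 1 -> (v + v) ^+ 2 = 4.
  by move=> vv; transitivity (4 * (v * v)); [ring | rewrite vv mulr1].
exact/aux/unit_sqr_val.
Qed.

Lemma lower_trace_sqr (x : {unit Fq}) y : val x != (val x)^-1 ->
  \tr (GLval (low x y)) ^+ 2 != 4.
Proof.
rewrite GLval_lower tr_mx2 -subr_eq0; apply: contra_neq => E.
apply/eqP; rewrite -sqrf_eq0; apply/eqP.
have nzx := unit_neq0 x.
by transitivity ((val x + (val x)^-1) ^+ 2 - 4); [field | rewrite E subrr].
Qed.

Lemma nuX_eqV l l' : (nu ^+ l' = nu ^- l)%g -> (0 < l < k)%N -> (0 < l' < k)%N -> False.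
Proof.
move=> E l1 l2; have : (nu ^+ (l' + l) == 1)%g by rewrite expgD E mulVg.
by rewrite (nuX_eq1 q_pr q_odd nu_gen) => /dvdn_leq; lia.
Qed.

Lemma nuX_inj l l' : (nu ^+ l' = nu ^+ l)%g -> (0 < l < k)%N -> (0 < l' < k)%N -> l = l'.
Proof.
move/eqP; rewrite eq_expg_mod_order (order_nu q_pr q_odd nu_gen) => E l1 l2.
by have := E; rewrite !modn_small => [/eqP->||]; lia.
Qed.

Lemma unit_sum_inv (x y : {unit Fq}) :
  val x + (val x)^-1 = val y + (val y)^-1 -> y = x \/ y = x^-1%g.
Proof.
have nzx := unit_neq0 x; have nzy := unit_neq0 y => E.
have : (val y - val x) * (val y - (val x)^-1) = 0.
  transitivity (val y * (val y + (val y)^-1 - (val x + (val x)^-1))); first by field; rewrite nzx.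
  by rewrite E subrr mulr0.
by move/eqP; rewrite mulf_eq0 !subr_eq0 => /orP[] /eqP e; [left | right]; apply: val_inj.
Qed.

(** The squared trace is 4 on the first six representatives and on no others, and among the others
    only the powers of a have eigenvalues. Inside either torus a class determines the exponent up to
    sign, and the ranges leave one choice. *)
Lemma class_reps_uniq : uniq [seq r ^: G | r <- class_reps].
Proof.
have in_iota i n : (i \in iota 1 n) = (0 < i <= n)%N by rewrite mem_iota add1n ltnS.
have k0 := k_gt0 q_pr q_odd.
have in_a l : l \in iota 1 k.-1 -> (0 < l < k)%N by rewrite in_iota; lia.
have in_b m : m \in iota 1 k -> (0 < m <= k)%N by rewrite in_iota.
have rep_in (r s : GL) : r ^: G = s ^: G -> r \in s ^: G by move=> <-; apply: class_refl.
rewrite /class_reps !map_cat !cat_uniq; apply/and3P; split.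
- rewrite -map_comp map_inj_in_uniq.
    rewrite /= !inE !xpair_eqE.
    have neN1 : (1%g : {unit Fq}) == uN1 = false.
      by rewrite -(inj_eq val_inj) /= -subr_eq0 opprK (negbTE nz2).
    have nz : (val nu == 0) = false by rewrite (negbTE (unit_neq0 _)).
    have n1 : (1 == val nu) = false.
      by have := nu_nonsquare q_pr q_odd nu_gen 1; rewrite expr1n => /negbTE.
    rewrite !neN1 ![uN1 == 1%g]eq_sym !neN1 !eqxx /= ![0 == _]eq_sym !oppr_eq0 oner_eq0 nz.
    by rewrite eqr_opp n1.
  move=> [e y] [e' y'] u1 u2 /= /rep_in cl.
  by rewrite (unip_reps_inj q_pr q_odd nu_gen u2 u1 cl).
- apply/hasPn => C; rewrite mem_cat => /orP[] /mapP[g] /mapP[j j_in ->] ->; apply/negP.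
    move/mapP => [h] /mapP[u u_in ->] /rep_in/class_trace E.
    have := lower_trace_sqr 0 (nuX_neqV q_pr q_odd nu_gen (in_a _ j_in)).
    by rewrite -elt_aX E unip_trace_sqr ?eqxx.
  move/mapP => [h] /mapP[u u_in ->] /rep_in/class_trace E.
  have := irr_trace_sqr (bX_irr_half q_pr q_odd Gb ob (in_b _ j_in)).
  by rewrite E unip_trace_sqr ?eqxx.
- apply/and3P; split.
  + rewrite -map_comp map_inj_in_uniq ?iota_uniq // => l l' /in_a ll /in_a ll' /= /rep_in/class_trace.
    rewrite !elt_aX !GLval_lower !tr_mx2 => /unit_sum_inv[E|E].
      by apply: nuX_inj.
    by case: (nuX_eqV _ ll ll').
  + apply/hasPn => C /mapP[g] /mapP[m m_in ->] ->; apply/negP => /mapP[h] /mapP[l l_in ->].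
    move/rep_in; rewrite class_sym elt_aX => cl.
    apply: (@lower_not_irr q (nu ^+ l)%g 0).
    exact: irr_class cl (bX_irr_half q_pr q_odd Gb ob (in_b _ m_in)).
  rewrite -map_comp map_inj_in_uniq ?iota_uniq // => m m' /in_b mm /in_b mm' /= /rep_in cl.
  have := bX_class q_pr q_odd Gb (bX_irr_half q_pr q_odd Gb ob mm') cl.
  case=> E; last first.
    have : (b ^+ (m + m') == 1)%g by rewrite expgD E mulVg.
    by rewrite -order_dvdn ob => /dvdn_leq; lia.
  have /eqP := E; rewrite bX_eq // !modn_small; last 2 first.
  - by lia.
  - by lia.
  by move/eqP.
Qed.

Lemma class_reps_sub : {subset class_reps <= G}.
Proof.
move=> g; rewrite !mem_cat => /or3P[] /mapP[j _ ->]; first exact: lower_SL2.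
  by rewrite groupX // lower_SL2.
by rewrite groupX.
Qed.

(** An arbitrary f serves twice: a constant gives the count that proves the list complete, and a
    class function then gives its sum over the group. *)
Lemma class_size_sum (V : nmodType) (f : GL -> V) :
  \sum_(r <- class_reps) f r *+ #|r ^: G| =
  f 1%g + f (sz q) + (f (low 1%g 1) + f (low 1%g (val nu)) +
    (f (sz q * low 1%g 1%R)%g + f (sz q * low 1%g (val nu))%g)) *+ (2 * k * k.+1) +
  ((\sum_(1 <= l < k) f (low nu 0 ^+ l)%g) *+ (q * q.+1) +
   (\sum_(1 <= m < k.+1) f (b ^+ m)%g) *+ (q.-1 * q)).
Proof.
have k0 := k_gt0 q_pr q_odd.
have c1 (g : GL) : (forall h, h \in G -> g * h = h * g)%g -> #|g ^: G| = 1%N.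
  by move=> /central_class ->; rewrite cards1.
have in_a l : l \in iota 1 k.-1 -> (0 < l < k)%N by rewrite mem_iota add1n prednK.
have in_b m : m \in iota 1 k -> (0 < m <= k)%N by rewrite mem_iota add1n ltnS.
have ia : index_iota 1 k = iota 1 k.-1 by rewrite /index_iota subn1.
have ib : index_iota 1 k.+1 = iota 1 k by rewrite /index_iota subn1.
rewrite ia ib /class_reps !big_cat /= !big_map; congr (_ + (_ + _)); last 2 first.
- rewrite -sumrMnl big_seq [RHS]big_seq; apply: eq_bigr => l l_in.
  by rewrite (card_class_a q_pr q_odd nu_gen (in_a _ l_in)).
- rewrite -sumrMnl big_seq [RHS]big_seq; apply: eq_bigr => m m_in.
  by rewrite (card_class_b q_pr q_odd Gb ob (in_b _ m_in)).
have u1 (y : Fq) : y != 0 -> #|low 1%g y ^: G| = (2 * k * k.+1)%N.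
  by apply: card_class_unip => //; apply: mul1g.
have u2 (y : Fq) : y != 0 -> #|low uN1 (- y) ^: G| = (2 * k * k.+1)%N.
  by move=> nzy; apply: card_class_unip => //; [apply: uN1_sqr | rewrite oppr_eq0].
have zE (y : Fq) : (sz q * low 1%g y)%g = low uN1 (- y) by rewrite elt_z_lower mulg1.
have e1 : #|low 1%g 0 ^: G| = 1%N.
  by apply: c1 => h _; rewrite lower1 mul1g mulg1.
have ez : #|low uN1 0 ^: G| = 1%N by apply: c1 => h _; apply: elt_z_central.
rewrite /unip_reps !big_cons big_nil addr0 /=.
rewrite e1 ez (u1 1) ?oner_neq0 // (u1 (val nu)) ?unit_neq0 // (u2 1) ?oner_neq0 //.
rewrite (u2 (val nu)) ?unit_neq0 // lower1 !zE !mulr1n !mulrnDl.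
by rewrite -[low uN1 0]/(sz q) !addrA.
Qed.

Lemma class_reps_card : (\sum_(r <- class_reps) #|r ^: G|)%N = #|G|.
Proof.
have mulnE (m n : nat) : m *+ n = (m * n)%N by rewrite -mulr_natr natn.
have := class_size_sum (fun=> 1%N).
rewrite (eq_bigr (fun r => #|r ^: G|)) => [->|r _]; last first.
  exact: etrans (mulnE 1%N _) (mul1n _).
rewrite ![_ *+ _]mulnE !sum_nat_const_nat !muln1 card_SL2 //.
have := q_eq q_pr q_odd; have := k_gt0 q_pr q_odd; move: k => n n_gt0 ->.
rewrite -[n.*2.+1.-1]/n.*2 -addnn; case: n n_gt0 => // n _; rewrite !subn1 /=; nia.
Qed.

Definition sl2_exhaust := class_reps_exist class_reps_uniq class_reps_card class_reps_sub.

Lemma SL2_class_sum (V : nmodType) (f : GL -> V) :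
  {in G &, forall g x, f (g ^ x)%g = f g} ->
  \sum_(g in G) f g =
  f 1%g + f (sz q) + (f (low 1%g 1) + f (low 1%g (val nu)) +
    (f (sz q * low 1%g 1%R)%g + f (sz q * low 1%g (val nu))%g)) *+ (2 * k * k.+1) +
  ((\sum_(1 <= l < k) f (low nu 0 ^+ l)%g) *+ (q * q.+1) +
   (\sum_(1 <= m < k.+1) f (b ^+ m)%g) *+ (q.-1 * q)).
Proof.
move=> fJ; rewrite -class_size_sum.
exact: (class_reps_sum class_reps_uniq class_reps_card class_reps_sub fJ).
Qed.

End ClassList2.

(** * Class functions given by their rows in the table *)

Section Rows.
Variables (C : numFieldType) (q : nat) (nu : {unit 'F_q}) (b : GL2fin q).
Hypotheses (q_pr : prime q) (q_odd : odd q).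
Hypothesis nu_gen : generator [set: {unit 'F_q}] nu.
Hypotheses (Gb : b \in SL2_group q) (ob : #[b]%g = q.+1).
Local Notation Fq := 'F_q.
Local Notation GL := (GL2fin q).
Local Notation G := (SL2_group q).
Local Notation uN1 := (FinRing.unit Fq (unitN1 q)).
Local Notation k := ((q - 1)./2).

(** The values at zc and zd are recorded separately because the rule that derives them from the
    other entries is lost in sums of characters with different central signs. *)
Record row_data := RowData {
  at_1 : C; at_z : C; at_c : C; at_d : C; at_zc : C; at_zd : C;
  at_a : nat -> C; at_b : nat -> C }.

Definition class_function (f : GL -> C) := {in G &, forall g x, f (g ^ x)%g = f g}.

Record has_row (f : GL -> C) (r : row_data) : Prop := HasRow {
  row_class : class_function f;
  row_1 : f 1%g = at_1 r;
  row_z : f (sz q) = at_z r;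
  row_c : f (low 1%g 1) = at_c r;
  row_d : f (low 1%g (val nu)) = at_d r;
  row_zc : f (sz q * low 1%g 1%R)%g = at_zc r;
  row_zd : f (sz q * low 1%g (val nu))%g = at_zd r;
  row_a : forall l, (0 < l < k)%N -> f (low nu 0 ^+ l)%g = at_a r l;
  row_b : forall m, (0 < m <= k)%N -> f (b ^+ m)%g = at_b r m }.

Lemma sz_low_unip y : (sz q * low 1%g y)%g = low uN1 (- y).
Proof. by rewrite elt_z_lower mulg1. Qed.

Lemma class_reps_ind (P : GL -> Prop) :
  P 1%g -> P (sz q) -> P (low 1%g 1) -> P (low 1%g (val nu)) ->
  P (sz q * low 1%g 1%R)%g -> P (sz q * low 1%g (val nu))%g ->
  (forall l, (0 < l < k)%N -> P (low nu 0 ^+ l)%g) ->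
  (forall m, (0 < m <= k)%N -> P (b ^+ m)%g) ->
  forall r, r \in class_reps nu b -> P r.
Proof.
move=> P1 Pz Pc Pd Pzc Pzd Pa Pb r.
have k0 := k_gt0 q_pr q_odd.
rewrite /class_reps !mem_cat => /or3P[] /mapP[u u_in ->].
- move: u_in; rewrite !inE => /or4P[|||/or3P[]] /eqP -> /=; rewrite -?sz_low_unip //.
  by rewrite lower1.
- by apply: Pa; move: u_in; rewrite mem_iota add1n prednK.
by apply: Pb; move: u_in; rewrite mem_iota add1n ltnS.
Qed.

Lemma class_function_eq f f' : class_function f -> class_function f' ->
  {in class_reps nu b, f =1 f'} -> {in G, f =1 f'}.
Proof.
move=> cf cf' eqff' g Gg.
have [r r_in /imsetP[x Gx ->]] := sl2_exhaust q_pr q_odd nu_gen Gb ob Gg.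
have Gr := class_reps_sub Gb r_in.
by rewrite cf // cf' // eqff'.
Qed.

Lemma has_row_eq f f' r r' : has_row f r -> has_row f' r' ->
  [/\ at_1 r = at_1 r', at_z r = at_z r', at_c r = at_c r', at_d r = at_d r' &
      at_zc r = at_zc r'] ->
  [/\ at_zd r = at_zd r', forall l, (0 < l < k)%N -> at_a r l = at_a r' l &
     forall m, (0 < m <= k)%N -> at_b r m = at_b r' m] ->
  {in G, f =1 f'}.
Proof.
move=> [cf f1 fz fc fd fzc fzd fa fb] [cf' f1' fz' fc' fd' fzc' fzd' fa' fb'].
move=> [e1 ez ec ed ezc] [ezd ea eb]; apply: class_function_eq => // g.
apply: (class_reps_ind (P := fun g => f g = f' g)).
- by rewrite f1 f1' e1.
- by rewrite fz fz' ez.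
- by rewrite fc fc' ec.
- by rewrite fd fd' ed.
- by rewrite fzc fzc' ezc.
- by rewrite fzd fzd' ezd.
- by move=> l ll; rewrite fa // fa' // ea.
by move=> m mm; rewrite fb // fb' // eb.
Qed.

Lemma has_row_sum f r : has_row f r ->
  \sum_(g in G) f g = at_1 r + at_z r +
    (at_c r + at_d r + (at_zc r + at_zd r)) *+ (2 * k * k.+1) +
    ((\sum_(1 <= l < k) at_a r l) *+ (q * q.+1) +
     (\sum_(1 <= m < k.+1) at_b r m) *+ (q.-1 * q)).
Proof.
case=> cf f1 fz fc fd fzc fzd fa fb.
rewrite (SL2_class_sum q_pr q_odd nu_gen Gb ob cf) f1 fz fc fd fzc fzd.
congr (_ + (_ *+ _ + _ *+ _)).
  by rewrite big_nat [RHS]big_nat; apply: eq_bigr => l /fa.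
by rewrite big_nat [RHS]big_nat; apply: eq_bigr => l /fb.
Qed.

Lemma has_rowD f r f' r' : has_row f r -> has_row f' r' ->
  has_row (fun g => f g + f' g)
    (RowData (at_1 r + at_1 r') (at_z r + at_z r') (at_c r + at_c r') (at_d r + at_d r')
      (at_zc r + at_zc r') (at_zd r + at_zd r')
      (fun l => at_a r l + at_a r' l) (fun m => at_b r m + at_b r' m)).
Proof.
move=> [cf f1 fz fc fd fzc fzd fa fb] [cf' f1' fz' fc' fd' fzc' fzd' fa' fb'].
split=> [g x Gg Gx|||||||l ll|m mm] /=.
- by rewrite cf // cf'.
- by rewrite f1 f1'.
- by rewrite fz fz'.
- by rewrite fc fc'.
- by rewrite fd fd'.
- by rewrite fzc fzc'.
- by rewrite fzd fzd'.
- by rewrite fa // fa'.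
by rewrite fb // fb'.
Qed.

Lemma has_rowB f r f' r' : has_row f r -> has_row f' r' ->
  has_row (fun g => f g - f' g)
    (RowData (at_1 r - at_1 r') (at_z r - at_z r') (at_c r - at_c r') (at_d r - at_d r')
      (at_zc r - at_zc r') (at_zd r - at_zd r')
      (fun l => at_a r l - at_a r' l) (fun m => at_b r m - at_b r' m)).
Proof.
move=> [cf f1 fz fc fd fzc fzd fa fb] [cf' f1' fz' fc' fd' fzc' fzd' fa' fb'].
split=> [g x Gg Gx|||||||l ll|m mm] /=.
- by rewrite cf // cf'.
- by rewrite f1 f1'.
- by rewrite fz fz'.
- by rewrite fc fc'.
- by rewrite fd fd'.
- by rewrite fzc fzc'.
- by rewrite fzd fzd'.
- by rewrite fa // fa'.
by rewrite fb // fb'.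
Qed.

Lemma has_row_const (x : C) :
  has_row (fun=> x) (RowData x x x x x x (fun=> x) (fun=> x)).
Proof. by split. Qed.

Lemma has_row_bigsum (I : Type) (s : seq I) (P : pred I) (f : I -> GL -> C) (r : I -> row_data) :
  (forall i, P i -> has_row (f i) (r i)) ->
  has_row (fun g => \sum_(i <- s | P i) f i g)
    (RowData (\sum_(i <- s | P i) at_1 (r i)) (\sum_(i <- s | P i) at_z (r i))
      (\sum_(i <- s | P i) at_c (r i)) (\sum_(i <- s | P i) at_d (r i))
      (\sum_(i <- s | P i) at_zc (r i)) (\sum_(i <- s | P i) at_zd (r i))
      (fun l => \sum_(i <- s | P i) at_a (r i) l) (fun m => \sum_(i <- s | P i) at_b (r i) m)).
Proof.
move=> fr; split=> [g x Gg Gx|||||||l ll|m mm] /=; apply: eq_bigr => i /fr [] //.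
- by move=> cf *; apply: cf.
- by move=> *; auto.
by move=> *; auto.
Qed.
End Rows.

(** * The effect of inversion on conjugacy classes *)

Section InverseRows.
Variables (C : numFieldType) (q : nat) (nu : {unit 'F_q}) (b : GL2fin q).
Hypotheses (q_pr : prime q) (q_odd : odd q).
Hypothesis nu_gen : generator [set: {unit 'F_q}] nu.
Hypotheses (Gb : b \in SL2_group q) (ob : #[b]%g = q.+1).
Local Notation Fq := 'F_q.
Local Notation GL := (GL2fin q).
Local Notation G := (SL2_group q).
Local Notation uN1 := (FinRing.unit Fq (unitN1 q)).
Local Notation k := ((q - 1)./2).

Lemma nuX_k : (nu ^+ k)%g = uN1.
Proof.
have k0 := k_gt0 q_pr q_odd.
have : (nu ^+ k * nu ^+ k = 1)%g.
  by apply/eqP; rewrite -expgD (nuX_eq1 q_pr q_odd nu_gen) addnn.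
case/unit_sqr1 => // /eqP; rewrite (nuX_eq1 q_pr q_odd nu_gen) => /dvdn_leq - /(_ k0).
by rewrite -addnn -{3}[k]addn0 leq_add2l leqNgt k0.
Qed.

Lemma square_or_nu (y : Fq) : y != 0 ->
  exists2 p, p != 0 & y = p ^+ 2 \/ y = p ^+ 2 * val nu.
Proof.
move=> nzy; have [x <-] := neq0_unit nzy.
have [i _ ->] := nu_log q_pr q_odd nu_gen x.
have valX (n : nat) : val (nu ^+ n)%g = val nu ^+ n.
  by elim: n => [|n IHn]; rewrite ?expg0 // expgS exprS -IHn.
exists (val nu ^+ i./2); first by rewrite expf_neq0 ?unit_neq0.
rewrite valX -{1 3}(odd_double_half i) -muln2; case: (odd i); [right | left].
  by rewrite add1n exprS exprM mulrC.
by rewrite add0n exprM.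
Qed.

Lemma neg1_square : ~~ odd k -> exists2 p : Fq, p != 0 & -1 = p ^+ 2.
Proof.
move=> ev; exists (val (nu ^+ k./2)%g); first exact: unit_neq0.
rewrite -[-1]/(val uN1) -nuX_k -{1}(odd_double_half k) (negbTE ev) add0n -addnn.
by rewrite expgD.
Qed.

Lemma neg1_nonsquare : odd k -> exists2 p : Fq, p != 0 & -1 = p ^+ 2 * val nu.
Proof.
move=> od; exists (val (nu ^+ k./2)%g); first exact: unit_neq0.
rewrite -[-1]/(val uN1) -nuX_k -{1}(odd_double_half k) od add1n -addnn.
by rewrite expgSr expgD.
Qed.

Variable f : GL -> C.
Hypothesis cf : @class_function C q f.

Lemma class_functionJ g h : g \in G -> h \in g ^: G -> f h = f g.
Proof. by move=> Gg /imsetP[x Gx ->]; apply: cf. Qed.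

Lemma class_function_unip e y p : (e * e = 1)%g -> y != 0 -> p != 0 ->
  f (low e (p ^+ 2 * y)) = f (low e y).
Proof.
move=> ee nzy nzp; apply: class_functionJ; first exact: lower_SL2.
by apply/(lower_conj_sqr _ ee nzy); exists p.
Qed.

(** Inversion negates the lower left entry. For even [k] the scalar -1 is a square; for odd [k] it
    is a square times [nu], so the two square classes are exchanged. *)
Lemma unip_inv e y : (e * e = 1)%g -> y != 0 ->
  f (low e y)^-1%g = if odd k then f (low e (val nu * y)) else f (low e y).
Proof.
move=> ee nzy; rewrite lowerV.
have -> : (e^-1 = e)%g by apply/eqP; rewrite eq_sym eq_mulgV1 invgK ee.
case: ifP => [/neg1_nonsquare[p nzp Ep]|/negbT/neg1_square[p nzp Ep]].
  have -> : - y = p ^+ 2 * (val nu * y) by rewrite mulrA -Ep mulN1r.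
  by rewrite class_function_unip // mulf_neq0 ?unit_neq0.
have -> : - y = p ^+ 2 * y by rewrite -Ep mulN1r.
exact: class_function_unip.
Qed.

Lemma unip_nunu e y : (e * e = 1)%g -> y != 0 ->
  f (low e (val nu * (val nu * y))) = f (low e y).
Proof.
by move=> ee nzy; rewrite mulrA -expr2 class_function_unip ?unit_neq0.
Qed.
End InverseRows.

Section InverseRows2.
Variables (C : numFieldType) (q : nat) (nu : {unit 'F_q}) (b : GL2fin q).
Hypotheses (q_pr : prime q) (q_odd : odd q).
Hypothesis nu_gen : generator [set: {unit 'F_q}] nu.
Hypotheses (Gb : b \in SL2_group q) (ob : #[b]%g = q.+1).
Local Notation Fq := 'F_q.
Local Notation GL := (GL2fin q).
Local Notation G := (SL2_group q).
Local Notation uN1 := (FinRing.unit Fq (unitN1 q)).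
Local Notation k := ((q - 1)./2).

(** No conjugating matrix is written down. The inverse has the same trace, hence no eigenvalue, so
    by completeness of the class list it is conjugate to some [b ^+ u] in the range. Being a power
    of b, it is then [b ^+ u] or [b ^- u]; the exponents are too small for the first. *)
Lemma bX_inv_class m : (0 < m <= k)%N -> (b ^- m)%g \in (b ^+ m)%g ^: G.
Proof.
move=> mm; have irrb := bX_irr_half q_pr q_odd Gb ob mm.
have Gbm := groupX m Gb; have GbV : (b ^- m)%g \in G by rewrite groupV.
have trV : \tr (GLval (b ^- m)%g) = \tr (GLval (b ^+ m)%g).
  have [p [r [s [u [Eg D]]]]] := SL2_mx2P Gbm.
  have [h Gh Eh] : exists2 h : GL, h \in G & GLval h = Defs.mx2 u (- r) (- s) p.
    by apply: SL2_mx2_exists; rewrite -D; ring.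
  have -> : (b ^- m)%g = h.
    apply: (mulgI (b ^+ m)%g); rewrite mulgV; apply: GL_inj.
    rewrite GLmulE Eg Eh mx2M [LHS]mx2_1; congr Defs.mx2; try ring; rewrite -[LHS]D; ring.
  by rewrite Eh Eg !tr_mx2 addrC.
have irrV : irr_elt (b ^- m)%g by move=> x; rewrite trV.
have [r r_in rV] := sl2_exhaust q_pr q_odd nu_gen Gb ob GbV.
have k0 := k_gt0 q_pr q_odd.
move: r_in; rewrite /class_reps !mem_cat => /or3P[] /mapP[u u_in Er].
- by case: (@lower_not_irr q u.1 u.2); apply: irr_class irrV; rewrite class_sym -Er.
- case: (@lower_not_irr q (nu ^+ u)%g 0); apply: irr_class irrV.
  by rewrite class_sym -elt_aX -Er.
move: u_in; rewrite mem_iota add1n ltnS => uu.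
have bVE : (b ^- m = b ^+ (q.+1 * m - m))%g.
  apply: (mulgI (b ^+ m)%g); rewrite mulgV -expgD subnKC ?leq_pmull //.
  by apply/esym/eqP; rewrite expgM -ob expg_order expg1n.
rewrite Er in rV; have := rV; rewrite bVE.
move/(bX_class q_pr q_odd Gb (bX_irr_half q_pr q_odd Gb ob uu)); rewrite -bVE => -[E|E].
  have : (b ^+ (m + u) == 1)%g by rewrite expgD -E mulgV.
  rewrite -order_dvdn ob => /dvdn_leq; have := q_eq q_pr q_odd; clear -mm uu k0; lia.
by move/invg_inj: E => E; rewrite -E in rV.
Qed.

Definition inv_row (r : row_data C) : row_data C :=
  if odd k then RowData (at_1 r) (at_z r) (at_d r) (at_c r) (at_zd r) (at_zc r) (at_a r) (at_b r)
  else r.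

Lemma has_row_inv f r : has_row nu b f r -> has_row nu b (fun g => f g^-1%g) (inv_row r).
Proof.
case=> cf f1 fz fc fd fzc fzd fa fb; rewrite /inv_row.
have szV : ((sz q)^-1 = sz q)%g by apply: (mulgI (sz q)); rewrite mulgV (elt_zz q).
have uu := uN1_sqr q; have e1 : (1 * 1 = 1 :> {unit Fq})%g by rewrite mulg1.
have nzn := unit_neq0 nu.
have unipV := unip_inv q_pr q_odd nu_gen cf.
have unip2 := unip_nunu nu cf.
have nz1 : 1 != 0 :> Fq := oner_neq0 _.
have nzN1 : -1 != 0 :> Fq by rewrite oppr_eq0.
have nzNn : - val nu != 0 by rewrite oppr_eq0.
rewrite sz_low_unip in fzc; rewrite sz_low_unip in fzd.
have cc : (if odd k then f (low 1%g (val nu)) else f (low 1%g 1)) = f (low 1%g 1%R)^-1%g.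
  by rewrite unipV // mulr1.
have dd : (if odd k then f (low 1%g 1) else f (low 1%g (val nu))) = f (low 1%g (val nu))^-1%g.
  by rewrite unipV // -[X in _ = if _ then f (low _ (_ * X)) else _]mulr1 unip2.
have zcc : (if odd k then f (low uN1 (- val nu)) else f (low uN1 (- 1))) = f (low uN1 (- 1%R))^-1%g.
  by rewrite unipV // mulrN1.
have zdd : (if odd k then f (low uN1 (- 1)) else f (low uN1 (- val nu))) = f (low uN1 (- val nu))^-1%g.
  by rewrite unipV // -[in - val nu]mulrN1 unip2.
have aV l : (0 < l < k)%N -> f (low nu 0 ^- l)%g = at_a r l.
  move=> ll; rewrite -fa //; apply: (class_functionJ cf); first exact: groupX (lower_SL2 _ _).
  by rewrite elt_aX lowerV oppr0 lower_conj_inv.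
have bV m : (0 < m <= k)%N -> f (b ^- m)%g = at_b r m.
  by move=> mm; rewrite -fb //; apply: (class_functionJ cf); [exact: groupX | exact: bX_inv_class].
split; rewrite ?sz_low_unip ?szV ?invg1 -?cc -?dd -?zcc -?zdd ?f1 ?fz ?fc ?fd ?fzc ?fzd;
  try by case: (odd k).
by move=> g x Gg Gx; rewrite -conjVg cf ?groupV.
Qed.
Lemma has_rowM f (r : row_data C) f' (r' : row_data C) : has_row nu b f r -> has_row nu b f' r' ->
  has_row nu b (fun g => f g * f' g)
    (RowData (at_1 r * at_1 r') (at_z r * at_z r') (at_c r * at_c r') (at_d r * at_d r')
      (at_zc r * at_zc r') (at_zd r * at_zd r')
      (fun l => at_a r l * at_a r' l) (fun m => at_b r m * at_b r' m)).
Proof.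
move=> [cf f1 fz fc fd fzc fzd fa fb] [cf' f1' fz' fc' fd' fzc' fzd' fa' fb'].
split=> [g x Gg Gx|||||||l ll|m mm] /=.
- by rewrite cf // cf'.
- by rewrite f1 f1'.
- by rewrite fz fz'.
- by rewrite fc fc'.
- by rewrite fd fd'.
- by rewrite fzc fzc'.
- by rewrite fzd fzd'.
- by rewrite fa // fa'.
by rewrite fb // fb'.
Qed.

Lemma pairing_has_row f (r : row_data C) f' (r' : row_data C) : has_row nu b f r -> has_row nu b f' r' ->
  let s := inv_row r' in
  pairing G f f' = at_1 r * at_1 s + at_z r * at_z s +
    (at_c r * at_c s + at_d r * at_d s + (at_zc r * at_zc s + at_zd r * at_zd s)) *+ (2 * k * k.+1) +
    ((\sum_(1 <= l < k) at_a r l * at_a s l) *+ (q * q.+1) +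
     (\sum_(1 <= m < k.+1) at_b r m * at_b s m) *+ (q.-1 * q)).
Proof.
move=> fr fr' s; rewrite /pairing.
exact: (has_row_sum q_pr q_odd nu_gen Gb ob (has_rowM fr (has_row_inv fr'))).
Qed.
End InverseRows2.

(** * Characters induced from the Borel, unipotent and nonsplit subgroups *)

Section CyclicChar.
Variables (C : nzRingType) (gT : finGroupType) (x : gT).

(** The discrete logarithm to base x as a least exponent; outside the powers of x it takes the value
    [#[x]]. *)
Definition clog (h : gT) : nat := find (fun i => x ^+ i == h)%g (iota 0 #[x]).
Definition cchar (w : C) (h : gT) : C := w ^+ clog h.

Lemma clogK h : h \in <[x]>%g -> (x ^+ clog h = h)%g.
Proof.
move=> /cyclePmin[i lti Eh].
have hash : has (fun i => x ^+ i == h)%g (iota 0 #[x]).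
  by apply/hasP; exists i; rewrite ?mem_iota ?Eh.
have := nth_find 0 hash => /eqP; rewrite nth_iota //.
by move: hash; rewrite has_find size_iota.
Qed.

Variable w : C.
Hypothesis wx : w ^+ #[x]%g = 1.

Lemma ccharX l : cchar w (x ^+ l)%g = w ^+ l.
Proof.
rewrite /cchar; have /eqP := clogK (mem_cycle x l).
rewrite eq_expg_mod_order => /eqP E.
by rewrite -(expr_mod _ wx) E expr_mod.
Qed.
End CyclicChar.

Section LowerSums.
Variables (C : numFieldType) (q : nat) (nu : {unit 'F_q}) (b : GL2fin q).
Hypotheses (q_pr : prime q) (q_odd : odd q).
Hypothesis nu_gen : generator [set: {unit 'F_q}] nu.
Hypotheses (Gb : b \in SL2_group q) (ob : #[b]%g = q.+1).
Local Notation Fq := 'F_q.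
Local Notation GL := (GL2fin q).
Local Notation G := (SL2_group q).
Local Notation k := ((q - 1)./2).

Lemma ind_char_class (H : {group GL}) lam : H \subset G ->
  {in H &, {morph lam : x y / (x * y)%g >-> x * y}} -> @class_function C q (ind_char G H lam).
Proof.
move=> sHG lamM; have [n [r Er]] := ind_char_repr sHG lamM.
move=> g x Gg Gx; rewrite -!Er ?groupJ // conjgE !repr_mxM ?groupM ?groupV //.
by rewrite mxtrace_mulC -mulmxA -repr_mxM ?groupV // mulgV repr_mx1 mulmx1.
Qed.

(** Every element of the square class of y0 comes from exactly two values of p, opposite to each
    other. *)
Lemma sum_squares (F : Fq -> C) y0 : y0 != 0 ->
  \sum_(y | [exists p, (p != 0) && (y == p ^+ 2 * y0)]) F y =
  (\sum_(p | p != 0) F (p ^+ 2 * y0)) / 2.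
Proof.
move=> nzy; apply: (mulIf (_ : 2 != 0)); first by rewrite pnatr_eq0.
rewrite divfK ?pnatr_eq0 // mulr_suml.
rewrite [RHS](partition_big (fun p => p ^+ 2 * y0)
  (fun y => [exists p, (p != 0) && (y == p ^+ 2 * y0)])); last first.
  by move=> p nzp; apply/existsP; exists p; rewrite nzp eqxx.
apply: eq_bigr => y /existsP[r /andP[nzr /eqP Ey]].
rewrite (eq_bigr (fun=> F y)) => [|p /andP[_ /eqP-> //]].
rewrite sumr_const -[RHS]mulr_natr; congr (_ * _).
have ne_rN : r != - r.
  by rewrite -subr_eq0 opprK -mulr2n -mulr_natl mulf_neq0 ?two_neq0.
transitivity (#|[set r; - r]|%:R : C); first by rewrite cards2 ne_rN.
congr _%:R; apply: eq_card => p; rewrite !inE unfold_in Ey.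
rewrite (inj_eq (mulIf nzy)) eqf_sqr; case: (eqVneq p 0) => // ->.
by rewrite eq_sym (negbTE nzr) eq_sym oppr_eq0 (negbTE nzr).
Qed.

Lemma low_class_unip e y0 (x : {unit Fq}) y : (e * e = 1)%g -> y0 != 0 ->
  (low x y \in low e y0 ^: G) = (x == e) && [exists p, (p != 0) && (y == p ^+ 2 * y0)].
Proof.
move=> ee nzy; apply/idP/andP => [cl|[/eqP-> /existsP[p /andP[nzp /eqP Ey]]]]; last first.
  by apply/(lower_conj_sqr _ ee nzy); exists p.
have xe : x = e.
  have := class_trace cl; rewrite !GLval_lower !tr_mx2 => /esym/unit_sum_inv[//|->].
  by apply/eqP; rewrite eq_sym eq_mulgV1 invgK ee.
rewrite xe in cl *; have [p nzp Ep] := lower_conj_sqr _ ee nzy cl.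
by rewrite eqxx; split=> //; apply/existsP; exists p; rewrite nzp Ep eqxx.
Qed.

Lemma low_class_central e (x : {unit Fq}) y : (e * e = 1)%g ->
  (low x y \in low e 0 ^: G) = (x == e) && (y == 0).
Proof.
move=> ee; rewrite (central_class (g := low e 0)) ?inE; last first.
  move=> h _; case: (unit_sqr1 ee) => ->; first by rewrite lower1 mul1g mulg1.
  exact: elt_z_central.
by apply/eqP/andP => [/lower_inj[-> ->]|[/eqP-> /eqP->]]; rewrite ?eqxx.
Qed.

Lemma low_class_a l (x : {unit Fq}) y : (0 < l < k)%N ->
  (low x y \in (low nu 0 ^+ l)%g ^: G) = (x == nu ^+ l)%g || (x == nu ^- l)%g.
Proof.
move=> ll; have nz := nuX_neqV q_pr q_odd nu_gen ll; rewrite elt_aX.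
apply/idP/orP => [/class_trace|].
  by rewrite !GLval_lower !tr_mx2 => /esym/unit_sum_inv[->|->]; [left | right].
case=> /eqP ->; first exact: lower_conj_diag.
apply: class_trans (lower_conj_inv _); apply: lower_conj_diag.
by rewrite unitVE invrK eq_sym.
Qed.

Lemma low_class_b m (x : {unit Fq}) y : (0 < m <= k)%N ->
  (low x y \in (b ^+ m)%g ^: G) = false.
Proof.
move=> mm; apply/negP => cl; apply: (@lower_not_irr q x y).
exact: irr_class cl (bX_irr_half q_pr q_odd Gb ob mm).
Qed.
End LowerSums.

Section InducedRows.
Variables (C : numFieldType) (q : nat) (nu : {unit 'F_q}) (b : GL2fin q).
Hypotheses (q_pr : prime q) (q_odd : odd q).
Hypothesis nu_gen : generator [set: {unit 'F_q}] nu.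
Hypotheses (Gb : b \in SL2_group q) (ob : #[b]%g = q.+1).
Local Notation Fq := 'F_q.
Local Notation GL := (GL2fin q).
Local Notation G := (SL2_group q).
Local Notation k := ((q - 1)./2).
Local Notation Q := (q%:R : C).
Local Notation K := (k%:R : C).

Lemma Q_eq : Q = 2 * K + 1.
Proof. by rewrite {1}(q_eq q_pr q_odd) -addn1 natrD -muln2 natrM mulrC. Qed.

Lemma K_neq0 : K != 0.
Proof. by rewrite pnatr_eq0 -lt0n k_gt0. Qed.

Lemma Q_neq0 : Q != 0.
Proof. by rewrite pnatr_eq0 -lt0n prime_gt0. Qed.

Lemma Q1_neq0 : Q + 1 != 0.
Proof. by rewrite natr1 pnatr_eq0. Qed.

Lemma q_pred : q.-1 = k.*2.
Proof. by rewrite {1}(q_eq q_pr q_odd). Qed.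

Lemma pred_qR : (q.-1%:R : C) = 2 * K.
Proof. by rewrite q_pred -muln2 natrM mulrC. Qed.

Lemma card_SL2R : #|G|%:R = 2 * K * Q * (Q + 1).
Proof. by rewrite card_SL2 // !natrM pred_qR natr1. Qed.

Lemma cent_central (e : {unit Fq}) : (e * e = 1)%g -> #|'C_G[low e 0]| = #|G|.
Proof.
move=> ee; congr #|pred_of_set _|; apply/setIidPl/subsetP => h _; apply/cent1P.
case: (unit_sqr1 ee) => ->; first by rewrite lower1; rewrite /commute mulg1 mul1g.
by apply/esym; apply: elt_z_central.
Qed.

Definition borel_set : {set GL} := [set low u.1 u.2 | u in [set: {unit Fq} * Fq]].

Lemma mem_borel x y : low x y \in borel_set.
Proof. by apply/imsetP; exists (x, y). Qed.

Lemma borel_group_set : group_set borel_set.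
Proof.
apply/group_setP; split; first by rewrite -lower1 mem_borel.
by move=> _ _ /imsetP[u _ ->] /imsetP[v _ ->]; rewrite lowerM mem_borel.
Qed.
Canonical borel_group := group borel_group_set.
Local Notation B := borel_group.

Lemma borel_sub : B \subset G.
Proof. by apply/subsetP => _ /imsetP[u _ ->]; apply: lower_SL2. Qed.

Lemma low_pair_inj : injective (fun u : {unit Fq} * Fq => low u.1 u.2).
Proof. by move=> [x y] [x' y'] /= /lower_inj[-> ->]. Qed.

Lemma card_borel : #|B|%:R = 2 * K * Q.
Proof.
rewrite card_imset ?cardsT ?card_prod; last exact: low_pair_inj.
by rewrite -cardsT card_units // card_Fp // natrM pred_qR.
Qed.

(** On lower triangular matrices of determinant 1 this is the first diagonal entry as a unit; the
    default 1 covers a noninvertible entry. *)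
Definition unit_entry (h : GL) : {unit Fq} := insubd (1%g : {unit Fq}) (GLval h 0 0).

Lemma unit_entry_low x y : unit_entry (low x y) = x.
Proof. by rewrite /unit_entry GLval_lower mxE /= valKd. Qed.

Lemma sum_fst_eq e (P : pred Fq) (F : {unit Fq} * Fq -> C) :
  \sum_(u | (u.1 == e) && P u.2) F u = \sum_(y | P y) F (e, y).
Proof.
transitivity (\sum_(u : {unit Fq} * Fq | (u.1 == e) && P u.2) F (u.1, u.2)).
  by apply: eq_bigr => -[].
by rewrite -(pair_big (pred1 e) P (fun x y => F (x, y))) /= big_pred1_eq.
Qed.

Section Borel.
Variable w : C.
Hypothesis wk : w ^+ k.*2 = 1.

Let wnu : w ^+ #[nu]%g = 1.
Proof. by rewrite (order_nu q_pr q_odd nu_gen). Qed.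

Let nz_w : w != 0.
Proof. by apply: contra_eq_neq wk => ->; rewrite expr0n double_eq0 eqn0Ngt k_gt0 // eq_sym oner_neq0. Qed.

Definition borel_lin (h : GL) : C := cchar nu w (unit_entry h).

Lemma borel_linE x y l : x = (nu ^+ l)%g -> borel_lin (low x y) = w ^+ l.
Proof. by move=> ->; rewrite /borel_lin unit_entry_low ccharX. Qed.

Lemma borel_linM : {in B &, {morph borel_lin : x y / (x * y)%g >-> x * y}}.
Proof.
move=> _ _ /imsetP[[x y] _ ->] /imsetP[[x' y'] _ ->] /=; rewrite lowerM.
have [i _ Ei] := nu_log q_pr q_odd nu_gen x.
have [j _ Ej] := nu_log q_pr q_odd nu_gen x'.
rewrite (borel_linE _ Ei) (borel_linE _ Ej) -exprD; apply: borel_linE.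
by rewrite Ei Ej expgD.
Qed.

Definition principal_series := ind_char G B borel_lin.

Lemma principal_seriesE g : g \in G -> principal_series g =
  #|'C_G[g]|%:R / #|B|%:R *
  \sum_(u : {unit Fq} * Fq | low u.1 u.2 \in g ^: G) borel_lin (low u.1 u.2).
Proof.
move=> Gg; rewrite /principal_series ind_charE //; congr (_ * _).
rewrite big_mkcondr /= big_imset /=; last by move=> u v _ _; apply: low_pair_inj.
by rewrite [RHS]big_mkcond; apply: eq_bigl => u; rewrite inE.
Qed.

Let uu := uN1_sqr q.
Let e1 : (1 * 1 = 1 :> {unit Fq})%g := mulg1 _.

Let unip_val e y0 l : e = (nu ^+ l)%g -> (e * e = 1)%g -> y0 != 0 ->
  principal_series (low e y0) = w ^+ l.
Proof.
move=> El ee nzy; rewrite principal_seriesE ?lower_SL2 // card_cent_lower_unip //.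
pose P y := [exists p, (p != 0) && (y == p ^+ 2 * y0)].
rewrite (_ : \sum_(_ | _) _ = \sum_(y | P y) w ^+ l); last first.
  transitivity (\sum_(u | (u.1 == e) && P u.2) borel_lin (low u.1 u.2)).
    by apply: eq_bigl => u; rewrite low_class_unip.
  by rewrite sum_fst_eq; apply: eq_bigr => y _; apply: borel_linE.
rewrite sum_squares //.
have -> : \sum_(p : Fq | p != 0) w ^+ l = 2 * K * w ^+ l.
  rewrite sumr_const -[LHS]mulr_natl -pred_qR; congr (_%:R * _).
  by have := cardC1 (0 : Fq); rewrite card_Fp // => <-; apply: eq_card => p.
by rewrite card_borel natrM; field; rewrite Q_neq0 K_neq0.
Qed.

Let central_val e l : e = (nu ^+ l)%g -> (e * e = 1)%g ->
  principal_series (low e 0) = (Q + 1) * w ^+ l.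
Proof.
move=> El ee; rewrite principal_seriesE ?lower_SL2 // cent_central //.
rewrite (_ : \sum_(_ | _) _ = w ^+ l); last first.
  transitivity (\sum_(u | (u.1 == e) && pred1 0 u.2) borel_lin (low u.1 u.2)).
    by apply: eq_bigl => u; rewrite low_class_central.
  by rewrite sum_fst_eq big_pred1_eq; apply: borel_linE.
by rewrite card_borel card_SL2R; field; rewrite Q_neq0 K_neq0.
Qed.

(** Each value sums the linear character over the part of a class inside the Borel subgroup: one
    square class of lower left entries for c or d, two full cosets of the unipotent group for a
    power of a, nothing for a power of b. *)
Lemma principal_series_row : has_row nu b principal_series
  (RowData (Q + 1) ((Q + 1) * w ^+ k) 1 1 (w ^+ k) (w ^+ k)
     (fun l => w ^+ l + w ^- l) (fun=> 0)).
Proof.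
have nuk := esym (nuX_k q_pr q_odd nu_gen).
have nu0 : 1%g = (nu ^+ 0)%g by rewrite expg0.
split=> /=; rewrite ?sz_low_unip.
- exact: ind_char_class borel_sub borel_linM.
- by rewrite -lower1 (central_val nu0 e1) expr0 mulr1.
- exact: central_val nuk uu.
- by rewrite (unip_val nu0 e1 (oner_neq0 _)).
- by rewrite (unip_val nu0 e1 (unit_neq0 _)).
- by rewrite (unip_val nuk uu) // oppr_eq0 oner_eq0.
- by rewrite (unip_val nuk uu) // oppr_eq0 unit_neq0.
- move=> l ll; rewrite principal_seriesE ?groupX ?lower_SL2 // elt_aX.
  rewrite card_cent_lower_diag ?(nuX_neqV q_pr q_odd nu_gen) // -elt_aX.
  have ne : (nu ^+ l != nu ^- l)%g by rewrite -(inj_eq val_inj) (nuX_neqV q_pr q_odd nu_gen).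
  have ltl : (l <= k.*2)%N by rewrite -addnn ltnW // ltn_addr; case/andP: ll.
  have nuV : (nu ^- l = nu ^+ (k.*2 - l))%g.
    apply: (mulgI (nu ^+ l)%g); rewrite mulgV -expgD subnKC //.
    by apply/esym/eqP; rewrite (nuX_eq1 q_pr q_odd nu_gen).
  have wV : w ^+ (k.*2 - l) = w ^- l.
    by apply: (mulIf (expf_neq0 l nz_w)); rewrite -exprD subnK // wk mulVf ?expf_neq0.
  transitivity (#|[set: {unit Fq}]|%:R / #|B|%:R * (Q * w ^+ l + Q * w ^- l)).
    rewrite card_units //; congr (_ * _).
    rewrite (bigID (fun u => u.1 == (nu ^+ l)%g)) /=; congr (_ + _).
      transitivity (\sum_(u | (u.1 == (nu ^+ l)%g) && predT u.2) borel_lin (low u.1 u.2)).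
        apply: eq_bigl => u; rewrite (low_class_a q_pr q_odd nu_gen) // andbT.
        by case: eqP => //= _; rewrite andbF.
      rewrite sum_fst_eq (eq_bigr (fun=> w ^+ l)) => [|y _]; last exact: borel_linE.
      by rewrite sumr_const card_Fp // mulr_natl.
    transitivity (\sum_(u | (u.1 == (nu ^- l)%g) && predT u.2) borel_lin (low u.1 u.2)).
      apply: eq_bigl => u; rewrite (low_class_a q_pr q_odd nu_gen) // andbT.
      by case: (eqVneq u.1 (nu ^- l)%g) => [->|_]; rewrite ?orbT ?orbF ?andbN // eq_sym ne.
    rewrite sum_fst_eq (eq_bigr (fun=> w ^- l)) => [|y _]; last first.
      by rewrite -wV; apply: borel_linE.
    by rewrite sumr_const card_Fp // mulr_natl.
  rewrite card_units // pred_qR card_borel; field.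
  by rewrite expf_neq0 // Q_neq0 K_neq0.
move=> m mm; rewrite principal_seriesE ?groupX // big_pred0 ?mulr0 // => u.
exact: low_class_b mm.
Qed.
End Borel.
End InducedRows.

(** * Induction from the centre times the unipotent group and from the nonsplit torus *)

Section InducedRows2.
Variables (C : numFieldType) (q : nat) (nu : {unit 'F_q}) (b : GL2fin q).
Hypotheses (q_pr : prime q) (q_odd : odd q).
Hypothesis nu_gen : generator [set: {unit 'F_q}] nu.
Hypotheses (Gb : b \in SL2_group q) (ob : #[b]%g = q.+1).
Local Notation Fq := 'F_q.
Local Notation GL := (GL2fin q).
Local Notation G := (SL2_group q).
Local Notation uN1 := (FinRing.unit Fq (unitN1 q)).
Local Notation k := ((q - 1)./2).
Local Notation Q := (q%:R : C).
Local Notation K := (k%:R : C).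
Let Q_eq := Q_eq C q_pr q_odd.
Let K_neq0 := K_neq0 C q_pr q_odd.
Let Q_neq0 := Q_neq0 C q_pr.

Let uu := uN1_sqr q.
Let e1 : (1 * 1 = 1 :> {unit Fq})%g := mulg1 _.
Let neN1 : ((1%g : {unit Fq}) == uN1) = false.
Proof. by rewrite -(inj_eq val_inj) /= -subr_eq0 opprK (negbTE (two_neq0 q_pr q_odd)). Qed.

Section Whittaker.
Variables (s : C) (psi : Fq -> C).
Hypotheses (ss : s * s = 1) (psiD : {morph psi : x y / x + y >-> x * y}) (psi0 : psi 0 = 1).

(** For nonzero y this is the sum of psi over the square class of y; twice it plus [psi 0 = 1] is a
    quadratic Gauss sum. *)
Definition gauss_half (y : Fq) : C := (\sum_(p : Fq | p != 0) psi (p ^+ 2 * y)) / 2.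

Local Notation ZU := 'C_G[low 1%g 1%R : GL]%G.
Local Notation sgn e := (if e == 1%g then 1 else s).

(** When e is 1 or -1, [low e y] is e times the unipotent matrix with lower left entry [e * y],
    which is the product of the two entries in the first column. *)
Definition unip_lin (h : GL) : C :=
  sgn (unit_entry h) * psi (GLval h 0 0 * GLval h 1 0).

Lemma unip_linE e y : unip_lin (low e y) = sgn e * psi (val e * y).
Proof. by rewrite /unip_lin unit_entry_low GLval_lower !mxE. Qed.

Let ZU_eq : ZU :=: [set low u.1 u.2 | u in setX [set u : {unit Fq} | (u * u == 1)%g] [set: Fq]].
Proof. by rewrite /= cent_lower_unip ?oner_neq0. Qed.

Lemma unip_linM : {in ZU &, {morph unip_lin : x y / (x * y)%g >-> x * y}}.
Proof.
move=> g h; rewrite ZU_eq => /imsetP[[e y] /setXP[]]; rewrite inE /= => /eqP ee _ ->.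
move=> /imsetP[[e' y'] /setXP[]]; rewrite inE /= => /eqP ee' _ ->.
rewrite lowerM !unip_linE mulrACA -psiD unitV_sqr //.
have -> : val (e * e')%g * (y * val e' + val e * y') = val e * y + val e' * y'.
  have E := unit_sqr_val ee; have E' := unit_sqr_val ee'.
  transitivity (val e * y * (val e' * val e') + val e' * y' * (val e * val e)).
    by rewrite /=; ring.
  by rewrite E E' !mulr1.
congr (_ * _).
case: (unit_sqr1 ee) => ->; rewrite ?mul1g ?eqxx ?mul1r //.
by case: (unit_sqr1 ee') => ->; rewrite ?mulg1 ?uu ?eqxx ![uN1 == _]eq_sym ?neN1 ?mulr1.
Qed.

(** For nontrivial psi this is the part of a Gelfand-Graev character on which the centre acts
    through s. Writing the inducing subgroup as the centralizer of c supplies its group structure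
    and its order. *)
Definition whittaker := ind_char G ZU unip_lin.

Lemma whittakerE g : g \in G -> whittaker g =
  #|'C_G[g]|%:R / (2 * Q) *
  \sum_(u : {unit Fq} * Fq | (u.1 * u.1 == 1)%g && (low u.1 u.2 \in g ^: G)) unip_lin (low u.1 u.2).
Proof.
move=> Gg; rewrite /whittaker ind_charE // card_cent_lower_unip ?oner_neq0 // natrM.
congr (_ * _); rewrite ZU_eq big_mkcondr /= big_imset /=; last by move=> u v _ _; apply: low_pair_inj.
rewrite [RHS]big_mkcondr; apply: eq_bigl => u.
by rewrite !inE andbT.
Qed.

Let unip_val e y0 : (e * e = 1)%g -> y0 != 0 ->
  whittaker (low e y0) = sgn e * gauss_half (val e * y0).
Proof.
move=> ee nzy; rewrite whittakerE ?lower_SL2 // card_cent_lower_unip //.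
pose P y := [exists p, (p != 0) && (y == p ^+ 2 * y0)].
rewrite (_ : \sum_(_ | _) _ = \sum_(y | P y) unip_lin (low e y)); last first.
  transitivity (\sum_(u | (u.1 == e) && P u.2) unip_lin (low u.1 u.2)).
    apply: eq_bigl => u; rewrite low_class_unip //.
    by case: (eqVneq u.1 e) => [->|]; rewrite ?andbF // ee eqxx.
  by rewrite sum_fst_eq.
rewrite sum_squares // /gauss_half mulrA mulr_sumr natrM divff ?mulf_neq0 ?pnatr_eq0 //.
  rewrite mul1r; congr (_ / _); apply: eq_bigr => p _.
  by rewrite unip_linE mulrCA.
by rewrite -(pnatr_eq0 C) Q_neq0.
Qed.

Let central_val e : (e * e = 1)%g -> whittaker (low e 0) = sgn e * (2 * K * (K + 1)).
Proof.
move=> ee; rewrite whittakerE ?lower_SL2 // cent_central //.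
rewrite (_ : \sum_(_ | _) _ = sgn e); last first.
  transitivity (\sum_(u | (u.1 == e) && pred1 0 u.2) unip_lin (low u.1 u.2)).
    apply: eq_bigl => u; rewrite low_class_central //.
    by case: (eqVneq u.1 e) => [->|]; rewrite ?andbF // ee eqxx.
  by rewrite sum_fst_eq big_pred1_eq unip_linE mulr0 psi0 mulr1.
rewrite card_SL2R // mulrC; congr (_ * _).
have nzK := K_neq0; have nzQ := Q_neq0.
have -> : Q + 1 = 2 * (K + 1) by rewrite Q_eq; ring.
by field.
Qed.

Lemma whittaker_row : has_row nu b whittaker
  (RowData (2 * K * (K + 1)) (s * (2 * K * (K + 1))) (gauss_half 1) (gauss_half (val nu))
     (s * gauss_half 1) (s * gauss_half (val nu)) (fun=> 0) (fun=> 0)).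
Proof.
have sgn1 : sgn (1%g : {unit Fq}) = 1 by rewrite eqxx.
have sgnN : sgn uN1 = s by rewrite eq_sym neN1.
split=> /=; rewrite ?sz_low_unip.
- by apply: ind_char_class unip_linM; apply: subsetIl.
- by rewrite -lower1 central_val // sgn1 mul1r.
- by rewrite (central_val uu) sgnN.
- by rewrite unip_val ?oner_neq0 // sgn1 mul1r mulr1.
- by rewrite unip_val ?unit_neq0 // sgn1 !mul1r.
- by rewrite (unip_val uu) ?oppr_eq0 ?oner_eq0 // sgnN /= mulrNN mulr1.
- by rewrite (unip_val uu) ?oppr_eq0 ?unit_neq0 // sgnN /= mulrNN mul1r.
- move=> l ll; rewrite whittakerE ?groupX ?lower_SL2 // big_pred0 ?mulr0 // => u.
  rewrite (low_class_a q_pr q_odd nu_gen) //; apply/negP => /andP[/eqP xx].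
  have := nuX_neqV q_pr q_odd nu_gen ll; rewrite -unitVE (inj_eq val_inj).
  have {}xx : (u.1 == u.1^-1)%g by rewrite eq_mulgV1 invgK xx.
  move=> ne /orP[] /eqP E; case/negP: ne; first by rewrite -E.
  have -> : (nu ^+ l)%g = (u.1^-1)%g by rewrite E invgK.
  by rewrite invgK eq_sym.
move=> m mm; rewrite whittakerE ?groupX // big_pred0 ?mulr0 // => u.
by rewrite (low_class_b q_pr q_odd Gb ob) ?andbF.
Qed.
End Whittaker.

Section Torus.
Variable v : C.
Hypothesis vb : v ^+ q.+1 = 1.

Let k_gt0 := k_gt0 q_pr q_odd.
Let vob : v ^+ #[b]%g = 1.
Proof. by rewrite ob. Qed.

Let nz_v : v != 0.
Proof. by apply: contra_eq_neq vb => ->; rewrite expr0n eq_sym oner_neq0. Qed.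

Let b1 : (b ^+ q.+1 = 1)%g.
Proof. by have := expg_order b; rewrite ob. Qed.

Let q1_eq : q.+1 = (k.+1 + k.+1)%N.
Proof. by have := q_eq q_pr q_odd; clear; lia. Qed.

(** The inverse of g is its adjugate; equality with g leaves only scalar matrices of square 1. *)
Lemma sqr1_SL2 (g : GL) : g \in G -> (g * g = 1)%g -> g = 1%g \/ g = sz q.
Proof.
move=> Gg gg; have [p [r [s [u [Eg D]]]]] := SL2_mx2P Gg.
have [h Gh Eh] : exists2 h : GL, h \in G & GLval h = Defs.mx2 u (- r) (- s) p.
  by apply: SL2_mx2_exists; rewrite -D; ring.
have gh : (g * h = 1)%g.
  apply: GL_inj; rewrite GLmulE Eg Eh mx2M [RHS]mx2_1; congr Defs.mx2; try ring;
  by rewrite -[RHS]D; ring.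
have : h = g by apply: (mulgI g); rewrite gh gg.
move/(congr1 (@GLval 2 _)); rewrite Eh Eg => /mx2_inj[Eu Er Es _].
have self0 (x : Fq) : - x = x -> x = 0.
  move=> E; apply: (mulfI (two_neq0 q_pr q_odd)); rewrite mulr0 mulr_natl mulr2n.
  by rewrite -{1}E addNr.
have r0 := self0 _ Er; have s0 := self0 _ Es.
move: D Eg; rewrite r0 s0 Eu mul0r subr0 => /eqP; rewrite -expr2 sqrf_eq1 => /orP[] /eqP -> Eg.
  by left; apply: GL_inj; rewrite Eg -mx2_1.
right; apply: GL_inj; rewrite Eg elt_zE [RHS]mx2E !mxE /=.
by rewrite mulr1n mulr0n.
Qed.

Lemma bX_half : (b ^+ k.+1 = sz q)%g.
Proof.
have : (b ^+ k.+1 = 1)%g \/ (b ^+ k.+1 = sz q)%g.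
  by apply: sqr1_SL2; rewrite ?groupX // -expgD -q1_eq.
case=> // /eqP.
rewrite -order_dvdn ob => /dvdn_leq; rewrite q1_eq; clear; lia.
Qed.

Lemma bX_cases n : [\/ (b ^+ n = 1)%g, (b ^+ n = sz q)%g | irr_elt (b ^+ n)%g].
Proof.
case: (boolP (q.+1 %| n.*2)%N) => [dv|ndv]; last first.
  by apply: Or33; apply: bX_irr.
have nn1 : (b ^+ n * b ^+ n = 1)%g.
  by rewrite -expgD addnn; apply/eqP; rewrite -order_dvdn ob.
by case: (sqr1_SL2 (groupX n Gb) nn1) => E; [apply: Or31 | apply: Or32].
Qed.

Definition torus_ind := ind_char G <[b]>%G (cchar b v).

Lemma torus_linM : {in <[b]>%g &, {morph cchar b v : x y / (x * y)%g >-> x * y}}.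
Proof.
by move=> _ _ /cycleP[i ->] /cycleP[j ->]; rewrite -expgD !ccharX // exprD.
Qed.

Let torus_val0 g : g \in G -> (forall n, (b ^+ n)%g \notin g ^: G) -> torus_ind g = 0.
Proof.
move=> Gg notg; rewrite /torus_ind ind_charE // big_pred0 ?mulr0 // => h.
by apply/negP => /andP[/cycleP[n ->]]; rewrite (negbTE (notg n)).
Qed.

Let unip_val e y : (e * e = 1)%g -> y != 0 -> torus_ind (low e y) = 0.
Proof.
move=> ee nzy; apply: torus_val0; first exact: lower_SL2.
move=> n; apply/negP => cl.
have lowE e' : (b ^+ n)%g = low e' 0 -> False.
  move=> E; move: cl; rewrite E low_class_unip // => /andP[_ /existsP[p /andP[nzp]]].
  by rewrite eq_sym mulf_eq0 expf_eq0 (negbTE nzp) (negbTE nzy).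
case: (bX_cases n) => [E|E|irrb]; first by apply: (lowE 1%g); rewrite lower1.
  exact: (lowE uN1).
by apply: (@lower_not_irr q e y); apply: irr_class irrb; rewrite class_sym.
Qed.

Let torus_central e l : (e * e = 1)%g -> (b ^+ l)%g = low e 0 ->
  torus_ind (low e 0) = Q * (2 * K) * v ^+ l.
Proof.
move=> ee El; rewrite /torus_ind ind_charE ?lower_SL2 // cent_central //.
rewrite -[#|<[b]>%g|]/(#[b]%g) ob (big_pred1 (low e 0)) => [|h]; last first.
  apply/andP/eqP => [[_ cl]|->].
    have cent (h' : GL) : h' \in G -> (low e 0 * h' = h' * low e 0)%g.
      move=> _; case: (unit_sqr1 ee) => ->; last exact: elt_z_central.
      by rewrite lower1 mul1g mulg1.
    by move: cl; rewrite (central_class cent) inE => /eqP.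
  by rewrite class_refl -El mem_cycle.
rewrite -El ccharX // card_SL2R // -natr1.
by field; rewrite addrC Q1_neq0.
Qed.

Lemma torus_row : has_row nu b torus_ind
  (RowData (Q * (2 * K)) (Q * (2 * K) * v ^+ k.+1) 0 0 0 0 (fun=> 0)
     (fun m => v ^+ m + v ^- m)).
Proof.
split=> /=; rewrite ?sz_low_unip.
- by apply: ind_char_class torus_linM; rewrite cycle_subG.
- by rewrite -lower1 (torus_central (l := 0)) ?expr0 ?mulr1 // lower1 expg0.
- by apply: torus_central => //; apply: bX_half.
- by rewrite unip_val ?oner_neq0.
- by rewrite unip_val ?unit_neq0.
- by rewrite unip_val // oppr_eq0 oner_eq0.
- by rewrite unip_val // oppr_eq0 unit_neq0.
- move=> l ll; apply: torus_val0 => [|n]; first by rewrite groupX ?lower_SL2.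
  apply/negP; rewrite elt_aX => cl; have nz := nuX_neqV q_pr q_odd nu_gen ll.
  have lowE e' : (e' * e' = 1)%g -> (b ^+ n)%g = low e' 0 -> False.
    move=> ee E; have := lower_trace_sqr 0 nz; rewrite -(class_trace cl) E.
    rewrite (@unip_trace_sqr _ nu (e', 0)) ?eqxx //.
    by case: (unit_sqr1 ee) => ->; rewrite !inE eqxx ?orbT.
  case: (bX_cases n) => [E|E|irrb]; first by apply: (lowE 1%g); rewrite ?lower1.
    exact: (lowE uN1).
  by apply: (@lower_not_irr q (nu ^+ l)%g 0); apply: irr_class irrb; rewrite class_sym.
move=> m mm; have irrb := bX_irr_half q_pr q_odd Gb ob mm.
rewrite /torus_ind ind_charE ?groupX // cent_bX // -[#|<[b]>%g|]/(#[b]%g) ob.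
rewrite divff ?mul1r ?pnatr_eq0 //.
have ne : (b ^+ m != b ^- m)%g.
  apply/eqP => E; have : (b ^+ (m + m) == 1)%g by rewrite expgD {2}E mulgV.
  apply/negP; rewrite -order_dvdn ob; case/andP: mm => m0 lem.
  by rewrite gtnNdvd ?addn_gt0 ?m0 // q1_eq; clear -lem; lia.
have lem : (m <= q.+1)%N by case/andP: mm; have := q1_eq; clear; lia.
have bV : (b ^- m = b ^+ (q.+1 - m))%g.
  by apply: (mulgI (b ^+ m)%g); rewrite mulgV -expgD subnKC // b1.
have vV : v ^+ (q.+1 - m) = v ^- m.
  by apply: (mulIf (expf_neq0 m nz_v)); rewrite -exprD subnK // vb mulVf ?expf_neq0.
(* The class of [b ^+ m] meets the cyclic group in exactly two elements, [b ^+ m] and its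
   inverse. *)
rewrite (bigD1 (b ^+ m)%g) ?mem_cycle ?class_refl //= ccharX //; congr (_ + _).
rewrite (big_pred1 (b ^- m)%g) => [|h]; first by rewrite bV ccharX.
apply/andP/eqP => [[/andP[/cycleP[n ->]]]|->].
  by move=> /(bX_class q_pr q_odd Gb irrb)[->|-> //]; rewrite eqxx.
rewrite (bX_inv_class q_pr q_odd nu_gen Gb ob mm) andbT eq_sym ne; split=> //.
by rewrite groupV mem_cycle.
Qed.
End Torus.
End InducedRows2.

(** * Trigonometric and Gauss sums *)

Section HalfSums.
Variable C : numFieldType.

(** The full geometric sum over a range of length 2h vanishes; pairing i with 2h - i leaves the
    terms at 0 and at h. *)
Lemma half_range_sum (z : C) h : (0 < h)%N -> z ^+ h.*2 = 1 -> z != 1 ->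
  \sum_(1 <= i < h) (z ^+ i + z ^- i) = - 1 - z ^+ h.
Proof.
move=> h_gt0 zh nz1.
have nzz : z != 0.
  by apply: contra_eq_neq zh => ->; rewrite expr0n double_eq0 eqn0Ngt h_gt0 eq_sym oner_neq0.
have sum0 : \sum_(0 <= i < h.*2) z ^+ i = 0.
  apply: (mulfI (_ : z - 1 != 0)); first by rewrite subr_eq0.
  by rewrite mulr0 big_mkord -subrX1 zh subrr.
have lt_hh : (h < h + h)%N by rewrite -{1}[h]addn0 ltn_add2l.
have := sum0; rewrite -addnn (big_cat_nat (leq0n h) (leq_addr h h)) /=.
rewrite (big_ltn h_gt0) expr0 (big_ltn lt_hh).
have -> : \sum_(h.+1 <= i < h + h) z ^+ i = \sum_(1 <= i < h) z ^- i.
  rewrite -{1}[h.+1]addn1 addnC big_addn addnK big_nat_rev /= big_nat [RHS]big_nat.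
  apply: eq_bigr => i /andP[i1 ih]; apply: (mulIf (expf_neq0 i nzz)).
  rewrite mulVf ?expf_neq0 // -exprD -zh; congr (z ^+ _).
  by rewrite -addnn; clear -i1 ih; lia.
rewrite big_split /=; set A := \sum_(1 <= i < h) _; set D := \sum_(1 <= i < h) _ => E.
by transitivity (1 + A + (z ^+ h + D) - 1 - z ^+ h); [ring | rewrite E; ring].
Qed.

Lemma sum_sign h : (0 < h)%N -> \sum_(1 <= l < h) (-1) ^+ l = (-1 - (-1) ^+ h) / 2 :> C.
Proof.
move=> h_gt0; apply: (mulfI (_ : 2 != 0 :> C)); first by rewrite pnatr_eq0.
rewrite mulr_sumr mulrC divfK ?pnatr_eq0 //.
transitivity (\sum_(1 <= l < h) ((-1) ^+ l + (-1) ^- l) : C).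
  by apply: eq_bigr => l _; rewrite -[(-1) ^- l]exprVn invrN invr1; ring.
rewrite half_range_sum //; first by rewrite -signr_odd odd_double.
by rewrite eq_sym -subr_eq0 opprK -mulr2n pnatr_eq0.
Qed.

(** The indicator of the parity p is [(1 + (-1) ^+ p * (-1) ^+ i) / 2]. *)
Lemma sum_parity (p : bool) (m n : nat) (x : nat -> C) :
  \sum_(m <= i < n | odd i == p) x i =
  (\sum_(m <= i < n) x i + (-1) ^+ p * \sum_(m <= i < n) (-1) ^+ i * x i) / 2.
Proof.
rewrite mulr_sumr -big_split mulr_suml big_mkcond; apply: eq_bigr => i _ /=.
by rewrite -[(-1) ^+ i]signr_odd; case: (odd i); case: p; rewrite /= ?expr0 ?expr1; field.
Qed.

(** The parity indicator splits the sum into the half-range sums of z and of -z; the condition on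
    the square of z keeps both away from 1. *)
Lemma half_range_parity (p : bool) (z : C) h : (0 < h)%N -> z ^+ h.*2 = 1 -> z ^+ 2 != 1 ->
  \sum_(1 <= i < h | odd i == p) (z ^+ i + z ^- i) =
  - (1 + (-1) ^+ p) / 2 - (1 + (-1) ^+ p * (-1) ^+ h) / 2 * z ^+ h.
Proof.
move=> h_gt0 zh; rewrite sqrf_eq1 negb_or => /andP[nz1 nzN1].
rewrite sum_parity half_range_sum //.
have zNh : (- z) ^+ h.*2 = 1 by rewrite exprNn -signr_odd odd_double mul1r zh.
have zN1 : - z != 1 by rewrite eqr_oppLR.
have -> : \sum_(1 <= i < h) (-1) ^+ i * (z ^+ i + z ^- i) = - 1 - (- z) ^+ h.
  rewrite -(half_range_sum h_gt0 zNh zN1); apply: eq_bigr => i _.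
  rewrite mulrDr [(- z) ^+ i]exprNn; congr (_ + _).
  by rewrite invfM -[((-1) ^+ i)^-1]exprVn invrN1.
by rewrite [(- z) ^+ h]exprNn; field.
Qed.

Lemma half_range_count (p : bool) h : (0 < h)%N ->
  \sum_(1 <= i < h | odd i == p) (1 : C) =
  (h%:R - (1 + (-1) ^+ p) / 2 - (1 + (-1) ^+ p * (-1) ^+ h) / 2) / 2.
Proof.
move=> h_gt0; rewrite sum_parity.
have -> : \sum_(1 <= i < h) (1 : C) = h%:R - 1 by rewrite sumr_const_nat natrB.
have -> : \sum_(1 <= i < h) (-1) ^+ i * (1 : C) = (- 1 - (-1) ^+ h) / 2.
  by rewrite -(sum_sign h_gt0); apply: eq_bigr => i _; rewrite mulr1.
by field.
Qed.
End HalfSums.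

Section Zeta.
Variable R : realType.

Lemma zetaX r s : zeta R r ^+ s = (cos (s%:R * (2 * pi / r%:R)) +i* sin (s%:R * (2 * pi / r%:R)))%C.
Proof.
elim: s => [|s IHs]; first by rewrite expr0 mul0r cos0 sin0.
rewrite exprS IHs /zeta; set th := 2 * pi / r%:R.
rewrite -[s.+1%:R]natr1 (mulrDl s%:R) mul1r cosD sinD.
by apply/eqP; rewrite eq_complex /=; apply/andP; split; apply/eqP; ring.
Qed.

(** If [zeta R r ^+ s] were 1, then [cos (2x) = 1] and [sin x = 0] for [x = s * pi / r], which lies
    strictly between 0 and pi when [0 < s < r]. *)
Lemma zeta_prim r : (0 < r)%N -> r.-primitive_root (zeta R r).
Proof.
move=> r_gt0; have nzr : (r%:R : R) != 0 by rewrite pnatr_eq0 -lt0n.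
have pi_gt0 := pi_gt0 R.
have z1 : zeta R r ^+ r = 1.
  rewrite zetaX mulrC divfK // [2 * pi]mulr_natl cos2pi sin2pi.
  by apply/eqP; rewrite eq_complex /= !eqxx.
have zn1 s : (0 < s < r)%N -> zeta R r ^+ s != 1.
  move=> /andP[s_gt0 lt_sr]; rewrite zetaX eq_complex /= negb_and.
  set x : R := s%:R / r%:R * pi.
  have -> : s%:R * (2 * pi / r%:R) = x *+ 2 by rewrite /x -mulr_natl; field.
  rewrite cos_mulr2n cos2sin2.
  have : 0 < sin x.
    apply: sin_gt0_pi; rewrite mulr_gt0 ?divr_gt0 ?ltr0n //=.
    by rewrite -[ltRHS]mul1r ltr_pM2r // ltr_pdivrMr ?ltr0n // mul1r ltr_nat.
  rewrite -mulr_natl => sx; apply/orP; left; apply/eqP => E.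
  have : sin x ^+ 2 = 0 by lra.
  by move/eqP; rewrite sqrf_eq0 gt_eqF.
have [m prim_m m_dv] := prim_order_exists r_gt0 z1.
have m_gt0 := prim_order_gt0 prim_m.
suff E : m = r by rewrite -{1}E.
apply/eqP; rewrite eqn_leq dvdn_leq //= leqNgt; apply/negP => lt_mr.
by have := zn1 m; rewrite m_gt0 lt_mr (prim_expr_order prim_m) eqxx => /(_ isT).
Qed.
End Zeta.

(** * Quadratic Gauss sums *)

Section GaussSums.
Variables (C : numFieldType) (q : nat) (nu : {unit 'F_q}).
Hypotheses (q_pr : prime q) (q_odd : odd q).
Hypothesis nu_gen : generator [set: {unit 'F_q}] nu.
Local Notation Fq := 'F_q.
Local Notation k := ((q - 1)./2).
Variable psi : Fq -> C.
Hypotheses (psiD : {morph psi : x y / x + y >-> x * y}) (psi0 : psi 0 = 1).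
Hypothesis psi_sum : \sum_y psi y = 0.
Let nz2 := two_neq0 q_pr q_odd.

Lemma psi_scale_sum (u : Fq) : u != 0 -> \sum_y psi (u * y) = 0.
Proof.
move=> nzu; rewrite -[RHS]psi_sum [RHS](reindex_inj (mulfI nzu)) /=.
exact: eq_bigr.
Qed.

(** The square classes of 1 and of [nu] exhaust the nonzero elements, over which psi sums to -1. *)
Lemma gauss_half_sum : gauss_half psi 1 + gauss_half psi (val nu) = -1.
Proof.
have nzn := unit_neq0 nu.
rewrite /gauss_half -(sum_squares q_pr q_odd psi (oner_neq0 _)) -(sum_squares q_pr q_odd psi nzn).
transitivity (\sum_(y | y != 0) psi y); last first.
  have := psi_sum; rewrite (bigD1 0) //= psi0 => E.
  by apply: (addrI 1); rewrite E subrr.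
rewrite [RHS](bigID (fun y => [exists p, (p != 0) && (y == p ^+ 2 * 1)])) /=.
congr (_ + _); apply: eq_bigl => y; apply/existsP/andP.
- case=> p /andP[nzp /eqP->]; rewrite mulr1 expf_neq0 //; split=> //.
  by apply/existsP; exists p; rewrite nzp mulr1 eqxx.
- by case=> _ /existsP.
- case=> p /andP[nzp /eqP->]; rewrite mulf_neq0 ?expf_neq0 //; split=> //.
  apply/existsPn => r; rewrite mulr1 negb_and negbK; case: (eqVneq r 0) => //= nzr.
  apply: contra (nu_nonsquare q_pr q_odd nu_gen (r / p)) => /eqP E.
  by rewrite expr_div_n -E mulrC mulKf ?expf_neq0.
case=> nzy /existsPn nsq; have [p nzp [Ey|Ey]] := square_or_nu q_pr q_odd nu_gen nzy.
  by have := nsq p; rewrite mulr1 nzp Ey eqxx.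
by exists p; rewrite nzp Ey eqxx.
Qed.

Lemma gauss_half_scale (r y : Fq) : r != 0 -> gauss_half psi (r ^+ 2 * y) = gauss_half psi y.
Proof.
move=> nzr; rewrite /gauss_half; congr (_ / _).
rewrite [RHS](reindex_inj (mulfI nzr)) /=; apply: eq_big => [p|p _].
  by rewrite mulf_eq0 (negbTE nzr).
by congr psi; ring.
Qed.

(** The Gauss sums at 1 and at -1 have product q: the product sums psi(x^2 - y^2), and the
    substitution (x, y) |-> (x - y, x + y) turns it into the sum of psi(u v), where only u = 0
    contributes. The two differ by the quadratic character of -1, which is [(-1) ^+ k]. *)
Lemma gauss_half_sqr : (2 * gauss_half psi 1 + 1) ^+ 2 = (-1) ^+ k * q%:R.
Proof.
have gE y : 2 * gauss_half psi y + 1 = \sum_p psi (p ^+ 2 * y).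
  rewrite /gauss_half mulrC divfK ?pnatr_eq0 // [RHS](bigD1 0) //= expr0n mul0r psi0.
  by rewrite addrC.
have prod : (2 * gauss_half psi 1 + 1) * (2 * gauss_half psi (-1) + 1) = q%:R.
  rewrite !gE big_distrl /=; under eq_bigr => x _ do rewrite big_distrr /=.
  rewrite pair_big /=.
  pose h (u : Fq * Fq) := (u.1 - u.2, u.1 + u.2).
  have h_inj : injective h.
    move=> [x y] [x' y'] E.
    have /= E1 := congr1 fst E; have /= E2 := congr1 snd E.
    have Ex : x = x' by apply: (mulfI nz2); transitivity ((x - y) + (x + y)); [ring | rewrite E1 E2; ring].
    by congr (_, _) => //; apply: (addrI x); rewrite E2 Ex.
  transitivity (\sum_(u : Fq * Fq) psi (u.1 * u.2)).
    rewrite [RHS](reindex_inj h_inj) /=; apply: eq_bigr => u _.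
    by rewrite -psiD; congr psi; ring.
  rewrite -(pair_big xpredT xpredT (fun x y => psi (x * y))) /= (bigD1 0) //=.
  rewrite [X in _ + X]big1 ?addr0 => [|u /psi_scale_sum //].
  rewrite (eq_bigr (fun=> 1)) => [|y _]; last by rewrite mul0r psi0.
  by rewrite sumr_const card_Fp.
have gN : 2 * gauss_half psi (-1) + 1 = (-1) ^+ k * (2 * gauss_half psi 1 + 1).
  rewrite -signr_odd; case: (boolP (odd k)) => [od|ev].
    have [r nzr ->] := neg1_nonsquare q_pr q_odd nu_gen od.
    rewrite gauss_half_scale // expr1; have := gauss_half_sum.
    move: (gauss_half _ 1) (gauss_half _ (val nu)) => x y E.
    have -> : y = x + y - x by ring.
    by rewrite E; ring.
  have [r nzr ->] := neg1_square q_pr q_odd nu_gen ev.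
  by rewrite -[r ^+ 2]mulr1 gauss_half_scale // expr0 mul1r.
have ee : (-1 : C) ^+ k * (-1) ^+ k = 1 by rewrite -exprD addnn -signr_odd odd_double.
rewrite gN in prod; rewrite -prod [RHS]mulrCA (mulrA ((-1) ^+ k)) ee.
by rewrite mul1r expr2.
Qed.
End GaussSums.

Section AdditiveCharacter.
Variables (C : numFieldType) (q : nat) (z : C).
Hypotheses (q_pr : prime q) (prim_z : q.-primitive_root z).

Definition add_char (y : 'F_q) : C := z ^+ y.

Lemma add_charD : {morph add_char : x y / x + y >-> x * y}.
Proof.
have zN : z ^+ (Zp_trunc (pdiv q)).+2 = 1 by rewrite Fp_cast // prim_expr_order.
by move=> x y; rewrite /add_char -exprD -(expr_mod (x + y)%N zN).
Qed.

Lemma add_char0 : add_char 0 = 1.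
Proof. by rewrite /add_char expr0. Qed.

Lemma add_char_sum : \sum_y add_char y = 0.
Proof.
have q_gt1 := prime_gt1 q_pr.
have nz1 : add_char 1 != 1.
  rewrite /add_char (_ : nat_of_ord 1 = 1%N) // -(prim_order_dvd prim_z).
  by rewrite dvdn1 eqn_leq leqNgt q_gt1.
apply: (mulfI (_ : add_char 1 - 1 != 0)); first by rewrite subr_eq0.
rewrite mulr0 mulrBl mul1r mulr_sumr [X in _ - X](reindex_inj (addrI 1)) /=.
by rewrite -sumrB big1 // => y _; rewrite add_charD subrr.
Qed.
End AdditiveCharacter.

(** * Rows and irreducibility of the constructed characters *)

Section SL2Rows.
Variables (C : numFieldType) (q : nat) (nu : {unit 'F_q}) (b : GL2fin q).
Hypotheses (q_pr : prime q) (q_odd : odd q).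
Hypothesis nu_gen : generator [set: {unit 'F_q}] nu.
Hypotheses (Gb : b \in SL2_group q) (ob : #[b]%g = q.+1).
Local Notation Fq := 'F_q.
Local Notation GL := (GL2fin q).
Local Notation k := ((q - 1)./2).
Local Notation Q := (q%:R : C).
Local Notation K := (k%:R : C).
Local Notation e := ((-1) ^+ k : C).

Lemma has_row_ext f (r r' : row_data C) : has_row nu b f r ->
  [/\ at_1 r = at_1 r', at_z r = at_z r', at_c r = at_c r', at_d r = at_d r' &
      at_zc r = at_zc r'] ->
  [/\ at_zd r = at_zd r', forall l, (0 < l < k)%N -> at_a r l = at_a r' l &
     forall m, (0 < m <= k)%N -> at_b r m = at_b r' m] ->
  has_row nu b f r'.
Proof.
move=> [cf f1 fz fc fd fzc fzd fa fb] [e1 ez ec ed ezc] [ezd ea eb].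
by split=> [//||||||| l ll | m mm]; rewrite ?f1 ?fz ?fc ?fd ?fzc ?fzd ?fa ?fb // ?ea ?eb.
Qed.

Variables om mu : C.
Hypotheses (prim_om : (k.*2).-primitive_root om) (prim_mu : q.+1.-primitive_root mu).

Let k_gt0 : (0 < k)%N := k_gt0 q_pr q_odd.
Let q_eq : q = k.*2.+1 := q_eq q_pr q_odd.
Let Q_eq : Q = 2 * K + 1 := Q_eq C q_pr q_odd.

Lemma prim_half_root (z : C) h : (0 < h)%N -> (h.*2).-primitive_root z -> z ^+ h = -1.
Proof.
move=> h_gt0 prim_z; have : (z ^+ h) ^+ 2 == 1.
  by rewrite -exprM muln2 prim_expr_order.
rewrite sqrf_eq1 -(prim_order_dvd prim_z) => /orP[/(dvdn_leq h_gt0)|/eqP //].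
by rewrite -addnn -{3}[h]addn0 leq_add2l leqNgt h_gt0.
Qed.

Lemma prim_sqr_neq1 (z : C) h l : (h.*2).-primitive_root z -> (0 < l < h)%N -> (z ^+ l) ^+ 2 != 1.
Proof.
move=> prim_z /andP[l_gt0 ltlh].
by rewrite -exprM muln2 -(prim_order_dvd prim_z) gtnNdvd ?double_gt0 ?ltn_double.
Qed.

Let om_k : om ^+ k = -1 := prim_half_root k_gt0 prim_om.
Let mu_k : mu ^+ k.+1 = -1.
Proof. by apply: prim_half_root => //; rewrite doubleS -q_eq. Qed.

Let prim_mu2 : (k.+1.*2).-primitive_root mu.
Proof. by rewrite doubleS -q_eq. Qed.

Lemma principal_row i : has_row nu b (principal_series nu (om ^+ i))
  (RowData (Q + 1) ((-1) ^+ i * (Q + 1)) 1 1 ((-1) ^+ i) ((-1) ^+ i)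
     (fun l => om ^+ (i * l) + om ^- (i * l)) (fun=> 0)).
Proof.
have wk : (om ^+ i) ^+ k.*2 = 1 by rewrite exprAC (prim_expr_order prim_om) expr1n.
apply: has_row_ext (principal_series_row q_pr q_odd nu_gen Gb ob wk) _ _; split=> //=.
- by rewrite exprAC om_k mulrC.
- by rewrite exprAC om_k.
- by rewrite exprAC om_k.
by move=> l _; rewrite exprM.
Qed.
Definition steinberg (g : GL) : C := principal_series nu (om ^+ 0) g - 1.

Lemma steinberg_row : has_row nu b steinberg
  (RowData Q Q 0 0 0 0 (fun=> 1) (fun=> -1)).
Proof.
apply: (has_row_ext (has_rowB (principal_row 0) (has_row_const nu b (1 : C)))).
  by split; rewrite /= ?expr0; ring.
split=> [|l ll|m mm] /=; rewrite ?mul0n ?expr0 ?invr1; ring.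
Qed.

Section Whittaker.
Variables (psi1 psi2 : Fq -> C).
Hypotheses (psi1D : {morph psi1 : x y / x + y >-> x * y}) (psi10 : psi1 0 = 1).
Hypotheses (psi2D : {morph psi2 : x y / x + y >-> x * y}) (psi20 : psi2 0 = 1).
Variables x1 x2 : C.
Hypotheses (g11 : gauss_half psi1 1 = x1) (g1n : gauss_half psi1 (val nu) = x2).
Hypotheses (g21 : gauss_half psi2 1 = x2) (g2n : gauss_half psi2 (val nu) = x1).
Hypothesis x12 : x1 + x2 = -1.

Let sgnM (i : nat) : (-1 : C) ^+ i * (-1) ^+ i = 1.
Proof. by rewrite -exprD addnn -signr_odd odd_double. Qed.

(** [psi1] and [psi2] stand for the two square classes of additive characters, so the sum takes
    equal values at c and d. Its degree is q^2 - 1, and removing the torus character of degree q(q -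
    1) with the same central sign leaves q - 1. *)
Definition cuspidal (j : nat) (g : GL) : C :=
  whittaker ((-1) ^+ j) psi1 g + whittaker ((-1) ^+ j) psi2 g - torus_ind b (mu ^+ j) g.

Lemma cuspidal_row j : has_row nu b (cuspidal j)
  (RowData (Q - 1) ((-1) ^+ j * (Q - 1)) (-1) (-1) (- (-1) ^+ j) (- (-1) ^+ j) (fun=> 0)
     (fun m => - (mu ^+ (j * m) + mu ^- (j * m)))).
Proof.
have vb : (mu ^+ j) ^+ q.+1 = 1 by rewrite exprAC (prim_expr_order prim_mu) expr1n.
have w1 := whittaker_row q_pr q_odd nu_gen Gb ob (sgnM j) psi1D psi10.
have w2 := whittaker_row q_pr q_odd nu_gen Gb ob (sgnM j) psi2D psi20.
have t := torus_row q_pr q_odd nu_gen Gb ob vb.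
have x1E : x1 = -1 - x2 by rewrite -x12 addrK.
apply: (has_row_ext (has_rowB (has_rowD w1 w2) t)).
  split; rewrite /= ?g11 ?g1n ?g21 ?g2n ?x1E ?Q_eq; try ring.
  by rewrite exprAC mu_k; ring.
split=> [|l ll|m mm] /=; first by rewrite ?g1n ?g2n ?x1E; ring.
  by ring.
by rewrite exprM; ring.
Qed.

(* The sum of the half Gelfand-Graev character with its constituents of
   degree q, q + 1 and q - 1 removed. *)
Definition half_weil (p : bool) (psi : Fq -> C) (g : GL) : C :=
  whittaker ((-1) ^+ p) psi g - (if p then 0 else 1) * steinberg g
  - \sum_(1 <= i < k | odd i == p) principal_series nu (om ^+ i) g
  - \sum_(1 <= j < k.+1 | odd j == p) cuspidal j g.

(** The constant t is 1 if the central sign s equals e and 0 if it is the opposite. The first case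
    is a row of type xi, of degree [K + 1]; the second is one of type eta, of degree [K]. *)
Lemma half_weil_row (p : bool) (psi : Fq -> C) (y1 y2 : C) :
  {morph psi : x y / x + y >-> x * y} -> psi 0 = 1 ->
  gauss_half psi 1 = y1 -> gauss_half psi (val nu) = y2 ->
  let s := (-1) ^+ p in let t := (1 + s * e) / 2 in
  has_row nu b (half_weil p psi)
   (RowData (K + t) (s * (K + t)) (y1 + t) (y2 + t) (s * (y1 + t)) (s * (y2 + t))
     (fun l => t * (-1) ^+ l) (fun m => - ((1 - t) * (-1) ^+ m))).
Proof.
move=> psiD psi0 gy1 gy2 s t.
have ss : s * s = 1 := sgnM p.
have w := whittaker_row q_pr q_odd nu_gen Gb ob ss psiD psi0.
have pc := has_row_const nu b (if p then 0 else 1 : C).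
have A := has_row_bigsum (index_iota 1 k) (P := fun i => odd i == p) (fun i _ => principal_row i).
have B := has_row_bigsum (index_iota 1 k.+1) (P := fun j => odd j == p) (fun j _ => cuspidal_row j).
have sgE i : odd i == p -> (-1) ^+ i = s by rewrite -signr_odd => /eqP ->.
have pE : (if p then 0 else 1) = (1 + s) / 2 by rewrite /s; case: (p); field.
have tB : (1 + s * (-1) ^+ k.+1) / 2 = 1 - t by rewrite /t exprS; field.
have cA := half_range_count C p k_gt0; have cB := half_range_count C p (ltn0Sn k).
rewrite -/s -/t in cA; rewrite -/s tB -[k.+1%:R]natr1 in cB.
(* [nA] and [nB] are the numbers of principal series and cuspidal characters removed. *)
set nA := (K - _ - _) / 2 in cA; set nB := (K + 1 - _ - _) / 2 in cB.
have sumA (x : C) : \sum_(1 <= i < k | odd i == p) x = nA * x.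
  by rewrite -cA mulr_suml; apply: eq_bigr => i _; rewrite mul1r.
have sumB (x : C) : \sum_(1 <= j < k.+1 | odd j == p) x = nB * x.
  by rewrite -cB mulr_suml; apply: eq_bigr => i _; rewrite mul1r.
have sumAs (x : C) : \sum_(1 <= i < k | odd i == p) (-1) ^+ i * x = nA * (s * x).
  by rewrite -sumA; apply: eq_bigr => i /sgE ->.
have sumBs (x : C) : \sum_(1 <= j < k.+1 | odd j == p) (-1) ^+ j * x = nB * (s * x).
  by rewrite -sumB; apply: eq_bigr => i /sgE ->.
have sumA1 : \sum_(1 <= i < k | odd i == p) (-1) ^+ i = nA * s.
  by rewrite -[s]mulr1 -sumAs; apply: eq_bigr => i _; rewrite mulr1.
have sumB1 : \sum_(1 <= j < k.+1 | odd j == p) - (-1) ^+ j = - (nB * s) :> C.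
  rewrite sumrN; congr (- _); rewrite -[s]mulr1 -sumBs.
  by apply: eq_bigr => i _; rewrite mulr1.
have sumAa l : (0 < l < k)%N ->
    \sum_(1 <= i < k | odd i == p) (om ^+ (i * l) + om ^- (i * l)) =
    - (1 + s) / 2 - t * (-1) ^+ l.
  move=> ll; have zk : (om ^+ l) ^+ k.*2 = 1 by rewrite exprAC (prim_expr_order prim_om) expr1n.
  have := half_range_parity p k_gt0 zk (prim_sqr_neq1 prim_om ll).
  rewrite exprAC om_k -/s -/t => <-; apply: eq_bigr => i _.
  by rewrite mulnC exprM.
have sumBb m : (0 < m <= k)%N ->
    \sum_(1 <= j < k.+1 | odd j == p) - (mu ^+ (j * m) + mu ^- (j * m)) =
    (1 + s) / 2 + (1 - t) * (-1) ^+ m.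
  move=> mm; have zk : (mu ^+ m) ^+ k.+1.*2 = 1 by rewrite exprAC (prim_expr_order prim_mu2) expr1n.
  have m2 : (mu ^+ m) ^+ 2 != 1 by apply: prim_sqr_neq1 prim_mu2 _.
  have := half_range_parity p (ltn0Sn k) zk m2.
  rewrite exprAC mu_k -/s tB sumrN => E.
  transitivity (- (- (1 + s) / 2 - (1 - t) * (-1) ^+ m)); last by field.
  rewrite -E; congr (- _); apply: eq_bigr => i _.
  by rewrite mulnC exprM.
(* The values at z agree only modulo [s * s = 1], hence a split on s. *)
have s1 : s = 1 \/ s = -1 by rewrite /s; case: (p); [right | left].
apply: (has_row_ext (has_rowB (has_rowB (has_rowB w (has_rowM pc steinberg_row)) A) B)).
  split; rewrite /= ?gy1 ?gy2 ?sumA ?sumB ?sumAs ?sumBs ?sumA1 ?sumB1 pE /nA /nB ?Q_eq;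
    by case: s1 => ->; field.
split=> [|l ll|m mm]; rewrite /= ?gy2 ?sumA1 ?sumB1.
- by rewrite /nA /nB; case: s1 => ->; field.
- by rewrite sumAa // pE big1_eq; field.
by rewrite sumBb // pE big1_eq; field.
Qed.
End Whittaker.
End SL2Rows.

(** * Irreducibility by computation of norms *)

Section SL2Irreducibles.
Variables (C : numClosedFieldType) (q : nat) (nu : {unit 'F_q}) (b : GL2fin q).
Hypotheses (q_pr : prime q) (q_odd : odd q).
Hypothesis nu_gen : generator [set: {unit 'F_q}] nu.
Hypotheses (Gb : b \in SL2_group q) (ob : #[b]%g = q.+1).
Local Notation Fq := 'F_q.
Local Notation GL := (GL2fin q).
Local Notation G := (SL2_group q).
Local Notation k := ((q - 1)./2).
Local Notation Q := (q%:R : C).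
Local Notation K := (k%:R : C).
Local Notation e := ((-1) ^+ k : C).
Variables om mu : C.
Hypotheses (prim_om : (k.*2).-primitive_root om) (prim_mu : q.+1.-primitive_root mu).
Let k_gt0 : (0 < k)%N := k_gt0 q_pr q_odd.
Let q_eq : q = k.*2.+1 := q_eq q_pr q_odd.
Let Q_eq : Q = 2 * K + 1 := Q_eq C q_pr q_odd.
Let cardG : #|G|%:R = 2 * K * Q * (Q + 1) := card_SL2R C q_pr q_odd.

Definition irr_afforded (f : GL -> C) := exists n (r : mx_representation C G n),
  mx_irreducible r /\ {in G, forall g, f g = \tr (r g)}.

Lemma vchar_ind (H : {group GL}) (lam : GL -> C) : H \subset G ->
  {in H &, {morph lam : x y / (x * y)%g >-> x * y}} -> vchar G (ind_char G H lam).
Proof.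
move=> sHG lamM; have [n [r Er]] := ind_char_repr sHG lamM.
exact: eq_vchar Er (vchar_repr r).
Qed.

Lemma trivial_mx_repr (F : fieldType) : mx_repr G (fun=> 1%:M : 'M[F]_1).
Proof. by split=> // g h _ _; rewrite mul1mx. Qed.
Definition trivial_repr F := MxRepresentation (trivial_mx_repr F).

Lemma mxtrace_trivial (F : fieldType) g : \tr (trivial_repr F g) = 1.
Proof. by rewrite mxtrace1. Qed.

Lemma vchar_trivial : vchar G (fun=> 1 : C).
Proof. by apply: eq_vchar (vchar_repr (trivial_repr C)) => g _; apply: mxtrace_trivial. Qed.

Lemma vchar_principal i : vchar G (principal_series nu (om ^+ i)).
Proof.
have wk : (om ^+ i) ^+ k.*2 = 1 by rewrite exprAC (prim_expr_order prim_om) expr1n.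
exact: vchar_ind (@borel_sub q) (borel_linM q_pr q_odd nu_gen wk).
Qed.

Lemma vchar_steinberg : vchar G (steinberg nu om).
Proof. exact: vcharB (vchar_principal 0) vchar_trivial. Qed.

Lemma vchar_whittaker (s : C) psi : s * s = 1 ->
  {morph psi : x y / x + y >-> x * y} -> vchar G (@whittaker C q s psi).
Proof.
move=> ss psiD; apply: vchar_ind; first exact: subsetIl.
exact: (unip_linM q_pr q_odd ss psiD).
Qed.

Lemma vchar_torus j : vchar G (torus_ind b (mu ^+ j)).
Proof.
have vb : (mu ^+ j) ^+ q.+1 = 1 by rewrite exprAC (prim_expr_order prim_mu) expr1n.
apply: vchar_ind; first by rewrite cycle_subG.
exact: (torus_linM ob vb).
Qed.

Let sgnM (i : nat) : (-1 : C) ^+ i * (-1) ^+ i = 1.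
Proof. by rewrite -exprD addnn -signr_odd odd_double. Qed.

Let sgn_cancel i x y : (-1 : C) ^+ i * x * ((-1) ^+ i * y) = x * y.
Proof. by rewrite mulrACA sgnM mul1r. Qed.

Let pred_q : (q.-1%:R : C) = 2 * K := pred_qR C q_pr q_odd.

Let kS1 : (k.+1 - 1 = k)%N.
Proof. by rewrite subSS subn0. Qed.

(** Equal values at c and d, and at zc and zd, make the row invariant under inversion. This serves
    the characters of degree q, q + 1 and q - 1. *)
Let symmetric_pairing f v1 vz vc vzc va vb :
  has_row nu b f (RowData v1 vz vc vc vzc vzc va vb) ->
  pairing G f f = v1 * v1 + vz * vz + 2 * (vc * vc + vzc * vzc) * (2 * K * (K + 1)) +
    (\sum_(1 <= l < k) va l * va l) * (Q * (Q + 1)) +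
    (\sum_(1 <= m < k.+1) vb m * vb m) * (2 * K * Q).
Proof.
move=> fr; rewrite (pairing_has_row q_pr q_odd nu_gen Gb ob fr fr) /inv_row /=.
have -> : (if odd k then RowData v1 vz vc vc vzc vzc va vb
           else RowData v1 vz vc vc vzc vzc va vb) = RowData v1 vz vc vc vzc vzc va vb.
  by case: (odd k).
by rewrite /= -(mulr_natr _ (2 * k * k.+1)) -(mulr_natr _ (q * q.+1)) -(mulr_natr _ (q.-1 * q))
  !natrM pred_q -[q.+1%:R]natr1 -[k.+1%:R]natr1; ring.
Qed.

(** Squaring gives the half-range sum of [z ^+ (2 * i)] plus [2 * (h - 1)]. The identity is used for
    norms and again for eigenvalue multiplicities, where the same numbers are the character
    values. *)
Lemma half_range_norm (z : C) h i : (0 < h)%N -> (h.*2).-primitive_root z -> (0 < i < h)%N ->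
  \sum_(1 <= l < h) (z ^+ (i * l) + z ^- (i * l)) * (z ^+ (i * l) + z ^- (i * l)) =
  2 * h%:R - 4.
Proof.
move=> h_gt0 prim_z ii.
have nzz : z != 0.
  apply: contra_eq_neq (prim_expr_order prim_z) => ->.
  by rewrite expr0n double_eq0 eqn0Ngt h_gt0 eq_sym oner_neq0.
have zh : ((z ^+ i) ^+ 2) ^+ h = 1.
  by rewrite -exprM mul2n exprAC (prim_expr_order prim_z) expr1n.
have zh2 : ((z ^+ i) ^+ 2) ^+ h.*2 = 1 by rewrite -muln2 exprM zh expr1n.
have := half_range_sum h_gt0 zh2 (prim_sqr_neq1 prim_z ii); rewrite zh => E.
have -> : \sum_(1 <= l < h) (z ^+ (i * l) + z ^- (i * l)) * (z ^+ (i * l) + z ^- (i * l)) =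
   \sum_(1 <= l < h) (((z ^+ i) ^+ 2) ^+ l + ((z ^+ i) ^+ 2) ^- l) + \sum_(1 <= l < h) (2 : C).
  rewrite -big_split; apply: eq_bigr => l _ /=.
  have -> : ((z ^+ i) ^+ 2) ^+ l = (z ^+ (i * l)) ^+ 2 by rewrite exprAC -[z ^+ i ^+ l]exprM.
  have : z ^+ (i * l) != 0 by rewrite expf_neq0.
  by move: (z ^+ (i * l)) => x nzx; field.
rewrite E sumr_const_nat -(mulr_natr _ (h - 1)) natrB //; ring.
Qed.

Lemma steinberg_irr : irr_afforded (steinberg nu om).
Proof.
have row := steinberg_row q_pr q_odd nu_gen Gb ob prim_om.
apply: (@vchar_norm1_irr _ _ _ _ q vchar_steinberg); last exact: row_1 row.
rewrite (symmetric_pairing row) cardG mulr1 mulrNN mulr1 !sumr_const_nat natrB // kS1 Q_eq; ring.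
Qed.

Lemma principal_irr i : (0 < i < k)%N -> irr_afforded (principal_series nu (om ^+ i)).
Proof.
move=> ii; have row := principal_row q_pr q_odd nu_gen Gb ob prim_om i.
apply: (@vchar_norm1_irr _ _ _ _ q.+1 (vchar_principal i)); last by rewrite (row_1 row) natr1.
rewrite (symmetric_pairing row) cardG half_range_norm // big1 => [|m _]; last by rewrite mul0r.
rewrite sgn_cancel sgnM Q_eq; ring.
Qed.

Section Whittaker.
Variables (psi1 psi2 : Fq -> C).
Hypotheses (psi1D : {morph psi1 : x y / x + y >-> x * y}) (psi10 : psi1 0 = 1).
Hypotheses (psi2D : {morph psi2 : x y / x + y >-> x * y}) (psi20 : psi2 0 = 1).
Variables r : C.
Local Notation x1 := ((-1 + r) / 2).
Local Notation x2 := ((-1 - r) / 2).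
Hypotheses (g11 : gauss_half psi1 1 = x1) (g1n : gauss_half psi1 (val nu) = x2).
Hypotheses (g21 : gauss_half psi2 1 = x2) (g2n : gauss_half psi2 (val nu) = x1).

Let x12 : x1 + x2 = -1. Proof. by field. Qed.

Let prim_mu2 : (k.+1.*2).-primitive_root mu.
Proof. by rewrite doubleS -q_eq. Qed.

Let cusp_row := cuspidal_row q_pr q_odd nu_gen Gb ob prim_mu psi1D psi10 psi2D psi20 g11 g1n g21 g2n x12.

Lemma vchar_cuspidal j : vchar G (cuspidal b mu psi1 psi2 j).
Proof.
apply: vcharB (vchar_torus j); apply: vcharD; apply: vchar_whittaker => //; exact: sgnM.
Qed.

Lemma cuspidal_irr j : (0 < j < k.+1)%N -> irr_afforded (cuspidal b mu psi1 psi2 j).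
Proof.
move=> jj; have row := cusp_row j.
apply: (@vchar_norm1_irr _ _ _ _ q.-1 (vchar_cuspidal j)); last first.
  by rewrite (row_1 row) /= pred_q Q_eq; ring.
rewrite (symmetric_pairing row) cardG big1 => [|m _]; last by rewrite mul0r.
under eq_bigr => m _ do rewrite mulrNN.
rewrite half_range_norm // sgn_cancel mulrNN [(- _) * _]mulrNN sgnM -[k.+1%:R]natr1 Q_eq; ring.
Qed.

Lemma vchar_half_weil p psi : {morph psi : x y / x + y >-> x * y} ->
  vchar G (half_weil nu b om mu psi1 psi2 p psi).
Proof.
move=> psiD; apply: vcharB; last by apply: vchar_sum => j _; apply: vchar_cuspidal.
apply: vcharB; last by apply: vchar_sum => j _; apply: vchar_principal.
apply: vcharB; first by apply: vchar_whittaker => //; apply: sgnM.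
case: p; first by apply: eq_vchar (@vchar0 C _ G) => g _; rewrite mul0r.
by apply: eq_vchar vchar_steinberg => g _; rewrite mul1r.
Qed.

Section HalfWeil.
Variable psi : Fq -> C.
Hypotheses (psiD : {morph psi : x y / x + y >-> x * y}) (psi0 : psi 0 = 1).
Variables (y1 y2 rho : C).
Hypotheses (gy1 : gauss_half psi 1 = y1) (gy2 : gauss_half psi (val nu) = y2).
Hypotheses (y1E : y1 = (-1 + rho) / 2) (y2E : y2 = (-1 - rho) / 2) (rho2 : rho ^+ 2 = e * Q).

Let hw_row p := half_weil_row q_pr q_odd nu_gen Gb ob prim_om prim_mu
  psi1D psi10 psi2D psi20 g11 g1n g21 g2n x12 p psiD psi0 gy1 gy2.

Let sgn_odd p : (-1 : C) ^+ (p (+) odd k) = (-1) ^+ p * e.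
Proof. by rewrite signr_addb signr_odd. Qed.

Let weil_row (p : bool) t : (1 + (-1) ^+ p * e) / 2 = t ->
  has_row nu b (half_weil nu b om mu psi1 psi2 p psi)
   (RowData (K + t) ((-1) ^+ p * (K + t)) (y1 + t) (y2 + t) ((-1) ^+ p * (y1 + t))
     ((-1) ^+ p * (y2 + t))
     (fun l => t * (-1) ^+ l) (fun m => - ((1 - t) * (-1) ^+ m))).
Proof. by move <-; apply: hw_row. Qed.

(** Inversion exchanges c and d exactly when the square of rho is -q. The contribution of c and d is
    a sum of squares [(1 + rho * rho) / 2] for even k and twice the product [(1 - rho * rho) / 4]
    for odd k, hence [(1 + Q) / 2] in both cases. *)
Lemma half_weil_norm (p : bool) : pairing G (half_weil nu b om mu psi1 psi2 p psi)
  (half_weil nu b om mu psi1 psi2 p psi) = #|G|%:R.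
Proof.
have [t tE tt] : exists2 t : C, (1 + (-1) ^+ p * e) / 2 = t & t = 0 \/ t = 1.
  exists (~~ (p (+) odd k))%:R; last by case: (_ (+) _); [left | right].
  by rewrite -sgn_odd; case: (_ (+) _); rewrite /= ?expr0 ?expr1; field.
have := weil_row tE; set r0 := RowData _ _ _ _ _ _ _ _ => row.
rewrite (pairing_has_row q_pr q_odd nu_gen Gb ob row row) cardG.
have invE : at_a (inv_row q r0) = at_a r0 /\ at_b (inv_row q r0) = at_b r0.
  by rewrite /inv_row; case: (odd k).
rewrite {}invE.1 {}invE.2.
have -> : \sum_(1 <= l < k) at_a r0 l * at_a r0 l = t * t * (K - 1).
  transitivity (\sum_(1 <= l < k) t * t).
    by apply: eq_bigr => l _; rewrite /= mulrACA sgnM mulr1.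
  by rewrite sumr_const_nat -(mulr_natr _ (k - 1)) natrB.
have -> : \sum_(1 <= m < k.+1) at_b r0 m * at_b r0 m = (1 - t) * (1 - t) * K.
  transitivity (\sum_(1 <= m < k.+1) (1 - t) * (1 - t)).
    by apply: eq_bigr => m _; rewrite /= mulrNN mulrACA sgnM mulr1.
  by rewrite sumr_const_nat kS1 mulr_natr.
rewrite -(mulr_natr _ (2 * k * k.+1)) -(mulr_natr _ (q * q.+1)) -(mulr_natr _ (q.-1 * q))
  !natrM pred_q -[q.+1%:R]natr1 -[k.+1%:R]natr1.
have ss := sgnM p.
have rhoE : rho * rho = (if odd k then -1 else 1) * (2 * K + 1).
  by rewrite -expr2 rho2 -Q_eq -[(-1) ^+ k]signr_odd; case: (odd k).
rewrite /inv_row /r0; move: (_ ^+ p) ss => s ss.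
have sE (x y : C) : s * x * (s * y) = x * y by rewrite mulrACA ss mul1r.
have cE : (y1 + t) * (y1 + t) + (y2 + t) * (y2 + t) = (1 + rho * rho) / 2.
  by rewrite y1E y2E; case: tt => ->; field.
have dE : (y1 + t) * (y2 + t) = (1 - rho * rho) / 4.
  by rewrite y1E y2E; case: tt => ->; field.
case: (odd k) rhoE => rhoE; rewrite /= !sE ?[(y2 + t) * (y1 + t)]mulrC ?cE ?dE rhoE Q_eq.
  by case: tt => ->; field.
by case: tt => ->; field.
Qed.

Lemma half_weil_irr p : irr_afforded (half_weil nu b om mu psi1 psi2 p psi).
Proof.
apply: (@vchar_norm1_irr _ _ _ _ (k + ~~ (p (+) odd k)) (vchar_half_weil p psiD)).
  exact: half_weil_norm.
rewrite (row_1 (hw_row p)) natrD /= -sgn_odd; congr (_ + _).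
by case: (_ (+) _); rewrite /= ?expr0 ?expr1; field.
Qed.
End HalfWeil.
End Whittaker.
End SL2Irreducibles.

(** * The character table *)

(** The square of the Gauss sum of psi is known, but not its sign relative to the given root r.
    Multiplying the argument by [nu] flips the sign, so psi and its twist are taken in whichever
    order fits r. *)
Lemma add_char_pair (C : numFieldType) (q : nat) (nu : {unit 'F_q}) (z r : C) :
  prime q -> odd q -> generator [set: {unit 'F_q}] nu -> q.-primitive_root z ->
  r ^+ 2 = (-1) ^+ ((q - 1)./2) * q%:R ->
  exists psi1 psi2 : 'F_q -> C,
    [/\ {morph psi1 : x y / x + y >-> x * y}, psi1 0 = 1,
        {morph psi2 : x y / x + y >-> x * y} & psi2 0 = 1] /\
    [/\ gauss_half psi1 1 = (-1 + r) / 2, gauss_half psi1 (val nu) = (-1 - r) / 2,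
        gauss_half psi2 1 = (-1 - r) / 2 & gauss_half psi2 (val nu) = (-1 + r) / 2].
Proof.
move=> q_pr q_odd nu_gen prim_z rr.
pose psi := add_char (q := q) z; pose psi' y := psi (val nu * y).
have psiD : {morph psi : x y / x + y >-> x * y} by apply: add_charD.
have psi0 : psi 0 = 1 by apply: add_char0.
have psi_sum : \sum_y psi y = 0 by apply: add_char_sum.
have psi'D : {morph psi' : x y / x + y >-> x * y} by move=> x y; rewrite /psi' mulrDr psiD.
have psi'0 : psi' 0 = 1 by rewrite /psi' mulr0.
have g'E y : gauss_half psi' y = gauss_half psi (val nu * y).
  by rewrite /gauss_half; congr (_ / _); apply: eq_bigr => p _; rewrite /psi' mulrCA.
have g'1 : gauss_half psi' 1 = gauss_half psi (val nu) by rewrite g'E mulr1.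
have g'n : gauss_half psi' (val nu) = gauss_half psi 1.
  by rewrite g'E -expr2 -[_ ^+ 2]mulr1 gauss_half_scale ?unit_neq0.
have gn : gauss_half psi (val nu) = - 1 - gauss_half psi 1.
  by rewrite -(gauss_half_sum q_pr q_odd nu_gen psi0 psi_sum) addrC addKr.
have := gauss_half_sqr q_pr q_odd nu_gen psiD psi0 psi_sum.
rewrite -rr => /eqP; rewrite eqf_sqr => /orP[] /eqP E.
  exists psi, psi'; split=> //; rewrite g'1 g'n gn.
  have -> : gauss_half psi 1 = (-1 + r) / 2 by rewrite -E; field.
  by split=> //; field.
exists psi', psi; split=> //; rewrite g'1 g'n gn.
have -> : gauss_half psi 1 = (-1 - r) / 2.
  by rewrite -E; field.
by split=> //; field.
Qed.

Section Table.
Variables (R : realType) (q : nat) (nu : {unit 'F_q}) (b : GL2fin q).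
Hypotheses (q_pr : prime q) (q_odd : odd q).
Hypothesis nu_gen : generator [set: {unit 'F_q}] nu.
Hypotheses (Gb : b \in SL2_group q) (ob : #[b]%g = q.+1).
Local Notation GL := (GL2fin q).
Local Notation G := (SL2_group q).
Local Notation k := ((q - 1)./2).

Lemma row_values_reps v1 vz vc vd va vb :
  map fst (@row_values R q nu b v1 vz vc vd va vb) = class_reps nu b.
Proof.
have -> : @row_values R q nu b v1 vz vc vd va vb =
  [:: (1%g : GL, v1); (sz q, vz); (low 1%g 1, vc); (low 1%g (val nu), vd);
      ((sz q * low 1%g 1%R)%g, vz / v1 * vc); ((sz q * low 1%g (val nu))%g, vz / v1 * vd)]
  ++ [seq ((low nu 0 ^+ l)%g : GL, va l) | l <- iota 1 ((q - 3)./2)]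
  ++ [seq ((b ^+ m)%g : GL, vb m) | m <- iota 1 k] by [].
rewrite /class_reps half_q3 // !map_cat -!map_comp.
by congr (_ ++ _); rewrite /= -!sz_low_unip lower1.
Qed.

Section Row.
Variables (v1 vz vc vd : R[i]) (va vb : nat -> R[i]).
Local Notation rv := (@row_values R q nu b v1 vz vc vd va vb).

Lemma table_row_at r v : (r, v) \in rv ->
  {in r ^: G, forall g, @table_row R q nu b v1 vz vc vd va vb g = v}.
Proof.
move=> rvr g rg; rewrite /table_row.
exact: (class_reps_table (class_reps_uniq q_pr q_odd nu_gen Gb ob) (row_values_reps _ _ _ _ _ _) rvr rg).
Qed.

Lemma table_has_row : has_row nu b (@table_row R q nu b v1 vz vc vd va vb)
  (RowData v1 vz vc vd (vz / v1 * vc) (vz / v1 * vd) va vb).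
Proof.
have at_rep r v : (r, v) \in rv -> @table_row R q nu b v1 vz vc vd va vb r = v.
  by move=> rvr; apply: (table_row_at rvr); apply: class_refl.
split=> /=.
- move=> g x Gg Gx; have [r r_in rg] := sl2_exhaust q_pr q_odd nu_gen Gb ob Gg.
  rewrite -(row_values_reps v1 vz vc vd va vb) in r_in.
  have [[r' v] rvr' Er] := mapP r_in; rewrite /= in Er; subst r'.
  by rewrite !(table_row_at rvr') // -(class_eqP rg) memJ_class.
- by apply: at_rep; rewrite !inE eqxx.
- by apply: at_rep; rewrite !inE eqxx ?orbT.
- by apply: at_rep; rewrite !inE eqxx ?orbT.
- by apply: at_rep; rewrite !inE eqxx ?orbT.
- by apply: at_rep; rewrite !inE eqxx ?orbT.
- by apply: at_rep; rewrite !inE eqxx ?orbT.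
- move=> l ll; apply: at_rep; rewrite !mem_cat; apply/or3P/Or32.
  apply/mapP; exists l => //; rewrite half_q3 // mem_iota; clear -ll; lia.
move=> m mm; apply: at_rep; rewrite !mem_cat; apply/or3P/Or33.
apply/mapP; exists m => //; rewrite mem_iota; clear -mm; lia.
Qed.
End Row.
End Table.

Section TableCharacters.
Variables (R : realType) (q : nat) (nu : {unit 'F_q}) (b : GL2fin q).
Hypotheses (q_pr : prime q) (q_odd : odd q).
Hypothesis nu_gen : generator [set: {unit 'F_q}] nu.
Hypotheses (Gb : b \in SL2_group q) (ob : #[b]%g = q.+1).
Local Notation C := R[i].
Local Notation GL := (GL2fin q).
Local Notation G := (SL2_group q).
Local Notation k := ((q - 1)./2).
Local Notation Q := (q%:R : C).
Local Notation K := (k%:R : C).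
Local Notation e := ((-1) ^+ k : C).
Local Notation om := (zeta R (q - 1)).
Local Notation mu := (zeta R (q + 1)).
Local Notation rt := (sqrt_eps_q R q).
Let k_gt0 : (0 < k)%N := k_gt0 q_pr q_odd.
Let q_eq : q = k.*2.+1 := q_eq q_pr q_odd.
Let Q_eq : Q = 2 * K + 1 := Q_eq C q_pr q_odd.
Let nzQ : Q != 0 := Q_neq0 C q_pr.
Let nzQ1 : Q + 1 != 0 := Q1_neq0 C q.
Let nzK : K != 0 := K_neq0 C q_pr q_odd.

Lemma zeta_prim_split : (k.*2).-primitive_root om.
Proof.
have E : (q - 1 = k.*2)%N by rewrite {1}q_eq subn1.
by rewrite -{1}E; apply: zeta_prim; rewrite E double_gt0.
Qed.

Lemma zeta_prim_nonsplit : q.+1.-primitive_root mu.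
Proof. by rewrite -[in q.+1]addn1; apply: zeta_prim; rewrite addn1. Qed.

Lemma epsE : eps R q = e.
Proof. by rewrite /eps -subn1. Qed.

Lemma sqrt_eps_qK : rt ^+ 2 = e * Q.
Proof. by rewrite sqrtCK epsE. Qed.

Let ee : e * e = 1.
Proof. by rewrite -exprD addnn -signr_odd odd_double. Qed.

Let nze : e != 0.
Proof. by rewrite signr_eq0. Qed.

Let table_row_eq f v1 vz vc vd va vb zc zd :
  f = @table_row R q nu b v1 vz vc vd va vb -> vz / v1 * vc = zc -> vz / v1 * vd = zd ->
  has_row nu b f (RowData v1 vz vc vd zc zd va vb).
Proof. by move=> -> <- <-; apply: table_has_row. Qed.

Lemma psi_row : has_row nu b (psi R nu b) (RowData Q Q 0 0 0 0 (fun=> 1) (fun=> -1)).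
Proof. by apply: table_row_eq; rewrite ?mulr0. Qed.

Lemma chi_row i : has_row nu b (chi R nu b i)
  (RowData (Q + 1) ((-1) ^+ i * (Q + 1)) 1 1 ((-1) ^+ i) ((-1) ^+ i)
     (fun l => om ^+ (i * l) + om ^- (i * l)) (fun=> 0)).
Proof. by apply: table_row_eq; rewrite ?mulr1 ?mulfK. Qed.

Lemma theta_row j : has_row nu b (theta R nu b j)
  (RowData (Q - 1) ((-1) ^+ j * (Q - 1)) (-1) (-1) (- (-1) ^+ j) (- (-1) ^+ j) (fun=> 0)
     (fun m => - (mu ^+ (j * m) + mu ^- (j * m)))).
Proof.
have nz : Q - 1 != 0 by rewrite Q_eq addrK mulf_neq0 // pnatr_eq0.
by apply: table_row_eq; rewrite ?mulrN1 ?mulfK.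
Qed.

Lemma xi1_row : has_row nu b (xi1 R nu b)
  (RowData (K + 1) (e * (K + 1)) ((1 + rt) / 2) ((1 - rt) / 2)
    (e * ((1 + rt) / 2)) (e * ((1 - rt) / 2)) (fun l => (-1) ^+ l) (fun=> 0)).
Proof.
have nz : K + 1 != 0 by rewrite natr1 pnatr_eq0.
rewrite /xi1; have := table_has_row q_pr q_odd nu_gen Gb ob ((Q + 1) / 2) (eps R q * (Q + 1) / 2)
 ((1 + rt) / 2) ((1 - rt) / 2) (fun l => (-1) ^+ l) (fun=> 0).
have -> : eps R q * (Q + 1) / 2 = e * (K + 1) by rewrite epsE Q_eq; field.
have -> : (Q + 1) / 2 = K + 1 by rewrite Q_eq; field.
by rewrite mulfK.
Qed.

Lemma xi2_row : has_row nu b (xi2 R nu b)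
  (RowData (K + 1) (e * (K + 1)) ((1 - rt) / 2) ((1 + rt) / 2)
    (e * ((1 - rt) / 2)) (e * ((1 + rt) / 2)) (fun l => (-1) ^+ l) (fun=> 0)).
Proof.
have nz : K + 1 != 0 by rewrite natr1 pnatr_eq0.
rewrite /xi2; have := table_has_row q_pr q_odd nu_gen Gb ob ((Q + 1) / 2) (eps R q * (Q + 1) / 2)
 ((1 - rt) / 2) ((1 + rt) / 2) (fun l => (-1) ^+ l) (fun=> 0).
have -> : eps R q * (Q + 1) / 2 = e * (K + 1) by rewrite epsE Q_eq; field.
have -> : (Q + 1) / 2 = K + 1 by rewrite Q_eq; field.
by rewrite mulfK.
Qed.

Lemma eta1_row : has_row nu b (eta1 R nu b)
  (RowData K (- e * K) ((-1 + rt) / 2) ((-1 - rt) / 2)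
    (- e * ((-1 + rt) / 2)) (- e * ((-1 - rt) / 2)) (fun=> 0) (fun m => (-1) ^+ m.+1)).
Proof.
rewrite /eta1; have := table_has_row q_pr q_odd nu_gen Gb ob ((Q - 1) / 2) (- (eps R q * (Q - 1) / 2))
 ((-1 + rt) / 2) ((-1 - rt) / 2) (fun=> 0) (fun m => (-1) ^+ m.+1).
have -> : - (eps R q * (Q - 1) / 2) = - e * K by rewrite epsE Q_eq; field.
have -> : (Q - 1) / 2 = K by rewrite Q_eq; field.
by rewrite mulfK.
Qed.

Lemma eta2_row : has_row nu b (eta2 R nu b)
  (RowData K (- e * K) ((-1 - rt) / 2) ((-1 + rt) / 2)
    (- e * ((-1 - rt) / 2)) (- e * ((-1 + rt) / 2)) (fun=> 0) (fun m => (-1) ^+ m.+1)).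
Proof.
rewrite /eta2; have := table_has_row q_pr q_odd nu_gen Gb ob ((Q - 1) / 2) (- (eps R q * (Q - 1) / 2))
 ((-1 - rt) / 2) ((-1 + rt) / 2) (fun=> 0) (fun m => (-1) ^+ m.+1).
have -> : - (eps R q * (Q - 1) / 2) = - e * K by rewrite epsE Q_eq; field.
have -> : (Q - 1) / 2 = K by rewrite Q_eq; field.
by rewrite mulfK.
Qed.

Let irr_eq (f h : GL -> C) : {in G, f =1 h} -> irr_afforded h -> irr_afforded f.
Proof. by move=> fh [n [r [irr_r E]]]; exists n, r; split=> // g Gg; rewrite fh ?E. Qed.

Let row_eq := @has_row_eq C _ _ _ q_pr q_odd nu_gen Gb ob.

Lemma psi_irr : irr_afforded (psi R nu b).
Proof.
apply: irr_eq (steinberg_irr q_pr q_odd nu_gen Gb ob zeta_prim_split).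
by apply: (row_eq psi_row (steinberg_row q_pr q_odd nu_gen Gb ob zeta_prim_split)).
Qed.

Lemma chi_irr i : (0 < i < k)%N -> irr_afforded (chi R nu b i).
Proof.
move/(principal_irr q_pr q_odd nu_gen Gb ob zeta_prim_split); apply: irr_eq.
by apply: (row_eq (chi_row i) (principal_row q_pr q_odd nu_gen Gb ob zeta_prim_split i)).
Qed.

Lemma cuspidal_table_irr : [/\ forall j, (0 < j <= k)%N -> irr_afforded (theta R nu b j),
   irr_afforded (xi1 R nu b) /\ irr_afforded (xi2 R nu b) &
   irr_afforded (eta1 R nu b) /\ irr_afforded (eta2 R nu b)].
Proof.
have pom := zeta_prim_split; have pmu := zeta_prim_nonsplit.
have [psi1 [psi2 [[D1 o1 D2 o2] [g11 g1n g21 g2n]]]] :=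
  add_char_pair q_pr q_odd nu_gen (zeta_prim R (prime_gt0 q_pr)) sqrt_eps_qK.
have x12 : (-1 + rt) / 2 + (-1 - rt) / 2 = -1 by field.
have hw p psi y1 y2 := @half_weil_row _ _ _ _ q_pr q_odd nu_gen Gb ob _ _ pom pmu
  _ _ D1 o1 D2 o2 _ _ g11 g1n g21 g2n x12 p psi y1 y2.
have hwi p psi psiD psi0 y1 y2 rho gy1 gy2 y1E y2E rho2:=
  @half_weil_irr _ _ _ _ q_pr q_odd nu_gen Gb ob _ _ pom pmu
  _ _ D1 o1 D2 o2 _ g11 g1n g21 g2n psi psiD psi0 y1 y2 rho gy1 gy2 y1E y2E rho2 p.
have rtN : (- rt) ^+ 2 = e * Q by rewrite sqrrN sqrt_eps_qK.
(* The central sign e selects the two xi and the sign -e the two eta; within each pair [psi1] and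
   [psi2] tell the members apart. *)
have so : (-1) ^+ odd k = e by rewrite signr_odd.
have sn : (-1) ^+ (~~ odd k) = - e by rewrite -[e]signr_odd; case: (odd k); rewrite ?opprK.
split=> [j jj||].
- apply: irr_eq (cuspidal_irr q_pr q_odd nu_gen Gb ob pmu D1 o1 D2 o2 g11 g1n g21 g2n jj).
  by apply: (row_eq (theta_row j) (cuspidal_row q_pr q_odd nu_gen Gb ob pmu D1 o1 D2 o2 g11 g1n g21 g2n x12 j)).
- split.
    apply: irr_eq (hwi (odd k) psi1 D1 o1 _ _ rt g11 g1n _ _ sqrt_eps_qK) => //.
    apply: (row_eq xi1_row (hw _ _ _ _ D1 o1 g11 g1n)).
      by rewrite /= so ee; split; field.
    by rewrite /= so ee; split=> [|l ll|m mm]; field.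
  apply: irr_eq (hwi (odd k) psi2 D2 o2 _ _ (- rt) g21 g2n _ _ rtN); rewrite ?opprK //.
  apply: (row_eq xi2_row (hw _ _ _ _ D2 o2 g21 g2n)).
    by rewrite /= so ee; split; field.
  by rewrite /= so ee; split=> [|l ll|m mm]; field.
split.
  apply: irr_eq (hwi (~~ odd k) psi1 D1 o1 _ _ rt g11 g1n _ _ sqrt_eps_qK) => //.
  apply: (row_eq eta1_row (hw _ _ _ _ D1 o1 g11 g1n)).
    by rewrite /= sn [- e * e]mulNr ee; split; field.
  by rewrite /= sn [- e * e]mulNr ee; split=> [|l ll|m mm]; rewrite ?exprS; field.
apply: irr_eq (hwi (~~ odd k) psi2 D2 o2 _ _ (- rt) g21 g2n _ _ rtN); rewrite ?opprK //.
apply: (row_eq eta2_row (hw _ _ _ _ D2 o2 g21 g2n)).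
  by rewrite /= sn [- e * e]mulNr ee; split; field.
by rewrite /= sn [- e * e]mulNr ee; split=> [|l ll|m mm]; rewrite ?exprS; field.
Qed.
End TableCharacters.

(** * Real types *)

(** The terms at m and 2h - m are paired, leaving those at 0 and h. For a torus inverted inside the
    group these are the values at the identity and at the central involution. *)
Lemma symmetric_sum (C : numFieldType) (F : nat -> C) (z : C) h :
  (0 < h)%N -> z ^+ h.*2 = 1 -> (forall l, (0 < l < h)%N -> F (h.*2 - l)%N = F l) ->
  \sum_(m < h.*2) z ^- m * F m = F 0 + z ^- h * F h + \sum_(1 <= l < h) (z ^+ l + z ^- l) * F l.
Proof.
move=> h_gt0 zh symF.
have nzz : z != 0.
  by apply: contra_eq_neq zh => ->; rewrite expr0n double_eq0 eqn0Ngt h_gt0 eq_sym oner_neq0.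
have lt_hh : (h < h + h)%N by rewrite -{1}[h]addn0 ltn_add2l.
rewrite -(big_mkord xpredT (fun m => z ^- m * F m)) -addnn (big_cat_nat (leq0n h) (leq_addr h h)) /=.
rewrite (big_ltn h_gt0) expr0 invr1 mul1r (big_ltn lt_hh).
have -> : \sum_(h.+1 <= m < h + h) z ^- m * F m = \sum_(1 <= l < h) z ^+ l * F l.
  rewrite -{1}[h.+1]addn1 addnC big_addn addnK big_nat_rev /= big_nat [RHS]big_nat.
  apply: eq_bigr => l ll; have -> : (1 + h - l.+1 + h = h.*2 - l)%N.
    by rewrite -addnn; clear -ll; lia.
  rewrite symF //; congr (_ * _); apply: (mulIf (expf_neq0 (h.*2 - l) nzz)).
  rewrite mulVf ?expf_neq0 // -exprD -zh; congr (z ^+ _).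
  by rewrite -addnn; clear -ll; lia.
under [X in _ = _ + X]eq_bigr do rewrite mulrDl.
rewrite big_split /=; ring.
Qed.

Section RealTypesSL2.
Variables (R : realType) (q : nat).
Local Notation C := R[i].
Local Notation GL := (GL2fin q).
Local Notation G := (SL2_group q).
Variables (f : GL -> C) (s : bool) (t w : GL) (h d : nat) (z : C).
Hypotheses (irr_f : irr_afforded f) (cf : @class_function C q f).
Hypothesis real_f : {in G, forall g, complex.Im (f g) = 0}.
Hypotheses (Gt : t \in G) (Gw : w \in G) (ww : (w * w = sz q)%g).
Hypotheses (wt : (w * t * w^-1 = t^-1)%g) (th : (t ^+ h = sz q)%g) (h_gt0 : (0 < h)%N).
Hypotheses (zh : z ^+ h.*2 = 1) (zz : z * z^*%C = 1).
Variables (v1 : C) (F : nat -> C).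
Hypotheses (f1 : f 1%g = v1) (fz : f (sz q) = (-1) ^+ s * v1) (odd_d : odd d).
Hypothesis ft : forall l, (0 < l < h)%N -> f (t ^+ l)%g = F l.
Hypothesis mult : v1 + z ^- h * ((-1) ^+ s * v1) +
  \sum_(1 <= l < h) (z ^+ l + z ^- l) * F l = (h.*2)%:R * d%:R.

(** [mult] is Fourier inversion on the powers of t: it says that the eigenvalue [z] of t has
    multiplicity d. The central sign decides between a real form and the realification, whose trace
    is doubled, whence the factor. *)
Lemma real_irr_of_odd_mult :
  real_irr_character G (fun g => (if s then 2 else 1) * f g).
Proof.
have [n [X [irrX fE]]] := irr_f.
have absX : mx_absolutely_irreducible X by apply: group_closure_closed_field.
have Gz : sz q \in G by rewrite -ww groupM.
have n_gt0 : (0 < n)%N by case/mx_irrP: irrX.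
(* By Schur's lemma the central involution acts as a scalar, which is read off from its trace. *)
have Xz : X (sz q) = ((-1) ^+ s)%:M.
  have /(mx_abs_irr_cent_scalar absX) /is_scalar_mxP [c Ec] : centgmx X (X (sz q)).
    by apply/centgmxP => g Gg; rewrite -!repr_mxM // elt_z_central.
  move: fz; rewrite -f1 !fE ?group1 // Ec repr_mx1 mxtrace_scalar mxtrace1 -[c *+ n]mulr_natr => /mulIf -> //.
  by rewrite pnatr_eq0 -lt0n.
have t2h : (t ^+ h.*2 = 1)%g by rewrite -addnn expgD th elt_zz.
have rkE : \rank (eigenspace (X t) z) = d.
  apply/eqP; rewrite -(eqr_nat C); apply/eqP.
  rewrite (@rank_eigenspace_sum _ _ (X t) (fun m => X (t ^+ m)%g) h.*2) ?double_gt0 //; last first.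
  - by rewrite t2h repr_mx1.
  - by move=> m; rewrite expgSr repr_mxM ?groupX.
  - by rewrite expg0 repr_mx1.
  under eq_bigr => m _ do rewrite -fE ?groupX //.
  rewrite (@symmetric_sum _ (fun m => f (t ^+ m)%g)) // => [|l ll].
    have -> : \sum_(1 <= l < h) (z ^+ l + z ^- l) * f (t ^+ l)%g =
        \sum_(1 <= l < h) (z ^+ l + z ^- l) * F l.
      by rewrite big_nat [RHS]big_nat; apply: eq_bigr => l /ft ->.
    by rewrite expg0 th f1 fz mult mulKf // pnatr_eq0 double_eq0 -lt0n.
  have -> : (t ^+ (h.*2 - l) = t ^- l)%g.
    apply: (mulgI (t ^+ l)%g); rewrite mulgV -expgD subnKC //.
    by rewrite -addnn; clear -ll; lia.
  have -> : (t ^- l = (t ^+ l) ^ w^-1)%g.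
    by rewrite -expgVn -wt conjXg /conjg invgK mulgA.
  by rewrite cf ?groupX ?groupV.
have odd_rk : odd (\rank (eigenspace (X t) z)) by rewrite rkE.
have Xww : X (w * w)%g = ((-1) ^+ s : R)%:C%C%:M.
  by rewrite ww Xz (rmorph_sign (real_complex R)).
have nzs : (-1) ^+ s != 0 :> R by rewrite signr_eq0.
have realX : {in G, forall g, complex.Im (\tr (X g)) = 0} by move=> g Gg; rewrite -fE ?real_f.
case: s Xww nzs => Xww nzs.
  have irrY := quaternionic_type_of_odd irrX Gt Gw Xww wt zz nzs odd_rk (ltrN10 _).
  exists (n + n)%N, (realify_repr X); split=> // g Gg.
  rewrite mxtrace_realify fE //; move: (realX g Gg); case: (\tr _) => x y /= ->.
  by apply/eqP; rewrite eq_complex /=; apply/andP; split; apply/eqP; ring.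
have [Y [irrY EY]] := real_type_of_odd irrX Gt Gw Xww wt zz nzs odd_rk (ltr01) realX.
by exists n, Y; split=> // g Gg; rewrite mul1r fE // EY.
Qed.
End RealTypesSL2.

(** * Elements with central square that invert a torus *)

Section Inverters.
Variables (q : nat) (nu : {unit 'F_q}) (b : GL2fin q).
Hypotheses (q_pr : prime q) (q_odd : odd q).
Hypothesis nu_gen : generator [set: {unit 'F_q}] nu.
Hypotheses (Gb : b \in SL2_group q) (ob : #[b]%g = q.+1).
Local Notation GL := (GL2fin q).
Local Notation G := (SL2_group q).
Local Notation k := ((q - 1)./2).

Lemma split_inverter (x : {unit 'F_q}) : exists2 w : GL, w \in G &
  (w * w = sz q)%g /\ (w * low x 0 * w^-1 = (low x 0)^-1)%g.
Proof.
have [u Gu Eu] : exists2 u : GL, u \in G & GLval u = Defs.mx2 0 1 (-1) 0.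
  by apply: SL2_mx2_exists; ring.
exists u => //; split.
  by apply: GL_inj; rewrite GLmulE elt_zE Eu mx2M [RHS]mx2E !mxE /= ?mulr1n ?mulr0n; congr Defs.mx2; ring.
apply: (mulIg u); rewrite mulgKV lowerV oppr0; apply: GL_inj.
by rewrite !GLmulE Eu !GLval_lower !mx2M !unitVE invrK; congr Defs.mx2; ring.
Qed.

(** Take x conjugating b to its inverse. Its square centralizes b, so it is a power of b; as such it
    is inverted by x, yet it commutes with x, so x^4 = 1. Were x^2 = 1, x would be central and b its
    own inverse, against the order of b. Hence x^2 is the central involution. *)
Lemma nonsplit_inverter : exists2 w : GL, w \in G &
  (w * w = sz q)%g /\ (w * b * w^-1 = b^-1)%g.
Proof.
have k0 : (0 < 1 <= k)%N by rewrite (k_gt0 q_pr q_odd).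
have /imsetP[x Gx bx] := bX_inv_class q_pr q_odd nu_gen Gb ob k0.
have bJ : (b ^ x = b^-1)%g by rewrite -[in RHS](expg1 b) bx.
have bV : (x^-1 * b * x = b^-1)%g by rewrite -bJ /conjg mulgA.
exists x^-1%g; rewrite ?groupV //; split; last by rewrite invgK.
have wVb : (b ^ (x * x) = b)%g.
  by rewrite conjgM bJ conjVg bJ invgK.
have := cent_bX q_pr q_odd Gb ob (bX_irr_half q_pr q_odd Gb ob k0).
move=> cb; have : (x * x)%g \in 'C_G[b ^+ 1]%g.
  by rewrite inE groupM //=; apply/cent1P; rewrite /commute [RHS]conjgC wVb.
rewrite cb => /cycleP[i Ei].
have x4 : (x * x * (x * x) = 1)%g.
  have E : (x * x = (x * x)^-1)%g.
    rewrite -[LHS](mulKg x) [(x * (x * x))%g]mulgA -/(conjg (x * x)%g x) Ei conjXg bJ expgVn //.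
  by rewrite {2}E mulgV.
have : (x * x = 1)%g \/ (x * x = sz q)%g by apply: sqr1_SL2; rewrite ?groupM.
case=> E; last first.
  by rewrite -invMg E; apply: (mulgI (sz q)); rewrite mulgV (elt_zz q).
have bb : (b * b = 1)%g.
  case: (sqr1_SL2 q_pr q_odd Gx E) => Ex; move: bV; rewrite Ex.
    by rewrite invg1 mul1g mulg1 => Eb; rewrite {2}Eb mulgV.
  by rewrite -mulgA -elt_z_central mulKg => Eb; rewrite {2}Eb mulgV.
have : (b ^+ 2 == 1)%g by rewrite expgS expg1 bb.
rewrite -order_dvdn ob => /dvdn_leq - /(_ isT); rewrite ltnS => q1.
by move: (prime_gt1 q_pr); rewrite ltnNge q1.
Qed.
End Inverters.

(** * Real types of the rows of the table *)

Section SL2RealIrreducibles.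
Variables (R : realType) (q : nat) (nu : {unit 'F_q}) (b : GL2fin q).
Hypotheses (q_pr : prime q) (q_odd : odd q).
Hypothesis nu_gen : generator [set: {unit 'F_q}] nu.
Hypotheses (Gb : b \in SL2_group q) (ob : #[b]%g = q.+1).
Local Notation C := R[i].
Local Notation GL := (GL2fin q).
Local Notation G := (SL2_group q).
Local Notation k := ((q - 1)./2).
Local Notation Q := (q%:R : C).
Local Notation K := (k%:R : C).
Local Notation e := ((-1) ^+ k : C).
Local Notation om := (zeta R (q - 1)).
Local Notation mu := (zeta R (q + 1)).
Local Notation rt := (sqrt_eps_q R q).
Let k_gt0 : (0 < k)%N := k_gt0 q_pr q_odd.
Let q_eq : q = k.*2.+1 := q_eq q_pr q_odd.
Let Q_eq : Q = 2 * K + 1 := Q_eq C q_pr q_odd.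
Let nzK : K != 0 := K_neq0 C q_pr q_odd.
Let pom := zeta_prim_split R q_pr q_odd.
Let pmu := zeta_prim_nonsplit R q.

Lemma complex_real_Im (x : C) : x \is Num.real -> complex.Im x = 0.
Proof. by move/complex_realP=> [y ->]. Qed.

Lemma zetaX_norm r s : zeta R r ^+ s * (zeta R r ^+ s)^*%C = 1.
Proof.
rewrite zetaX; set th := (_ * _ : R); apply/eqP; rewrite eq_complex /=.
apply/andP; split; apply/eqP; last by ring.
by rewrite mulrN opprK -!expr2 cos2Dsin2.
Qed.

Lemma zetaX_real r s : zeta R r ^+ s + zeta R r ^- s \is Num.real.
Proof.
have n1 := zetaX_norm r s; move: (_ ^+ s) n1 => x n1.
have nzx : x != 0 by apply: contra_eq_neq n1 => ->; rewrite mul0r eq_sym oner_neq0.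
have -> : x^-1 = x^*%C by apply: (mulfI nzx); rewrite divff.
by apply/complex_realP; exists (2 * complex.Re x); rewrite addcJ rmorphM rmorph_nat.
Qed.

Lemma row_real f (v1 vz vc vd vzc vzd : C) (va vb : nat -> C) :
  has_row nu b f (RowData v1 vz vc vd vzc vzd va vb) ->
  [/\ v1 \is Num.real, vz \is Num.real, vc \is Num.real & vd \is Num.real] ->
  [/\ vzc \is Num.real, vzd \is Num.real, forall l, va l \is Num.real & forall m, vb m \is Num.real] ->
  {in G, forall g, complex.Im (f g) = 0}.
Proof.
case=> cf f1 fz fc fd fzc fzd fa fb [R1 Rz Rc Rd] [Rzc Rzd Ra Rb] g Gg; apply: complex_real_Im.
have [r r_in /imsetP[x Gx ->]] := sl2_exhaust q_pr q_odd nu_gen Gb ob Gg.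
rewrite cf ?(class_reps_sub Gb r_in) //; move: r r_in.
apply: (class_reps_ind q_pr q_odd); rewrite ?f1 ?fz ?fc ?fd ?fzc ?fzd //.
  by move=> l ll; rewrite fa.
by move=> m mm; rewrite fb.
Qed.

Lemma real_irr_ext (f f' : GL -> C) : {in G, f =1 f'} ->
  real_irr_character G f -> real_irr_character G f'.
Proof. by move=> ff' [n [Y [irrY E]]]; exists n, Y; split=> // g Gg; rewrite -ff' ?E. Qed.

Lemma rt_parts : complex.Re rt * complex.Im rt = 0 /\
  complex.Re rt ^+ 2 - complex.Im rt ^+ 2 = (-1) ^+ k * q%:R.
Proof.
have := sqrt_eps_qK R q; rewrite -(rmorph_sign (real_complex R)) -(rmorph_nat (real_complex R)).
rewrite -rmorphM; case: rt => x y /eqP; rewrite eq_complex /= => /andP[/eqP Ex /eqP Ey].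
split; last by rewrite -Ex; ring.
by apply: (mulfI (_ : 2 != 0 :> R)); rewrite ?pnatr_eq0 // mulr0 -Ey; ring.
Qed.

Lemma rt_real : ~~ odd k -> rt \is Num.real.
Proof.
move=> ev; have [xy x2y2] := rt_parts; apply/complex_realP; exists (complex.Re rt).
have : complex.Im rt = 0.
  move: xy => /eqP; rewrite mulf_eq0 => /orP[/eqP x0|/eqP //].
  have : - complex.Im rt ^+ 2 > 0.
    move: x2y2; rewrite x0 expr0n sub0r -[(-1) ^+ k]signr_odd (negbTE ev) mul1r => ->.
    by rewrite ltr0n prime_gt0.
  by rewrite oppr_gt0 ltNge sqr_ge0.
by case: rt => x y /= ->.
Qed.

Lemma rt_imag : odd k -> complex.Re rt = 0 /\ complex.Im rt != 0.
Proof.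
move=> od; have [xy x2y2] := rt_parts.
rewrite -[(-1) ^+ k]signr_odd od mulN1r in x2y2.
have nzy : complex.Im rt != 0.
  apply/eqP => y0; move: x2y2; rewrite y0 expr0n subr0 => x2.
  by have := sqr_ge0 (complex.Re rt); rewrite x2 oppr_ge0 lern0 eqn0Ngt prime_gt0.
by move: xy => /eqP; rewrite mulf_eq0 (negbTE nzy) orbF => /eqP.
Qed.

Let signV_mul i (x : C) : (-1) ^- i * ((-1) ^+ i * x) = x.
Proof. by rewrite mulrA mulVf ?mul1r // signr_eq0. Qed.

Let signV i : (-1) ^- i = (-1) ^+ i :> C.
Proof. by rewrite -exprVn invrN invr1. Qed.

Let oneR : (1 : C) \is Num.real. Proof. exact: rpred1. Qed.
Let zeroR : (0 : C) \is Num.real. Proof. exact: rpred0. Qed.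
Let signR (i : nat) : ((-1) ^+ i : C) \is Num.real. Proof. by rewrite rpred_sign. Qed.
Let natR (i : nat) : (i%:R : C) \is Num.real. Proof. exact: rpred_nat. Qed.

Let one_norm : 1 * 1^*%C = 1 :> C.
Proof. by rewrite conjc1 mulr1. Qed.

Let torus_inv := nonsplit_inverter q_pr q_odd nu_gen Gb ob.
Let b_half : (b ^+ k.+1 = sz q)%g := bX_half q_pr q_odd Gb ob.
Let a_half : (low nu 0 ^+ k = sz q)%g.
Proof. by rewrite elt_aX (nuX_k q_pr q_odd nu_gen). Qed.

Lemma psi_real_irr : real_irr_character G (psi R nu b).
Proof.
have row := psi_row R q_pr q_odd nu_gen Gb ob.
have [w Gw [ww wb]] := torus_inv.
have realf : {in G, forall g, complex.Im (psi R nu b g) = 0}.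
  by apply: (row_real row); split=> // *; rewrite ?rpredN.
apply: (@real_irr_ext (fun g => 1 * psi R nu b g)) => [g _|]; first by rewrite mul1r.
(* The eigenvalue 1 of b is simple here: its multiplicity is (2q - 2k) / (q + 1) = 1. *)
apply: (real_irr_of_odd_mult (s := false) (d := 1) (z := 1) (v1 := Q) (F := fun=> -1)
   (psi_irr R q_pr q_odd nu_gen Gb ob) (row_class row) realf Gb Gw ww wb b_half (ltn0Sn k) _ one_norm
   (row_1 row) _ _ (row_b row)) => //.
- by rewrite expr1n.
- by rewrite mul1r (row_z row).
transitivity (Q + Q + \sum_(1 <= m < k.+1) (- 2)).
  by rewrite expr1n invr1 !mul1r; congr (_ + _); apply: eq_bigr => m _; rewrite expr1n invr1; ring.
by rewrite sumr_const_nat subSS subn0 -(mulr_natr _ k) -muln2 natrM -[k.+1%:R]natr1 Q_eq; ring.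
Qed.

Lemma chi_real_irr i : (0 < i < k)%N ->
  real_irr_character G (fun g => (if odd i then 2 else 1) * chi R nu b i g).
Proof.
move=> ii; have row := chi_row R q_pr q_odd nu_gen Gb ob i.
have [w Gw [ww wt]] := split_inverter nu.
have realf : {in G, forall g, complex.Im (chi R nu b i g) = 0}.
  by apply: (row_real row); split=> // *; rewrite ?zetaX_real ?realM ?realD.
have omi : (om ^+ i) ^+ k = (-1) ^+ i by rewrite exprAC (prim_half_root k_gt0 pom).
(* The multiplicity 3 is explained by Mackey's formula. On the projective line the split torus has
   two fixed points, which contribute [om ^+ i] and its inverse once each, and two further orbits,
   each contributing every eigenvalue of the right central sign once. *)
apply: (real_irr_of_odd_mult (d := 3) (z := om ^+ i) (v1 := Q + 1)
   (F := fun l => om ^+ (i * l) + om ^- (i * l)) (chi_irr R q_pr q_odd nu_gen Gb ob ii)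
   (row_class row) realf (lower_SL2 nu 0) Gw ww wt a_half k_gt0 _ (zetaX_norm _ _)
   (row_1 row) _ _ (row_a row)) => //.
- by rewrite exprAC (prim_expr_order pom) expr1n.
- by rewrite (row_z row) signr_odd.
under eq_bigr => l _ do rewrite -exprM.
rewrite half_range_norm // omi signr_odd signV_mul -muln2 natrM Q_eq; ring.
Qed.

Lemma theta_real_irr j : (0 < j <= k)%N ->
  real_irr_character G (fun g => (if odd j then 2 else 1) * theta R nu b j g).
Proof.
move=> jj; have row := theta_row R q_pr q_odd nu_gen Gb ob j.
have [w Gw [ww wt]] := torus_inv.
have realf : {in G, forall g, complex.Im (theta R nu b j g) = 0}.
  by apply: (row_real row); split=> // *; rewrite ?rpredN ?zetaX_real ?realM ?realB.
have pmu2 : (k.+1.*2).-primitive_root mu by rewrite doubleS -q_eq.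
have muj : (mu ^+ j) ^+ k.+1 = (-1) ^+ j by rewrite exprAC (prim_half_root (ltn0Sn k) pmu2).
have [thI _ _] := cuspidal_table_irr R q_pr q_odd nu_gen Gb ob.
(* Every eigenvalue of b allowed by the central sign is double, except [mu ^+ j] and its inverse,
   which are simple. *)
apply: (real_irr_of_odd_mult (d := 1) (z := mu ^+ j) (v1 := Q - 1)
   (F := fun m => - (mu ^+ (j * m) + mu ^- (j * m))) (thI j jj)
   (row_class row) realf Gb Gw ww wt b_half (ltn0Sn k) _ (zetaX_norm _ _)
   (row_1 row) _ _ (row_b row)) => //.
- by rewrite exprAC (prim_expr_order pmu2) expr1n.
- by rewrite (row_z row) signr_odd.
under eq_bigr => m _ do rewrite mulrN -exprM.
rewrite sumrN half_range_norm // muj signr_odd signV_mul -muln2 natrM -[k.+1%:R]natr1 Q_eq; ring.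
Qed.

Lemma xi_type_real_irr f (x y : C) : ~~ odd k -> irr_afforded f ->
  x \is Num.real -> y \is Num.real ->
  has_row nu b f (RowData (K + 1) (e * (K + 1)) x y (e * x) (e * y) (fun l => (-1) ^+ l) (fun=> 0)) ->
  real_irr_character G f.
Proof.
move=> ev fI Rx Ry row.
have e1 : e = 1 by rewrite -signr_odd (negbTE ev).
have [w Gw [ww wt]] := split_inverter nu.
have realf : {in G, forall g, complex.Im (f g) = 0}.
  by apply: (row_real row); split=> // *; rewrite ?realM ?realD.
apply: (@real_irr_ext (fun g => 1 * f g)) => [g _|]; first by rewrite mul1r.
(* For even k the centre acts trivially and the eigenvalue 1 of a is simple: the weighted sum is
   [2 * (K + 1) - 2], equal to [2 * K]. *)
apply: (real_irr_of_odd_mult (s := false) (d := 1) (z := 1) (v1 := K + 1)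
 (F := fun l => (-1) ^+ l) fI (row_class row) realf (lower_SL2 nu 0) Gw ww wt a_half
 k_gt0 _ one_norm (row_1 row) _ _ (row_a row)) => //.
- by rewrite expr1n.
- by rewrite (row_z row) e1.
under eq_bigr => l _ do rewrite expr1n invr1.
by rewrite -mulr_sumr sum_sign // e1 expr1n invr1 -muln2 natrM; field.
Qed.

Lemma eta_type_real_irr f (x y : C) : ~~ odd k -> irr_afforded f ->
  x \is Num.real -> y \is Num.real ->
  has_row nu b f (RowData K (- e * K) x y (- e * x) (- e * y) (fun=> 0) (fun m => (-1) ^+ m.+1)) ->
  real_irr_character G (fun g => 2 * f g).
Proof.
move=> ev fI Rx Ry row.
have e1 : e = 1 by rewrite -signr_odd (negbTE ev).
have [w Gw [ww wt]] := torus_inv.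
have realf : {in G, forall g, complex.Im (f g) = 0}.
  by apply: (row_real row); split=> // *; rewrite ?realM ?realD ?rpredN.
have pmu2 : (k.+1.*2).-primitive_root mu by rewrite doubleS -q_eq.
have mu_half := prim_half_root (ltn0Sn k) pmu2.
have kk : (0 < 1 < k.+1)%N by rewrite /= ltnS k_gt0.
have sum : \sum_(1 <= m < k.+1) (mu ^+ m + mu ^- m) * (-1) ^+ m = - 2 :> C.
  transitivity (\sum_(1 <= m < k.+1) ((- mu) ^+ m + (- mu) ^- m) : C).
    apply: eq_bigr => m _; rewrite (exprNn mu) invfM signV; ring.
  rewrite half_range_sum // ?(exprNn mu) ?mu_half.
  - by rewrite exprS e1; ring.
  - by rewrite -signr_odd odd_double mul1r (prim_expr_order pmu2).
  apply: contraNneq (prim_sqr_neq1 pmu2 kk) => E.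
  by rewrite expr1 -sqrrN E expr1n.
(* Here [b ^+ k.+1] acts as -1, so 1 is not an eigenvalue of b; the simple eigenvalue [mu] is used
   instead. *)
apply: (real_irr_of_odd_mult (s := true) (d := 1) (z := mu ^+ 1) (v1 := K)
 (F := fun m => (-1) ^+ m.+1) fI (row_class row) realf Gb Gw ww wt b_half (ltn0Sn k) _
 (zetaX_norm _ _) (row_1 row) _ _ (row_b row)) => //.
- by rewrite expr1 (prim_expr_order pmu2).
- by rewrite (row_z row) e1.
under eq_bigr => m _ do rewrite expr1 exprS mulN1r mulrN.
by rewrite sumrN sum expr1 mu_half -muln2 natrM -[k.+1%:R]natr1 invrN invr1; ring.
Qed.

Lemma half_even_real_irr : ~~ odd k ->
  [/\ real_irr_character G (xi1 R nu b), real_irr_character G (xi2 R nu b),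
     real_irr_character G (fun g => 2 * eta1 R nu b g) &
     real_irr_character G (fun g => 2 * eta2 R nu b g)].
Proof.
move=> ev; have Rrt := rt_real ev.
have [_ [xi1I xi2I] [eta1I eta2I]] := cuspidal_table_irr R q_pr q_odd nu_gen Gb ob.
have h1 : (1 + rt) / 2 \is Num.real by rewrite realM ?realV ?realD.
have h2 : (1 - rt) / 2 \is Num.real by rewrite realM ?realV ?realB.
have h3 : (-1 + rt) / 2 \is Num.real by rewrite realM ?realV ?realD ?rpredN.
have h4 : (-1 - rt) / 2 \is Num.real by rewrite realM ?realV ?realB ?rpredN.
split.
- exact: xi_type_real_irr ev xi1I _ _ (xi1_row R q_pr q_odd nu_gen Gb ob).
- exact: xi_type_real_irr ev xi2I _ _ (xi2_row R q_pr q_odd nu_gen Gb ob).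
- exact: eta_type_real_irr ev eta1I _ _ (eta1_row R q_pr q_odd nu_gen Gb ob).
exact: eta_type_real_irr ev eta2I _ _ (eta2_row R q_pr q_odd nu_gen Gb ob).
Qed.

Lemma nonreal_real_irr (f : GL -> C) g : irr_afforded f -> g \in G -> complex.Im (f g) != 0 ->
  real_irr_character G (fun g => (2 * complex.Re (f g))%:C%C).
Proof.
move=> [n [X [irrX fE]]] Gg nz; exists (n + n)%N, (realify_repr X); split.
  by apply: (realify_irr_of_nonreal irrX Gg); rewrite -fE.
by move=> h Gh /=; rewrite mxtrace_realify fE.
Qed.

Lemma half_odd_real_irr : odd k ->
  real_irr_character G (fun g => (2 * complex.Re (xi1 R nu b g))%:C%C) /\
  real_irr_character G (fun g => (2 * complex.Re (eta1 R nu b g))%:C%C).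
Proof.
move=> od; have [_ nzI] := rt_imag od.
have [_ [xi1I _] [eta1I _]] := cuspidal_table_irr R q_pr q_odd nu_gen Gb ob.
have Im2 (x : C) : complex.Im x != 0 -> complex.Im (x / 2) != 0.
  have -> : (2 : C)^-1 = (2^-1 : R)%:C%C by rewrite fmorphV rmorph_nat.
  by case: x => x y nz /=; rewrite mulr0 add0r mulf_neq0 // invr_eq0 pnatr_eq0.
split.
  apply: (nonreal_real_irr (g := low 1%g 1) xi1I (lower_SL2 _ _)).
  rewrite (row_c (xi1_row R q_pr q_odd nu_gen Gb ob)) /=; apply: Im2.
  by case: rt nzI => x y /= nz; rewrite add0r.
apply: (nonreal_real_irr (g := low 1%g 1) eta1I (lower_SL2 _ _)).
rewrite (row_c (eta1_row R q_pr q_odd nu_gen Gb ob)) /=; apply: Im2.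
by case: rt nzI => x y /= nz; rewrite oppr0 add0r.
Qed.
End SL2RealIrreducibles.

(** * Completeness *)

(** The pairing of the complex values is the image of the pairing computed over R, where a nonzero
    value already forces an isomorphism of the real representations. *)
Lemma real_irr_eq (R : realType) (gT : finGroupType) (G : {group gT}) (f h : gT -> R[i]) :
  real_irr_character G f -> real_irr_character G h -> pairing G f h != 0 -> {in G, f =1 h}.
Proof.
move=> [m [r [irr_r fE]]] [n [r' [irr_r' hE]]] nz.
have rr' : mx_rsim r r'.
  apply: pairing_neq0_rsim => //; apply: contra_neq nz => E.
  transitivity ((pairing G (fun g => \tr (r g)) (fun g => \tr (r' g)))%:C%C); last by rewrite E.
  rewrite /pairing rmorph_sum; apply: eq_bigr => g Gg.
  by rewrite fE // hE ?groupV // rmorphM.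
by move=> g Gg; rewrite fE // hE // (mxtrace_rsim rr').
Qed.

Lemma real_irr_complexify (R : realType) (gT : finGroupType) (G : {group gT}) (f : gT -> R[i]) :
  real_irr_character G f ->
  exists2 n, (0 < n)%N & exists r : mx_representation R[i] G n, {in G, forall g, f g = \tr (r g)}.
Proof.
move=> [n [r [/mx_irrP[n_gt0 _] fE]]]; exists n => //.
exists (map_repr (real_complex R) r) => g Gg.
by rewrite fE // map_reprE trace_map_mx.
Qed.

Section DegreeSum.
Variables (C : numFieldType) (q : nat) (nu : {unit 'F_q}) (b : GL2fin q).
Hypotheses (q_pr : prime q) (q_odd : odd q).
Hypothesis nu_gen : generator [set: {unit 'F_q}] nu.
Hypotheses (Gb : b \in SL2_group q) (ob : #[b]%g = q.+1).
Local Notation GL := (GL2fin q).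
Local Notation G := (SL2_group q).
Local Notation k := ((q - 1)./2).
Local Notation Q := (q%:R : C).
Local Notation K := (k%:R : C).
Local Notation e := ((-1) ^+ k : C).
Let k_gt0 : (0 < k)%N := k_gt0 q_pr q_odd.
Let q_eq : q = k.*2.+1 := q_eq q_pr q_odd.
Let Q_eq : Q = 2 * K + 1 := Q_eq C q_pr q_odd.
Let cardG : #|G|%:R = 2 * K * Q * (Q + 1) := card_SL2R C q_pr q_odd.

Variables (om mu rt : C) (St X1 X2 E1 E2 : GL -> C) (Pr Cu : nat -> GL -> C).
Hypotheses (pom : (k.*2).-primitive_root om) (pmu : q.+1.-primitive_root mu).
Hypothesis rowS : has_row nu b St (RowData Q Q 0 0 0 0 (fun=> 1) (fun=> -1)).
Hypothesis rowP : forall i, has_row nu b (Pr i)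
  (RowData (Q + 1) ((-1) ^+ i * (Q + 1)) 1 1 ((-1) ^+ i) ((-1) ^+ i)
     (fun l => om ^+ (i * l) + om ^- (i * l)) (fun=> 0)).
Hypothesis rowC : forall j, has_row nu b (Cu j)
  (RowData (Q - 1) ((-1) ^+ j * (Q - 1)) (-1) (-1) (- (-1) ^+ j) (- (-1) ^+ j) (fun=> 0)
     (fun m => - (mu ^+ (j * m) + mu ^- (j * m)))).
Hypothesis rowX1 : has_row nu b X1
  (RowData (K + 1) (e * (K + 1)) ((1 + rt) / 2) ((1 - rt) / 2)
    (e * ((1 + rt) / 2)) (e * ((1 - rt) / 2)) (fun l => (-1) ^+ l) (fun=> 0)).
Hypothesis rowX2 : has_row nu b X2
  (RowData (K + 1) (e * (K + 1)) ((1 - rt) / 2) ((1 + rt) / 2)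
    (e * ((1 - rt) / 2)) (e * ((1 + rt) / 2)) (fun l => (-1) ^+ l) (fun=> 0)).
Hypothesis rowE1 : has_row nu b E1
  (RowData K (- e * K) ((-1 + rt) / 2) ((-1 - rt) / 2)
    (- e * ((-1 + rt) / 2)) (- e * ((-1 - rt) / 2)) (fun=> 0) (fun m => (-1) ^+ m.+1)).
Hypothesis rowE2 : has_row nu b E2
  (RowData K (- e * K) ((-1 - rt) / 2) ((-1 + rt) / 2)
    (- e * ((-1 - rt) / 2)) (- e * ((-1 + rt) / 2)) (fun=> 0) (fun m => (-1) ^+ m.+1)).

(** The two characters of type xi, and likewise those of type eta, enter only through their sum, so
    the same identity serves both residues of q modulo 4. *)
Definition degree_sum (g : GL) : C :=
  1 + Q * St g + \sum_(1 <= i < k) (Q + 1) * Pr i g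
  + \sum_(1 <= j < k.+1) (Q - 1) * Cu j g
  + ((K + 1) * (X1 g + X2 g) + K * (E1 g + E2 g)).

Lemma degree_sum_row : has_row nu b degree_sum (RowData #|G|%:R 0 0 0 0 0 (fun=> 0) (fun=> 0)).
Proof.
have cst x := has_row_const nu b (x : C).
have scale x f r (fr : has_row nu b f r) := has_rowM (cst x) fr.
have A := has_row_bigsum (index_iota 1 k) (P := xpredT)
  (fun i _ => scale (Q + 1) _ _ (rowP i)).
have B := has_row_bigsum (index_iota 1 k.+1) (P := xpredT)
  (fun j _ => scale (Q - 1) _ _ (rowC j)).
have X := scale (K + 1) _ _ (has_rowD rowX1 rowX2).
have E := scale K _ _ (has_rowD rowE1 rowE2).
have S := scale Q _ _ rowS.
have kS1 : (k.+1 - 1 = k)%N by rewrite subSS subn0.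
have sumA (x : C) : \sum_(1 <= i < k) x = (K - 1) * x.
  by rewrite sumr_const_nat -(mulr_natr _ (k - 1)) natrB // mulrC.
have sumB (x : C) : \sum_(1 <= j < k.+1) x = K * x.
  by rewrite sumr_const_nat kS1 mulr_natl.
have sgA := sum_sign C k_gt0.
have sgB : \sum_(1 <= j < k.+1) (-1) ^+ j = (-1 + e) / 2 by rewrite sum_sign // exprS; ring.
have pmu2 : (k.+1.*2).-primitive_root mu by rewrite doubleS -q_eq.
have sumAa l : (0 < l < k)%N ->
    \sum_(1 <= i < k) (Q + 1) * (om ^+ (i * l) + om ^- (i * l)) = (Q + 1) * (- 1 - (-1) ^+ l).
  move=> ll; have n1 : om ^+ l != 1.
    by apply: contraNneq (prim_sqr_neq1 pom ll) => ->; rewrite expr1n.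
  have zk : (om ^+ l) ^+ k.*2 = 1 by rewrite exprAC (prim_expr_order pom) expr1n.
  have := half_range_sum k_gt0 zk n1; rewrite exprAC (prim_half_root k_gt0 pom) => <-.
  by rewrite mulr_sumr; apply: eq_bigr => i _; rewrite mulnC exprM.
have sumBb m : (0 < m <= k)%N ->
    \sum_(1 <= j < k.+1) (Q - 1) * - (mu ^+ (j * m) + mu ^- (j * m)) = (Q - 1) * (1 + (-1) ^+ m).
  move=> mm; have n1 : mu ^+ m != 1.
    by apply: contraNneq (prim_sqr_neq1 pmu2 (mm : 0 < m < k.+1)%N) => ->; rewrite expr1n.
  have zk : (mu ^+ m) ^+ k.+1.*2 = 1 by rewrite exprAC (prim_expr_order pmu2) expr1n.
  have := half_range_sum (ltn0Sn k) zk n1; rewrite exprAC (prim_half_root (ltn0Sn k) pmu2) => E'.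
  transitivity (- (Q - 1) * (- 1 - (-1) ^+ m)); last by ring.
  rewrite -E' mulr_sumr; apply: eq_bigr => i _; rewrite [(i * m)%N]mulnC exprM; ring.
have sumAs (x : C) : \sum_(1 <= i < k) (Q + 1) * ((-1) ^+ i * x) = (Q + 1) * ((-1 - e) / 2 * x).
  by rewrite -sgA mulr_suml mulr_sumr.
have sumBs (x : C) : \sum_(1 <= j < k.+1) (Q - 1) * ((-1) ^+ j * x) = (Q - 1) * ((-1 + e) / 2 * x).
  by rewrite -sgB mulr_suml mulr_sumr.
have sumA1 : \sum_(1 <= i < k) (Q + 1) * (-1) ^+ i = (Q + 1) * ((-1 - e) / 2).
  by rewrite -sgA mulr_sumr.
have sumB1 : \sum_(1 <= j < k.+1) (Q - 1) * - (-1) ^+ j = - ((Q - 1) * ((-1 + e) / 2)).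
  rewrite -sgB mulr_sumr -sumrN.
  by apply: eq_bigr => j _; rewrite mulrN.
rewrite /= in S A B X E.
have D1 := has_rowD (cst 1) S; have D2 := has_rowD D1 A; rewrite /= in D2.
have D3 := has_rowD D2 B; have D4 := has_rowD X E; rewrite /= in D3 D4.
have row := has_rowD D3 D4.
apply: (has_row_ext row).
  by split; rewrite /= ?sumA ?sumB ?sumAs ?sumBs ?sumA1 ?sumB1 ?cardG Q_eq; field.
split=> [|l ll|m mm]; rewrite /= ?sumA1 ?sumB1 ?mulr0 ?sumr0 ?big1_eq.
- by rewrite Q_eq; field.
- by rewrite sumAa // Q_eq; ring.
by rewrite sumBb // Q_eq exprS; ring.
Qed.

Lemma pairing_degree_sum (f : GL -> C) : @class_function C q f ->
  pairing G degree_sum f = #|G|%:R * f 1%g.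
Proof.
move=> cf; have frow : has_row nu b f (RowData (f 1%g) (f (sz q)) (f (low 1%g 1))
   (f (low 1%g (val nu))) (f (sz q * low 1%g 1%R)%g) (f (sz q * low 1%g (val nu))%g)
   (fun l => f (low nu 0 ^+ l)%g) (fun m => f (b ^+ m)%g)) by split.
rewrite (pairing_has_row q_pr q_odd nu_gen Gb ob degree_sum_row frow) /inv_row.
by case: (odd k); rewrite /= !mul0r !addr0 mul0rn !big1 ?mul0rn ?addr0 // => l _; rewrite mul0r.
Qed.
End DegreeSum.

Section Completeness.
Variables (R : realType) (q : nat) (nu : {unit 'F_q}) (b : GL2fin q).
Hypotheses (q_pr : prime q) (q_odd : odd q).
Hypothesis nu_gen : generator [set: {unit 'F_q}] nu.
Hypotheses (Gb : b \in SL2_group q) (ob : #[b]%g = q.+1).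
Local Notation C := R[i].
Local Notation GL := (GL2fin q).
Local Notation G := (SL2_group q).
Local Notation k := ((q - 1)./2).

Lemma pairingDl (f1 f2 h : GL -> C) :
  pairing G (fun g => f1 g + f2 g) h = pairing G f1 h + pairing G f2 h.
Proof. by rewrite /pairing -big_split; apply: eq_bigr => g _; rewrite mulrDl. Qed.

Lemma pairingZl (a : C) (f h : GL -> C) :
  pairing G (fun g => a * f g) h = a * pairing G f h.
Proof. by rewrite /pairing mulr_sumr; apply: eq_bigr => g _; rewrite mulrA. Qed.

Lemma pairing_big (s : seq nat) (f : nat -> GL -> C) (h : GL -> C) :
  pairing G (fun g => \sum_(i <- s) f i g) h = \sum_(i <- s) pairing G (f i) h.
Proof.
by rewrite /pairing exchange_big; apply: eq_bigr => g _; rewrite mulr_suml.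
Qed.

Lemma irr_constituent (f : GL -> C) : @class_function C q f -> f 1%g != 0 ->
  [\/ pairing G (fun=> 1) f != 0 \/ pairing G (psi R nu b) f != 0,
      (exists2 i, (0 < i < k)%N & pairing G (chi R nu b i) f != 0) \/
      (exists2 j, (0 < j <= k)%N & pairing G (theta R nu b j) f != 0),
      pairing G (fun g => xi1 R nu b g + xi2 R nu b g) f != 0 |
      pairing G (fun g => eta1 R nu b g + eta2 R nu b g) f != 0].
Proof.
move=> cf nzf1; apply: contrapT => none.
have p1 : pairing G (fun=> 1) f = 0.
  by apply/eqP; apply: contrapT => /negP nz; apply: none; apply: Or41; left.
have pS : pairing G (psi R nu b) f = 0.
  by apply/eqP; apply: contrapT => /negP nz; apply: none; apply: Or41; right.
have pP i : (0 < i < k)%N -> pairing G (chi R nu b i) f = 0.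
  by move=> ii; apply/eqP; apply: contrapT => /negP nz; apply: none; apply: Or42; left; exists i.
have pC j : (0 < j <= k)%N -> pairing G (theta R nu b j) f = 0.
  by move=> jj; apply/eqP; apply: contrapT => /negP nz; apply: none; apply: Or42; right; exists j.
have pX : pairing G (fun g => xi1 R nu b g + xi2 R nu b g) f = 0.
  by apply/eqP; apply: contrapT => /negP nz; apply: none; apply: Or43.
have pE : pairing G (fun g => eta1 R nu b g + eta2 R nu b g) f = 0.
  by apply/eqP; apply: contrapT => /negP nz; apply: none; apply: Or44.
have : #|G|%:R * f 1%g = 0.
  rewrite -(pairing_degree_sum q_pr q_odd nu_gen Gb ob
    (zeta_prim_split R q_pr q_odd) (zeta_prim_nonsplit R q)
    (psi_row R q_pr q_odd nu_gen Gb ob) (chi_row R q_pr q_odd nu_gen Gb ob)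
    (theta_row R q_pr q_odd nu_gen Gb ob) (xi1_row R q_pr q_odd nu_gen Gb ob)
    (xi2_row R q_pr q_odd nu_gen Gb ob) (eta1_row R q_pr q_odd nu_gen Gb ob)
    (eta2_row R q_pr q_odd nu_gen Gb ob) cf).
  rewrite /degree_sum !pairingDl !pairing_big !pairingZl p1 pS pX pE !mulr0 !addr0 !add0r.
  rewrite !big_nat !big1 ?addr0 // => i ii; rewrite pairingZl ?pP ?pC ?mulr0 //.
by move/eqP; rewrite mulf_eq0 (negbTE nzf1) orbF pnatr_eq0 eqn0Ngt cardG_gt0.
Qed.
End Completeness.

Lemma mod4_even q : prime q -> odd q -> q = 1 %[mod 4] <-> ~~ odd ((q - 1)./2).
Proof.
move=> q_pr q_odd; rewrite {1}(q_eq q_pr q_odd); move: (_./2) => k.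
have := odd_double_half k; case: (odd k) => /= <-;
  by split=> // E; lia.
Qed.

Lemma mod4_odd q : prime q -> odd q -> q = 3 %[mod 4] <-> odd ((q - 1)./2).
Proof.
move=> q_pr q_odd; rewrite {1}(q_eq q_pr q_odd); move: (_./2) => k.
have := odd_double_half k; case: (odd k) => /= <-;
  by split=> // E; lia.
Qed.

(** * Classification of the real irreducible characters *)

Section MainTheorem.
Variables (R : realType) (q : nat) (nu : {unit 'F_q}) (b : GL2fin q).
Hypotheses (q_pr : prime q) (q_odd : odd q).
Hypothesis nu_gen : generator [set: {unit 'F_q}] nu.
Hypotheses (Gb : b \in SL2_group q) (ob : #[b]%g = q.+1).
Local Notation C := R[i].
Local Notation GL := (GL2fin q).
Local Notation G := (SL2_group q).
Local Notation k := ((q - 1)./2).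
Local Notation rt := (sqrt_eps_q R q).

Lemma has_row_conj (f : GL -> C) (v1 vz vc vd vzc vzd : C) (va vb : nat -> C) :
  has_row nu b f (RowData v1 vz vc vd vzc vzd va vb) ->
  has_row nu b (fun g => (f g)^*%C)
    (RowData v1^*%C vz^*%C vc^*%C vd^*%C vzc^*%C vzd^*%C
       (fun l => (va l)^*%C) (fun m => (vb m)^*%C)).
Proof.
case=> cf f1 fz fc fd fzc fzd fa fb.
split; rewrite ?f1 ?fz ?fc ?fd ?fzc ?fzd //.
- by move=> g x Gg Gx; rewrite cf.
- by move=> l ll; rewrite fa.
by move=> m mm; rewrite fb.
Qed.

Lemma two_Re (x y : C) : x^*%C = y -> (2 * complex.Re x)%:C%C = x + y.
Proof. by move <-; rewrite addcJ rmorphM rmorph_nat. Qed.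

(** For odd k the root [rt] is purely imaginary, so complex conjugation changes its sign and carries
    the row of [xi1] to that of [xi2], and the row of [eta1] to that of [eta2]. *)
Lemma two_Re_half : odd k ->
  {in G, forall g, (2 * complex.Re (xi1 R nu b g))%:C%C = xi1 R nu b g + xi2 R nu b g} /\
  {in G, forall g, (2 * complex.Re (eta1 R nu b g))%:C%C = eta1 R nu b g + eta2 R nu b g}.
Proof.
move=> od; have [re0 _] := rt_imag R q_pr od.
have rtJ : rt^*%C = - rt by move: re0; case: rt => x y /= ->; rewrite -[LHS]/(Complex 0 (- y)) -{1}oppr0.
have signJ n : ((-1) ^+ n : C)^*%C = (-1) ^+ n by rewrite (rmorph_sign (@conjc R)).
have natJ n : (n%:R : C)^*%C = n%:R by rewrite (rmorph_nat (@conjc R)).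
have halfJ : (2^-1 : C)^*%C = 2^-1 by rewrite (fmorphV (@conjc R)); congr _^-1; apply: (natJ 2).
have MJ (x y : C) : (x * y)^*%C = x^*%C * y^*%C by rewrite (rmorphM (@conjc R)).
have DJ (x y : C) : (x + y)^*%C = x^*%C + y^*%C by rewrite (rmorphD (@conjc R)).
have NJ (x : C) : (- x)^*%C = - x^*%C by rewrite (rmorphN (@conjc R)).
have row_eq := @has_row_eq C _ _ _ q_pr q_odd nu_gen Gb ob.
split=> g Gg; apply: two_Re; move: g Gg.
  apply: (row_eq _ _ _ _ (has_row_conj (xi1_row R q_pr q_odd nu_gen Gb ob))
    (xi2_row R q_pr q_odd nu_gen Gb ob)); split=> *;
  by rewrite /at_1 /at_z /at_c /at_d /at_zc /at_zd /at_a /at_b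
    ?MJ ?halfJ ?DJ ?NJ ?natJ ?signJ ?conjc1 ?conjc0 ?rtJ ?opprK.
apply: (row_eq _ _ _ _ (has_row_conj (eta1_row R q_pr q_odd nu_gen Gb ob))
  (eta2_row R q_pr q_odd nu_gen Gb ob)); split=> *;
by rewrite /at_1 /at_z /at_c /at_d /at_zc /at_zd /at_a /at_b
  ?MJ ?halfJ ?DJ ?NJ ?natJ ?signJ ?conjc1 ?conjc0 ?rtJ ?opprK.
Qed.

Lemma trivial_real_irr : real_irr_character G (fun=> 1 : C).
Proof.
exists 1%N, (trivial_repr q R); split; first by apply/mx_abs_irrW/linear_mx_abs_irr.
by move=> g _; rewrite mxtrace_trivial.
Qed.
End MainTheorem.

Local Open Scope complex_scope.

Theorem lemma3 (R : realType) (q : nat) (nu : {unit 'F_q}) (b : {'GL_2(q)}) :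
  prime q -> odd q ->
  generator [set: {unit 'F_q}] nu ->
  b \in SL2 q -> #[b]%g = q.+1 ->
  (forall f : {'GL_2(q)} -> R[i],
    real_irr_character (SL2_group q) f <->
    [\/ {in SL2 q, forall g, f g = 1} \/ {in SL2 q, f =1 psi R nu b},
        (exists i : nat, (1 <= 2 * i <= (q - 3)./2)%N /\
           {in SL2 q, f =1 chi R nu b (2 * i)}) \/
        (exists i' : nat, (1 <= 2 * i' + 1 <= (q - 3)./2)%N /\
           {in SL2 q, forall g, f g = 2 * chi R nu b (2 * i' + 1) g}),
        (exists j : nat, (1 <= 2 * j <= (q - 1)./2)%N /\
           {in SL2 q, f =1 theta R nu b (2 * j)}) \/
        (exists j' : nat, (1 <= 2 * j' + 1 <= (q - 1)./2)%N /\
           {in SL2 q, forall g, f g = 2 * theta R nu b (2 * j' + 1) g})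
      | (q = 1 %[mod 4] /\
           [\/ {in SL2 q, f =1 xi1 R nu b},
               {in SL2 q, f =1 xi2 R nu b},
               {in SL2 q, forall g, f g = 2 * eta1 R nu b g}
             | {in SL2 q, forall g, f g = 2 * eta2 R nu b g}]) \/
        (q = 3 %[mod 4] /\
           ({in SL2 q, forall g, f g = (2 * complex.Re (xi1 R nu b g))%:C} \/
            {in SL2 q, forall g, f g = (2 * complex.Re (eta1 R nu b g))%:C}))])
  /\
  (q = 3 %[mod 4] ->
     {in SL2 q, forall g,
        (2 * complex.Re (xi1 R nu b g))%:C = xi1 R nu b g + xi2 R nu b g} /\
     {in SL2 q, forall g,
        (2 * complex.Re (eta1 R nu b g))%:C = eta1 R nu b g + eta2 R nu b g}).
Proof.
move=> q_pr q_odd nu_gen Gb ob; split=> [f|]; last first.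
  move=> q3; have od : odd ((q - 1)./2) by apply/(mod4_odd q_pr q_odd).
  have [hx he] := two_Re_half R q_pr q_odd nu_gen Gb ob od.
  by split=> g Gg; [apply: hx | apply: he].
have q3 := half_q3 q_pr q_odd; have k0 := k_gt0 q_pr q_odd.
have even2 i : odd (2 * i) = false by rewrite mul2n odd_double.
have odd2 i : odd (2 * i + 1) = true by rewrite oddD even2.
have parity i : i = (2 * i./2 + odd i)%N by rewrite mul2n addnC odd_double_half.
have sym (h h' : GL2fin q -> R[i]) : {in SL2 q, h =1 h'} -> {in SL2_group q, h' =1 h}.
  by move=> hh' g Gg; rewrite hh'.
have chiR := chi_real_irr R q_pr q_odd nu_gen Gb ob.
have thetaR := theta_real_irr R q_pr q_odd nu_gen Gb ob.
split=> [rf|].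
  have [n n_gt0 [r fE]] := real_irr_complexify rf.
  have cf : @class_function _ q f.
    move=> g x Gg Gx; rewrite !fE ?groupJ // !repr_mxM ?groupM ?groupV // mulmxA.
    by rewrite mxtrace_mulC mulmxA -repr_mxM ?groupV // mulgV repr_mx1 mul1mx.
  have nzf1 : f 1%g != 0.
    by rewrite fE ?group1 // repr_mx1 mxtrace1 pnatr_eq0 -lt0n.
  (* A multiple of a row pairs with f nontrivially when the row does, so f coincides on the group
     with whichever multiple is a real irreducible character. *)
  have scaled (c : R[i]) h : c != 0 -> pairing (SL2_group q) h f != 0 ->
      real_irr_character (SL2_group q) (fun g => c * h g) -> {in SL2 q, forall g, f g = c * h g}.
    move=> nzc nz rh; apply: (real_irr_eq rf rh).
    by rewrite pairingC pairingZl mulf_neq0.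
  have plain h : pairing (SL2_group q) h f != 0 ->
      real_irr_character (SL2_group q) h -> {in SL2 q, f =1 h}.
    by move=> nz rh; apply: (real_irr_eq rf rh); rewrite pairingC.
  have nz2 : (2 : R[i]) != 0 by rewrite pnatr_eq0.
  have [[nz|nz]|[[i ii nz]|[j jj nz]]|nz|nz] :=
    irr_constituent q_pr q_odd nu_gen Gb ob cf nzf1.
  - by apply: Or41; left; apply: plain nz (trivial_real_irr _ _).
  - by apply: Or41; right; apply: plain nz (psi_real_irr R q_pr q_odd nu_gen Gb ob).
  - have rchi := chiR i ii; apply: Or42.
    have ile : (0 < i <= (q - 3)./2)%N by rewrite q3; clear -ii k0; lia.
    rewrite (parity i) in ile nz rchi; case: (odd i) rchi ile nz => rchi ile nz; [right | left].
      exists i./2; split=> //; apply: scaled nz2 nz _.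
      by rewrite odd2 in rchi.
    exists i./2; rewrite addn0 in ile nz rchi; split=> //; apply: plain nz _.
    by rewrite even2 in rchi; apply: real_irr_ext rchi => g _; rewrite mul1r.
  - have rth := thetaR j jj; apply: Or43.
    rewrite (parity j) in jj nz rth; case: (odd j) rth jj nz => rth jj nz; [right | left].
      exists j./2; split=> //; apply: scaled nz2 nz _.
      by rewrite odd2 in rth.
    exists j./2; rewrite addn0 in jj nz rth; split=> //; apply: plain nz _.
    by rewrite even2 in rth; apply: real_irr_ext rth => g _; rewrite mul1r.
  - apply: Or44; case: (boolP (odd ((q - 1)./2))) => [od|ev]; [right | left]; split.
    + exact/mod4_odd.
    + have [hx _] := two_Re_half R q_pr q_odd nu_gen Gb ob od; left.
      have [rx _] := half_odd_real_irr R q_pr q_odd nu_gen Gb ob od.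
      apply: plain rx; rewrite (@eq_pairing _ _ _ _ (fun g => xi1 R nu b g + xi2 R nu b g) _ f) //.
    + exact/mod4_even.
    have [r1 r2 _ _] := half_even_real_irr R q_pr q_odd nu_gen Gb ob ev.
    rewrite pairingDl in nz.
    (* For even k only the sum is known to pair nontrivially with f; if the first summand pairs to
       zero, the second does not. *)
    case: (eqVneq (pairing (SL2_group q) (xi1 R nu b) f) 0) => [z1|nz1]; last first.
      by apply: Or41; apply: plain nz1 r1.
    by apply: Or42; apply: plain r2; rewrite z1 add0r in nz.
  apply: Or44; case: (boolP (odd ((q - 1)./2))) => [od|ev]; [right | left]; split.
  - exact/mod4_odd.
  - have [_ he] := two_Re_half R q_pr q_odd nu_gen Gb ob od; right.
    have [_ re] := half_odd_real_irr R q_pr q_odd nu_gen Gb ob od.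
    apply: plain re; rewrite (@eq_pairing _ _ _ _ (fun g => eta1 R nu b g + eta2 R nu b g) _ f) //.
  - exact/mod4_even.
  have [_ _ r1 r2] := half_even_real_irr R q_pr q_odd nu_gen Gb ob ev.
  rewrite pairingDl in nz.
  case: (eqVneq (pairing (SL2_group q) (eta1 R nu b) f) 0) => [z1|nz1]; last first.
    by apply: Or43; apply: scaled nz2 nz1 r1.
  by apply: Or44; apply: scaled nz2 _ r2; rewrite z1 add0r in nz.
have chi_lt i : (i <= (q - 3)./2)%N -> (i < (q - 1)./2)%N.
  by rewrite q3; clear -k0; lia.
case=> [[fE|fE]|[[i [ii fE]]|[i [ii fE]]]|[[j [jj fE]]|[j [jj fE]]]|[[/(mod4_even q_pr q_odd) ev fE]|
  [/(mod4_odd q_pr q_odd) od fE]]].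
- exact: real_irr_ext (sym _ _ fE) (trivial_real_irr _ _).
- exact: real_irr_ext (sym _ _ fE) (psi_real_irr R q_pr q_odd nu_gen Gb ob).
- case/andP: ii => i0 ii; have := chiR (2 * i)%N; rewrite even2 i0 chi_lt // => /(_ isT) rchi.
  by apply: real_irr_ext rchi => g Gg; rewrite mul1r fE.
- case/andP: ii => i0 ii; have := chiR (2 * i + 1)%N; rewrite odd2 i0 chi_lt // => /(_ isT) rchi.
  exact: real_irr_ext (sym _ _ fE) rchi.
- have := thetaR _ jj; rewrite even2 => rth.
  by apply: real_irr_ext rth => g Gg; rewrite mul1r fE.
- have := thetaR _ jj; rewrite odd2 => rth.
  exact: real_irr_ext (sym _ _ fE) rth.
- have [r1 r2 r3 r4] := half_even_real_irr R q_pr q_odd nu_gen Gb ob ev.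
  case: fE => fE.
  + exact: real_irr_ext (sym _ _ fE) r1.
  + exact: real_irr_ext (sym _ _ fE) r2.
  + exact: real_irr_ext (sym _ _ fE) r3.
  exact: real_irr_ext (sym _ _ fE) r4.
have [rx re] := half_odd_real_irr R q_pr q_odd nu_gen Gb ob od.
by case: fE => fE; [apply: real_irr_ext (sym _ _ fE) rx | apply: real_irr_ext (sym _ _ fE) re].
Qed.
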